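(* Let $\tilde w=s_{\beta_1}\cdots s_{\beta_r}$ be an expression (not necessarily reduced) in simple reflections of the Weyl group of a Kac-Moody group $G$. The toric limit $Y_{\tilde w}$ is Fano if and only if every extremal ray in $\overline{NE}(Y_{\tilde w})$ is Mori.
   Context: We work over $\mathbb C$. $G$ is a Kac-Moody group; the $\beta_i$ are simple roots and $\beta_{ij}:=\langle\beta_j,\check\beta_i\rangle$, with $\check\beta_i$ the coroot of $\beta_i$. The toric limit $Y_{\tilde w}$ (the special fibre of a toric degeneration of the Bott-Samelson-Demazure-Hansen variety $Z(\tilde w)$) is the smooth projective toric variety whose fan in $\mathbb R^r$ has as cones those generated by subsets of $\{e_1^{\pm},\dots,e_r^{\pm}\}$ containing no pair $\{e_i^+,e_i^-\}$, where $e_1^+,\dots,e_r^+$ is the standard basis of $\mathbb Z^r$ and $e_i^-:=-e_i^+-\sum_{j>i}\beta_{ij}e_j^+$. A smooth projective variety $X$ is Fano if $-K_X$ is ample. The Mori cone $\overline{NE}(X)$ is the closure in $N_1(X)$ (real 1-cycles modulo numerical equivalence) of the convex cone generated by classes of irreducible curves. An extremal ray is a one-dimensional subcone $R$ of $\overline{NE}(X)$ such that $u,v\in\overline{NE}(X)$, $u+v\in R$ imply $u,v\in R$; it is called Mori if $R\cdot K_X<0$. *)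

(* Defs.v *)
(* Classical points-and-functions model, over the complex numbers C = R[i], of
   the toric variety of a smooth complete fan; its line bundles, ampleness,
   canonical bundle, curves, intersection numbers and Mori cone. *)
From HB Require Import structures.
From mathcomp Require Import all_boot all_order all_algebra.
From mathcomp Require Import complex.
From mathcomp Require Import all_classical all_reals all_analysis.
From mathcomp Require mpoly.

Set Implicit Arguments.
Unset Strict Implicit.
Unset Printing Implicit Defensive.

Import Order.TTheory GRing.Theory Num.Theory.
Import numFieldNormedType.Exports.

Local Open Scope classical_set_scope.
Local Open Scope ring_scope.

(* Tits' root datum of a Kac-Moody group: a lattice Z^d (row vectors) with
   simple roots, the dual lattice (column vectors) with simple coroots, such
   that the pairings form a generalized Cartan matrix. *)
Record km_root_datum := KMRootDatum {
  km_size : nat;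
  km_rank : nat;
  root : 'I_km_size -> 'rV[int]_km_rank;
  coroot : 'I_km_size -> 'cV[int]_km_rank;
  cartan := fun i j : 'I_km_size => (root j *m coroot i) 0 0 : int;
  _ : forall i, cartan i i = 2;
  _ : forall i j, i != j -> cartan i j <= 0;
  _ : forall i j, cartan i j = 0 -> cartan j i = 0
}.

(* A simplicial fan in R^r: primitive ray generators, and the cones, each given
   by its set of rays. *)
Record fan (r : nat) := Fan {
  ridx : finType;
  ray : ridx -> 'rV[int]_r;
  cones : {set {set ridx}}
}.

(* Column vectors are characters (elements of the dual lattice M). *)
Definition pairing r (u : 'rV[int]_r) (m : 'cV[int]_r) : int := (u *m m) 0 0.

Section ToricVariety.
Variables (R : realType) (r : nat) (X : fan r).

Local Notation C := (R[i])%C.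
Local Notation M := 'cV[int]_r.
Local Notation cone := {set ridx X}.

Definition dual_cone (A : cone) (m : M) : bool :=
  [forall u in A, 0 <= pairing (ray u) m].

Definition perp_cone (A : cone) (m : M) : bool :=
  [forall u in A, pairing (ray u) m == 0].

(* A K-point of the toric variety.  On U_A = Spec C[A^dual /\ M] it is a
   semigroup homomorphism from A^dual /\ M to K, for multiplication.  By the orbit-cone
   correspondence every point lies in the torus orbit of a unique cone A, where
   A is the smallest cone with the point in U_A; being in that orbit means that
   the homomorphism is nonzero exactly on A^perp.  [pt_val] is extended by 0
   outside A^dual, so that distinct terms are distinct points. *)
Record kpoint (K : fieldType) := KPoint {
  pt_cone : cone;
  pt_val : M -> K;
  _ : pt_cone \in cones X;
  _ : pt_val 0 = 1;
  _ : forall m m', dual_cone pt_cone m -> dual_cone pt_cone m' ->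
        pt_val (m + m') = pt_val m * pt_val m';
  _ : forall m, (pt_val m != 0) = perp_cone pt_cone m
}.

(* The point x lies in the affine open U_A. *)
Definition in_chart (K : fieldType) (A : cone) (x : kpoint K) : bool :=
  pt_cone x \subset A.

(* The U_A for r-dimensional A cover the variety when the fan is complete. *)
Definition chart (A : cone) : bool := (A \in cones X) && (#|A| == r).

(* The list of the (a, m) stands for the Laurent polynomial sum of the
   a * chi^m. *)
Definition laurent : Type := seq (C * M).

Definition lmul (p q : laurent) : laurent :=
  [seq (s.1 * t.1, s.2 + t.2) | s <- p, t <- q].

Definition lexp (p : laurent) (n : nat) : laurent :=
  iter n (lmul p) [:: (1, 0)].

Definition regular_on (A : cone) (p : laurent) : bool :=
  all (fun t => dual_cone A t.2) p.

(* Meaningful for x in U_A and p regular on U_A. *)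
Definition eval (K : fieldType) (iota : {rmorphism C -> K}) (x : kpoint K)
  (p : laurent) : K := \sum_(t <- p) iota t.1 * pt_val x t.2.

Local Notation "p @@ x" := (eval (@idfun C : {rmorphism C -> C}) x p)
  (at level 30, no associativity).

(* Line bundles are given by transition functions on the cover by the charts:
   charts are isomorphic to affine r-space, on which all line bundles are
   trivial.  A section is a family s with s_A = L_{AB} s_B. *)
Definition cocycle : Type := cone -> cone -> laurent.

Definition is_line_bundle (L : cocycle) : Prop :=
  [/\ forall A B, chart A -> chart B -> regular_on (A :&: B) (L A B),
      forall A, chart A -> forall x : kpoint C, in_chart A x -> L A A @@ x = 1
    & forall A B D, chart A -> chart B -> chart D ->
      forall x : kpoint C, in_chart A x -> in_chart B x -> in_chart D x ->
        L A D @@ x = (L A B @@ x) * (L B D @@ x)].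

Definition lb_dual (L : cocycle) : cocycle := fun A B => L B A.

Definition lb_exp (L : cocycle) (n : nat) : cocycle :=
  fun A B => lexp (L A B) n.

Definition is_section (L : cocycle) (s : cone -> laurent) : Prop :=
  (forall A, chart A -> regular_on A (s A)) /\
  (forall A B, chart A -> chart B ->
   forall x : kpoint C, in_chart A x -> in_chart B x ->
     s A @@ x = (L A B @@ x) * (s B @@ x)).

Definition zariski_closed (Z : set (kpoint C)) : Prop :=
  forall A, chart A -> exists F : set laurent,
    (forall p, F p -> regular_on A p) /\
    (forall x, in_chart A x -> (Z x <-> forall p, F p -> p @@ x = 0)).

Section ProjectiveMorphism.
Variables (N : nat) (s : 'I_N.+1 -> cone -> laurent).

(* Homogeneous coordinates of the image of x, in the trivialisation over A. *)
Definition hcoord (A : cone) (x : kpoint C) : 'I_N.+1 -> C :=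
  fun i => s i A @@ x.

(* The class of the nonzero vector p is the image of x in P^N. *)
Definition hits (p : 'I_N.+1 -> C) (x : kpoint C) : Prop :=
  exists A, exists2 c : C, [/\ chart A, in_chart A x & c != 0] &
    forall i, p i = c * hcoord A x i.

Definition generates : Prop :=
  forall A x, chart A -> in_chart A x -> exists i, hcoord A x i != 0.

Definition injective_morphism : Prop :=
  forall x y p, hits p x -> hits p y -> x = y.

Definition homogeneous (d : nat) (f : mpoly.mpoly N.+1 C) : bool :=
  all (fun m => mpoly.mdeg m == d) (mpoly.msupp f).

Definition closed_morphism : Prop :=
  forall Z, zariski_closed Z -> exists F : set (mpoly.mpoly N.+1 C),
    (forall f, F f -> exists d, homogeneous d f) /\
    (forall p : 'I_N.+1 -> C, (exists i, p i != 0) ->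
      ((forall f, F f -> mpoly.meval p f = 0) <-> exists2 x, Z x & hits p x)).

(* Surjectivity of the local homomorphism O_{P^N, phi(x)} -> O_{X, x} at every
   x: each germ a / b is some (P / Q) o phi.  The equality of germs is cleared
   of denominators; as the variety is integral it holds on all of U_A. *)
Definition stalk_surjective : Prop :=
  forall A x, chart A -> in_chart A x ->
  forall a b : laurent, regular_on A a -> regular_on A b -> b @@ x != 0 ->
  exists d, exists P, exists Q : mpoly.mpoly N.+1 C,
    [/\ homogeneous d P, homogeneous d Q,
        mpoly.meval (hcoord A x) Q != 0
      & forall y, in_chart A y ->
          (a @@ y) * mpoly.meval (hcoord A y) Q =
          (b @@ y) * mpoly.meval (hcoord A y) P].

Definition closed_embedding : Prop :=
  [/\ generates, injective_morphism, closed_morphism & stalk_surjective].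

End ProjectiveMorphism.

Definition very_ample (L : cocycle) : Prop :=
  exists N, exists2 s : 'I_N.+1 -> cone -> laurent,
    forall i, is_section L (s i) & closed_embedding s.

Definition ample (L : cocycle) : Prop :=
  exists2 n, (0 < n)%N & very_ample (lb_exp L n).

(* Rows: the generators of the r-dimensional cone A, which form a basis of Z^r
   for a smooth fan.  The columns of the inverse are then the dual basis
   m_1, ..., m_r, and the chi^(m_i) are coordinates on U_A. *)
Definition frame (A : cone) : 'M[int]_r :=
  \matrix_(i, j) (nth 0 [seq ray u | u <- enum A] i) 0 j.

(* The bundle of r-forms, trivialised over U_A by dx_1 /\ ... /\ dx_r for these
   coordinates.  If y_i are the coordinates on U_B, with exponents m'_i, then
   m'_i = \sum_j T_{ji} m_j for T = frame A * (frame B)^-1, and the Jacobian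
   determinant of the d y_i / d x_j = T_{ji} chi^(m'_i - m_j) is
   (det T) chi^(\sum_i m'_i - \sum_j m_j). *)
Definition canonical_bundle : cocycle := fun A B =>
  [:: ((\det (frame A *m invmx (frame B)))%:~R,
       (invmx (frame B) - invmx (frame A)) *m const_mx 1)].

Definition fano : Prop := ample (lb_dual canonical_bundle).

Section Curve.
Variables (K : fieldType) (iota : {rmorphism C -> K}).

Definition transcendental (t : K) : Prop :=
  forall p : {poly C}, p != 0 -> (map_poly iota p).[t] != 0.

Definition alg_dependent (f g : K) : Prop :=
  exists2 P : {poly {poly C}}, P != 0 &
    (map_poly (fun q : {poly C} => (map_poly iota q).[f]) P).[g] = 0.

Definition trdeg_one : Prop :=
  (exists t, transcendental t) /\ (forall f g, alg_dependent f g).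

(* An irreducible curve is given by its generic point: a scheme point whose
   residue field is K, the function field of the curve, of transcendence
   degree 1 over C. *)
Definition generic_point_of_curve (x : kpoint K) : Prop :=
  trdeg_one /\
  (forall f : K, exists p, exists q,
    [/\ regular_on (pt_cone x) p, regular_on (pt_cone x) q,
        eval iota x q != 0 & f = eval iota x p / eval iota x q]).

(* Normalised discrete valuations of K over C, i.e., the closed points of the
   normalisation of the curve; v 0 is set to 0. *)
Definition place (v : K -> int) : Prop :=
  [/\ v 0 = 0,
      forall f g, f != 0 -> g != 0 -> v (f * g) = v f + v g,
      forall f g, f != 0 -> g != 0 -> f + g != 0 ->
        Order.min (v f) (v g) <= v (f + g),
      forall c : C, v (iota c) = 0
    & exists2 f, f != 0 & v f = 1].

(* The normalisation of the (complete) curve maps its point v into U_A. *)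
Definition centered (v : K -> int) (x : kpoint K) (A : cone) : Prop :=
  [/\ chart A, in_chart A x
    & forall m, dual_cone A m -> pt_val x m != 0 -> 0 <= v (pt_val x m)].

Definition generic_chart (x : kpoint K) : cone :=
  odflt finset.set0 [pick A | chart A && in_chart A x].

Definition center_chart (v : K -> int) (x : kpoint K) : cone :=
  odflt finset.set0 [pick A | `[< centered v x A >]].

(* Intersection number of a line bundle and a curve: the degree of the pullback
   of L to the normalisation, i.e., the sum over its points v of the order at v
   of a nonzero rational section.  The section used is the one equal to 1 in
   the trivialisation of L over [generic_chart x]. *)
Definition degree (L : cocycle) (x : kpoint K) : int :=
  \sum_(v \in [set v | place v])
    v (eval iota x (L (center_chart v x) (generic_chart x))).

End Curve.

(* Real 1-cycles modulo numerical equivalence, as functions on line bundles: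
   N_1 is the span of the curve classes below.  Classes are 0 on the cocycle
   data that do not define a line bundle. *)
Definition num_class : Type := cocycle -> R.

Definition curve_class (z : num_class) : Prop :=
  exists K : fieldType, exists iota : {rmorphism C -> K},
  exists2 x : kpoint K, generic_point_of_curve iota x &
    forall L, z L = if `[< is_line_bundle L >] then (degree iota L x)%:~R else 0.

Definition curve_cone : set num_class :=
  [set z | exists n, exists a : 'I_n -> R, exists2 c : 'I_n -> num_class,
     (forall i, 0 <= a i) /\ (forall i, curve_class (c i)) &
     forall L, z L = \sum_(i < n) a i * c i L].

(* N_1 is a finite dimensional subspace of the space of all functions on line
   bundles, so its topology is that of pointwise convergence and it is closed. *)
Definition mori_cone : set num_class :=
  closure (curve_cone : set {ptws cocycle -> R}).

Definition extremal_ray (S : set num_class) : Prop :=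
  (exists u, [/\ mori_cone u, u <> (fun _ => 0) &
     S = [set z | exists2 t : R, 0 <= t & z = (fun L => t * u L)]]) /\
  (forall u v, mori_cone u -> mori_cone v -> S (fun L => u L + v L) ->
     S u /\ S v).

Definition mori_ray (S : set num_class) : Prop :=
  forall z, S z -> z <> (fun _ => 0) -> z canonical_bundle < 0.

End ToricVariety.

Section ToricLimit.
Variables (D : km_root_datum) (r : nat) (w : 'I_r -> 'I_(km_size D)).

Definition beta (i j : 'I_r) : int := cartan (w i) (w j).

(* (i, true) is e_i^+ and (i, false) is e_i^-. *)
Definition limit_ray (u : 'I_r * bool) : 'rV[int]_r :=
  if u.2 then delta_mx 0 u.1
  else - delta_mx 0 u.1 - \sum_(j < r | (u.1 < j)%N) beta u.1 j *: delta_mx 0 j.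

(* The toric limit of the word s_(beta_1) ... s_(beta_r), where beta_i is the
   simple root indexed by w i. *)
Definition toric_limit : fan r :=
  @Fan r ('I_r * bool)%type limit_ray
    [set A : {set 'I_r * bool} |
       [forall i, ~~ (((i, true) \in A) && ((i, false) \in A))]]%SET.

End ToricLimit.

(* Main.v *)
(* The toric limit is a Bott tower, so its primitive collections are the r pairs
   {e_i^+, e_i^-}.  Writing e_i^+ + e_i^- = sum_(j > i) c_j e_j^(s_j) with
   c_j >= 0 gives the primitive relation r_i.  It is the class of an invariant
   curve, namely that of any wall containing the e_j^(s_j).  The r_i have a dual
   basis of globally generated line bundles L_k in Pic (built by induction on
   k), so the class of any curve is sum_k (L_k . C) r_k with L_k . C >= 0.  Hence
   the Mori cone is simplicial, its rays are spanned by the r_i, and both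
   conditions of the theorem amount to -K . r_i > 0 for all i.

   Fano implies -K . r_i > 0: a section of a bundle of degree <= 0 on the
   invariant curve r_i is constant, and the embedding would not be injective.

   Conversely, if -K . r_i > 0 for all i, the support function of -K is a positive
   combination of those of the L_k, hence strictly convex.  The sections of -2K
   given by the vertices of its polytope and by the lattice points next to them
   on the edges define a closed embedding.

   Degrees of arbitrary curves need no product formula: a globally generated
   bundle has degree >= 0 place by place.  They do need the finiteness of the set
   of zeros of a rational function, which follows from weak approximation. *)
Require Import Defs.
From HB Require Import structures.
From mathcomp Require Import all_boot all_order all_algebra.
From mathcomp Require Import complex ring zify.
From mathcomp Require Import all_classical all_reals all_analysis.
From mathcomp Require mpoly.

Set Implicit Arguments.
Unset Strict Implicit.
Unset Printing Implicit Defensive.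

Import Order.TTheory GRing.Theory Num.Theory.
Import numFieldNormedType.Exports.

Local Open Scope classical_set_scope.
Local Open Scope ring_scope.

(** * Function fields and places *)

(** A line bundle is an arbitrary cocycle of Laurent polynomials, so its combinatorial description
    has to be proved: a transition function is a unit on the torus, hence a constant times a
    character, and the exponents assemble into an integral function [psi] on the rays, from which
    degrees and positivity are read off. The degree of a curve is a sum over all places of its
    function field. Such a sum is 0 by convention when its support is infinite, so finiteness of
    zeros must precede any additivity of degrees. The only information on the function field is that
    any two elements are algebraically dependent and that finitely many elements generate it. Curve
    classes are controlled by linear relations and inequalities between finitely many values. These
    are closed conditions, so they extend to the Mori cone, which is defined as a closure. The
    multiple 2 of -K removes the signs of the Jacobian determinants: the transition functions of -2K
    are plain characters. *)

Section FractionLift.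
Variable D : idomainType.

Lemma fraction_repr (x : {fraction D}) :
  x * tofrac (frac (repr x)).2 = tofrac (frac (repr x)).1.
Proof.
move: (repr x) (reprK x) => y <-; unlock tofrac.
rewrite -[LHS]FracField.pi_mul /FracField.mulf /=; apply/eqmodP.
rewrite /= FracField.equivfE !numden_Ratio ?mulr1 ?oner_eq0 ?denom_ratioP //.
by rewrite mulrC.
Qed.

Lemma fraction_numdenP (x : {fraction D}) :
  exists n, exists2 d, d != 0 & x = tofrac n / tofrac d.
Proof.
exists (frac (repr x)).1, (frac (repr x)).2; first exact: denom_ratioP.
by rewrite -fraction_repr mulfK // tofrac_eq0; apply: denom_ratioP.
Qed.

Lemma tofrac_divK (a b : D) : b != 0 -> tofrac a / tofrac b * tofrac b = tofrac a.
Proof. by move=> b0; rewrite divfK // tofrac_eq0. Qed.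

Lemma tofrac_div_neq0 (a b : D) : a != 0 -> b != 0 -> tofrac a / tofrac b != 0.
Proof. by move=> a0 b0; rewrite mulf_neq0 ?invr_eq0 ?tofrac_eq0. Qed.

Lemma tofrac_divM (a b c d : D) :
  tofrac a / tofrac b * (tofrac c / tofrac d) = tofrac (a * c) / tofrac (b * d).
Proof. by rewrite mulf_div -!rmorphM. Qed.

Lemma tofrac_divD (a b c d : D) : b != 0 -> d != 0 ->
  tofrac a / tofrac b + tofrac c / tofrac d =
  tofrac (a * d + c * b) / tofrac (b * d).
Proof. by move=> b0 d0; rewrite addf_div ?tofrac_eq0 // -!rmorphM -rmorphD. Qed.

(** One denominator for all monomials of exponents at most [n]: dependence of rational functions
    becomes a count of polynomial degrees. *)
Lemma tofrac_div_monomial (a b c d : D) n i j : b != 0 -> d != 0 ->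
  (i <= n)%N -> (j <= n)%N ->
  (tofrac a / tofrac b) ^+ i * (tofrac c / tofrac d) ^+ j =
  tofrac (a ^+ i * b ^+ (n - i) * (c ^+ j * d ^+ (n - j))) / tofrac ((b * d) ^+ n).
Proof.
move=> b0 d0 lin ljn; rewrite !expr_div_n mulf_div -!rmorphXn -!rmorphM.
apply/eqP; rewrite eqr_div ?tofrac_eq0 ?mulf_neq0 ?expf_neq0 ?mulf_neq0 //.
have sub x k : (k <= n)%N -> x ^+ n = x ^+ (n - k) * x ^+ k :> D.
  by move=> kn; rewrite -exprD subnK.
rewrite -!rmorphM tofrac_eq exprMn (sub b i lin) (sub d j ljn); apply/eqP; ring.
Qed.

Lemma fraction_numden_neq0 (x : {fraction D}) : x != 0 ->
  exists n d, [/\ n != 0, d != 0 & x = tofrac n / tofrac d].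
Proof.
have [n [d d0 ->]] := fraction_numdenP x => x0; exists n, d; split => //.
by apply: contraNneq x0 => ->; rewrite rmorph0 mul0r.
Qed.

Variables (K : fieldType) (h : {rmorphism D -> K}).
Hypothesis h_inj : injective h.

(** The value is read off a chosen representative; [frac_liftE] shows that the choice does not
    matter. The proof of injectivity is an argument so that morphism structures can be attached to
    this constant. *)
Definition frac_lift of injective h := locked (fun x : {fraction D} =>
  h (frac (repr x)).1 / h (frac (repr x)).2).

Let hn0 (d : D) : d != 0 -> h d != 0.
Proof. by rewrite -(inj_eq h_inj) rmorph0. Qed.

Lemma frac_liftE (n d : D) : d != 0 ->
  frac_lift h_inj (tofrac n / tofrac d) = h n / h d.
Proof.
move=> d0; rewrite /frac_lift -lock; set x : {fraction D} := tofrac n / tofrac d.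
have d1 := denom_ratioP (repr x).
have E : tofrac (frac (repr x)).1 * tofrac d = tofrac n * tofrac (frac (repr x)).2.
  apply: (mulIf (x := (tofrac d)^-1)); first by rewrite invr_eq0 tofrac_eq0.
  by rewrite mulfK ?tofrac_eq0 // mulrAC -/x -fraction_repr.
apply/eqP; rewrite eqr_div ?hn0 // -!rmorphM; apply/eqP; congr (h _).
by apply/eqP; rewrite -tofrac_eq !rmorphM /= E.
Qed.

Lemma frac_lift_tofrac p : frac_lift h_inj (tofrac p) = h p.
Proof.
have := frac_liftE p (oner_neq0 D).
by rewrite !rmorph1 !divr1.
Qed.

Lemma frac_lift_is_zmod_morphism : zmod_morphism (frac_lift h_inj).
Proof.
move=> x y; have [a [b b0 ->]] := fraction_numdenP x.
have [c [d d0 ->]] := fraction_numdenP y.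
have bF : tofrac b != 0 by rewrite tofrac_eq0.
have dF : tofrac d != 0 by rewrite tofrac_eq0.
rewrite -mulNr addf_div // -rmorphN -!rmorphM -rmorphD /=.
rewrite !frac_liftE ?mulf_neq0 // -[RHS]/(_ + - _) -mulNr addf_div ?hn0 //.
by rewrite rmorphD !rmorphM rmorphN.
Qed.

Lemma frac_lift_is_monoid_morphism : monoid_morphism (frac_lift h_inj).
Proof.
split; first by rewrite -(rmorph1 (@tofrac D)) frac_lift_tofrac rmorph1.
move=> x y; have [a [b b0 ->]] := fraction_numdenP x.
have [c [d d0 ->]] := fraction_numdenP y.
rewrite mulf_div -!rmorphM /= !frac_liftE ?mulf_neq0 //.
by rewrite !rmorphM /= mulf_div.
Qed.

HB.instance Definition _ := GRing.isZmodMorphism.Build _ _ (frac_lift h_inj)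
  frac_lift_is_zmod_morphism.
HB.instance Definition _ := GRing.isMonoidMorphism.Build _ _ (frac_lift h_inj)
  frac_lift_is_monoid_morphism.

End FractionLift.

(** * Discrete valuations of a field over C *)

Section PlaceTheory.
Variables (R : realType) (K : fieldType) (iota : {rmorphism R[i] -> K}).
Variables (v : K -> int) (pv : place iota v).

Lemma place0 : v 0 = 0. Proof. by case: pv. Qed.

Lemma placeM f g : f != 0 -> g != 0 -> v (f * g) = v f + v g.
Proof. by case: pv => _ vM _ _ _; apply: vM. Qed.

Lemma place_const c : v (iota c) = 0. Proof. by case: pv. Qed.

Lemma place1 : v 1 = 0. Proof. by rewrite -(rmorph1 iota) place_const. Qed.

Lemma placeN f : v (- f) = v f.
Proof.
have [->|f0] := eqVneq f 0; first by rewrite oppr0.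
rewrite -mulN1r placeM ?oppr_eq0 ?oner_eq0 //.
by rewrite -(rmorph1 iota) -rmorphN place_const add0r.
Qed.

Lemma placeV f : v f^-1 = - v f.
Proof.
have [->|f0] := eqVneq f 0; first by rewrite invr0 place0 oppr0.
by apply/eqP; rewrite -addr_eq0 -placeM ?invr_eq0 // mulVf // place1.
Qed.

Lemma placeX f n : f != 0 -> v (f ^+ n) = v f *+ n.
Proof.
move=> f0; elim: n => [|n IH]; first by rewrite expr0 place1 mulr0n.
by rewrite exprS placeM ?expf_neq0 // IH mulrS.
Qed.

Lemma placeXz f (z : int) : f != 0 -> v (f ^ z) = z * v f.
Proof.
move=> f0; case: z => n; first by rewrite -exprnP placeX // -mulr_natl natz.
by rewrite NegzE -exprnN placeV placeX // -mulr_natl natz mulNr.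
Qed.

(** As [v 0 = 0] by convention, this predicate gives 0 infinite order, so that bounds pass to sums
    that vanish. *)
Definition place_ge (n : int) (f : K) : bool := (f == 0) || (n <= v f).

Lemma place_geD n f g : place_ge n f -> place_ge n g -> place_ge n (f + g).
Proof.
rewrite /place_ge; have [->|f0 /=] := eqVneq f 0; first by rewrite add0r.
have [->|g0 /=] := eqVneq g 0; first by rewrite addr0 (negPf f0).
move=> nf ng; have [//|fg0 /=] := eqVneq (f + g) 0.
case: pv => _ _ vD _ _; apply: le_trans (vD _ _ f0 g0 fg0).
by rewrite le_min nf.
Qed.

Lemma place_geN n f : place_ge n (- f) = place_ge n f.
Proof. by rewrite /place_ge oppr_eq0 placeN. Qed.

Lemma place_ge_sum n (I : finType) (P : pred I) (F : I -> K) :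
  (forall i, P i -> place_ge n (F i)) -> place_ge n (\sum_(i | P i) F i).
Proof.
move=> nF; elim/big_rec: _ => [|i x Pi]; first by rewrite /place_ge eqxx.
exact/place_geD/nF.
Qed.

Lemma place_geM n m f g : place_ge n f -> place_ge m g -> place_ge (n + m) (f * g).
Proof.
rewrite /place_ge mulf_eq0; have [//|f0 /=] := eqVneq f 0.
have [//|g0 /=] := eqVneq g 0 => nf mg.
by rewrite placeM // lerD.
Qed.

(** If the order of [f + g] were larger than that of [f], so would be the order of
    [f = (f + g) - g]. *)
Lemma place_dominant f g : f != 0 -> place_ge (v f + 1) g ->
  f + g != 0 /\ v (f + g) = v f.
Proof.
move=> f0 fg.
have h : ~~ place_ge (v f + 1) f by rewrite /place_ge (negPf f0) /= gerDl.
have h1 : ~~ place_ge (v f + 1) (f + g).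
  apply: contra h => h; suff: place_ge (v f + 1) (f + g - g) by rewrite addrK.
  by apply: place_geD; rewrite ?place_geN.
have h2 : place_ge (v f) (f + g).
  apply: place_geD; first by rewrite /place_ge lexx orbT.
  move: fg; rewrite /place_ge => /orP[->//|fg].
  by rewrite (le_trans _ fg) ?orbT // lerDl.
move: h1 h2; rewrite /place_ge negb_or => /andP[fg0].
rewrite (negPf fg0) /= -ltNge ltzD1 => h1 h2; split=> //.
by apply/eqP; rewrite eq_le h1.
Qed.

Lemma place_ge_horner f (p : {poly R[i]}) : 0 <= v f ->
  place_ge 0 (map_poly iota p).[f].
Proof.
move=> vf; elim/poly_ind: p => [|p c IH].
  by rewrite rmorph0 horner0 /place_ge eqxx.
rewrite rmorphD rmorphM /= map_polyX map_polyC !hornerE.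
apply: place_geD; last by rewrite /place_ge place_const orbT.
rewrite -[0]addr0; apply: place_geM => //.
by rewrite /place_ge vf orbT.
Qed.

Lemma place_horner_unit f (p : {poly R[i]}) : 0 < v f -> ~~ root p 0 ->
  (map_poly iota p).[f] != 0 /\ v (map_poly iota p).[f] = 0.
Proof.
move=> vf; elim/poly_ind: p => [|p c _]; first by rewrite root0.
rewrite rootE !hornerE => c0.
rewrite rmorphD rmorphM /= map_polyX map_polyC !hornerE addrC.
have := @place_dominant (iota c) ((map_poly iota p).[f] * f).
rewrite place_const add0r; apply; first by rewrite fmorph_eq0.
rewrite -[1]add0r; apply: place_geM; first exact/place_ge_horner/ltW.
by rewrite /place_ge -gtz0_ge1 vf orbT.
Qed.

(** After splitting off the exact power of X, the cofactor has a nonzero constant term, which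
    dominates because [f] has a zero at [v]. *)
Lemma place_horner f (p : {poly R[i]}) : 0 < v f -> p != 0 ->
  (map_poly iota p).[f] != 0 /\ v (map_poly iota p).[f] = v f *+ mup 0 p.
Proof.
move=> vf p0.
have f0 : f != 0 by apply: contraTneq vf => ->; rewrite place0.
have := mup_geq 0 (mup 0 p) p0; rewrite leqnn subr0 => /esym.
move/dvdpP=> [q pE].
have q0 : ~~ root q 0.
  rewrite -dvdp_XsubCl subr0; apply/negP => /dvdpP[s qE].
  have := mup_leq 0 (mup 0 p) p0; rewrite leqnn subr0 => /esym/negP; apply.
  by rewrite {2}pE qE -mulrA -exprS dvdp_mull.
have [h1 h2] := place_horner_unit vf q0.
rewrite {1 2}pE rmorphM rmorphXn /= map_polyX !hornerE.
by rewrite mulf_neq0 ?expf_neq0 // placeM ?expf_neq0 // placeX // h2 add0r.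
Qed.

Lemma place_transcendental f : 0 < v f -> transcendental iota f.
Proof. by move=> vf p p0; case: (place_horner vf p0). Qed.

End PlaceTheory.

(** * The place of C(t) at the origin *)

Section OrderAtZero.
Variable C : fieldType.
Local Notation Ct := {fraction {poly C}}.

Definition ratC : {rmorphism C -> Ct} := (@tofrac _ \o @polyC C : {rmorphism _ -> _}).
Definition ratX : Ct := tofrac 'X.

Lemma ratX_neq0 : ratX != 0.
Proof. by rewrite tofrac_eq0 polyX_eq0. Qed.

Lemma horner_ratX (p : {poly C}) : (map_poly ratC p).[ratX] = tofrac p.
Proof.
elim/poly_ind: p => [|p c IH]; first by rewrite !rmorph0 horner0.
by rewrite !rmorphD !rmorphM /= map_polyX map_polyC !hornerE IH.
Qed.

Definition ordX (x : Ct) : int :=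
  if x == 0 then 0 else (mup 0 (frac (repr x)).1)%:Z - (mup 0 (frac (repr x)).2)%:Z.

Lemma ordXE (n d : {poly C}) : n != 0 -> d != 0 ->
  ordX (tofrac n / tofrac d) = (mup 0 n)%:Z - (mup 0 d)%:Z.
Proof.
move=> n0 d0; have := tofrac_divK n d0; have := tofrac_div_neq0 n0 d0.
move: (tofrac n / tofrac d) => x x0 xd.
rewrite /ordX (negPf x0).
have dx := denom_ratioP (repr x).
have xE := fraction_repr x.
have nx : (frac (repr x)).1 != 0 by rewrite -tofrac_eq0 -xE mulf_neq0 ?tofrac_eq0.
have : n * (frac (repr x)).2 = (frac (repr x)).1 * d.
  apply/eqP; rewrite -tofrac_eq !rmorphM /= -xE -xd.
  by rewrite mulrAC.
move/(congr1 (mup 0)); rewrite !mupM // => /(congr1 Posz); rewrite !PoszD => E.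
by apply/eqP; rewrite subr_eq addrAC E addrK.
Qed.

Lemma ordX_ratX : ordX ratX = 1.
Proof.
have := @ordXE 'X 1; rewrite polyX_eq0 oner_eq0 rmorph1 divr1 => -> //.
rewrite (mupNroot (q := 1)) ?rootE ?hornerC ?oner_eq0 // subr0.
by have := mup_XsubCX 1 (0 : C) 0; rewrite subr0 eqxx expr1 => ->.
Qed.

Lemma ordX_0 : ordX 0 = 0.
Proof. by rewrite /ordX eqxx. Qed.

Lemma ordXM f g : f != 0 -> g != 0 -> ordX (f * g) = ordX f + ordX g.
Proof.
move=> /fraction_numden_neq0[a [b [a0 b0 ->]]] /fraction_numden_neq0[c [d [c0 d0 ->]]].
rewrite tofrac_divM !ordXE ?mulf_neq0 // !mupM // !PoszD.
by rewrite opprD addrACA.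
Qed.

(** Over the common denominator [b * d], a power of X dividing both numerators divides their sum. *)
Lemma ordXD f g : f != 0 -> g != 0 -> f + g != 0 ->
  Order.min (ordX f) (ordX g) <= ordX (f + g).
Proof.
move=> /fraction_numden_neq0[a [b [a0 b0 ->]]] /fraction_numden_neq0[c [d [c0 d0 ->]]].
rewrite tofrac_divD // => h.
have h0 : a * d + c * b != 0.
  by apply: contraNneq h => ->; rewrite rmorph0 mul0r.
rewrite !ordXE ?mulf_neq0 //.
have -> : (mup 0 a)%:Z - (mup 0 b)%:Z = (mup 0 (a * d))%:Z - (mup 0 (b * d))%:Z.
  by rewrite !mupM // !PoszD opprD addrACA subrr addr0.
have -> : (mup 0 c)%:Z - (mup 0 d)%:Z = (mup 0 (c * b))%:Z - (mup 0 (b * d))%:Z.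
  by rewrite !mupM // !PoszD (addrC (mup 0 b)%:Z (mup 0 d)%:Z) opprD addrACA subrr addr0.
rewrite ge_min !lerD2r !lez_nat !mup_geq //.
have [le|le] := leqP (mup 0 (a * d)) (mup 0 (c * b)); apply/orP; [left|right].
  by rewrite dvdp_add // -mup_geq ?mulf_neq0.
by rewrite dvdp_add // -mup_geq ?mulf_neq0 // ltnW.
Qed.

Lemma ordXC c : ordX (ratC c) = 0.
Proof.
have [->|c0] := eqVneq c 0; first by rewrite rmorph0 /ordX eqxx.
have := @ordXE c%:P 1; rewrite polyC_eq0 oner_eq0 rmorph1 divr1 => -> //.
by rewrite !mupNroot ?rootE ?hornerC ?oner_eq0 ?subrr.
Qed.

End OrderAtZero.

Arguments ratC {C}.
Arguments ratX {C}.

Section RationalFunctions.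
Variable R : realType.
Local Notation C := R[i].
Local Notation Ct := {fraction {poly C}}.

Lemma place_ordX : place (@ratC C) (@ordX C).
Proof.
split; [exact: ordX_0 | exact: ordXM | exact: ordXD | exact: ordXC |].
by exists ratX; [exact: ratX_neq0 | exact: ordX_ratX].
Qed.

Section Specialize.
Variables (K : fieldType) (iota : {rmorphism C -> K}) (f : K).
Hypothesis ft : transcendental iota f.

Definition horner_at : {rmorphism {poly C} -> K} :=
  horner_morph (fun c => mulrC f (iota c)).

Lemma horner_at_inj : injective horner_at.
Proof.
move=> p q pq; apply/eqP; rewrite -subr_eq0; apply/negPn/negP => /ft.
move: pq; rewrite /= /horner_morph /= => pq.
by rewrite rmorphB hornerD hornerN pq subrr eqxx.
Qed.

(** The isomorphism of C(t) with C(f), t going to [f]; through it K becomes a vector space over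
    C(f). *)
Definition specialize : {rmorphism Ct -> K} := frac_lift horner_at_inj.

Lemma specialize_tofrac p : specialize (tofrac p) = (map_poly iota p).[f].
Proof. exact: frac_lift_tofrac. Qed.

Lemma specialize_X : specialize ratX = f.
Proof. by rewrite specialize_tofrac map_polyX hornerX. Qed.

Lemma specializeC c : specialize (ratC c) = iota c.
Proof. by rewrite specialize_tofrac map_polyC hornerC. Qed.

(** On C(f), [v] is the order at the origin times the ramification index [v f]. *)
Lemma place_specialize v (x : Ct) : place iota v -> 0 < v f ->
  v (specialize x) = v f * ordX x.
Proof.
move=> pv vf; have [->|x0] := eqVneq x 0.
  by rewrite rmorph0 (place0 pv) (place0 place_ordX) mulr0.
have [n [d d0 xE]] := fraction_numdenP x.
have n0 : n != 0 by apply: contraNneq x0 => n0; rewrite xE n0 rmorph0 mul0r.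
rewrite xE ordXE // fmorph_div !specialize_tofrac.
have [hn vn] := place_horner pv vf n0; have [hd vd] := place_horner pv vf d0.
rewrite (placeM pv) ?invr_eq0 // (placeV pv) vn vd mulrBr.
by rewrite !pmulrn !mulrzz.
Qed.

End Specialize.

(** A place takes the value 1, which forces the positive factor [k] to be 1. *)
Lemma place_multiple_eq (K : fieldType) (iota : {rmorphism C -> K})
    (v o : K -> int) (k : int) :
  place iota v -> 0 < k -> (forall x, v x = k * o x) -> v = o.
Proof.
case=> _ _ _ _ [f f0 vf] k0 vE.
have o1 : 1 <= o f by rewrite -gtz0_ge1 -(pmulr_rgt0 _ k0) -vE vf.
have k1 : k = 1.
  by apply/eqP; rewrite eq_le -(gtz0_ge1 k) k0 andbT -vf (vE f) ler_peMr // ltW.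
by apply/funext => x; rewrite vE k1 mul1r.
Qed.

Lemma place_ratX_gt0 v : place (@ratC C) v -> 0 < v ratX -> v = @ordX C.
Proof.
move=> pv vX; have Xt := place_transcendental pv vX.
apply: (place_multiple_eq pv vX) => x.
suff {1}<- : specialize Xt x = x by rewrite place_specialize.
have [n [d d0 ->]] := fraction_numdenP x.
by rewrite fmorph_div !specialize_tofrac !horner_ratX.
Qed.

End RationalFunctions.

(** * The place of C(t) at infinity *)

Section PlaceAtInfinity.
Variable R : realType.
Local Notation C := R[i].
Local Notation Ct := {fraction {poly C}}.

Lemma transcendentalV (K : fieldType) (iota : {rmorphism C -> K}) t :
  transcendental iota t -> transcendental iota t^-1.
Proof.
move=> tt p p0; have t0 : t != 0.
  by have := tt 'X; rewrite map_polyX hornerX; apply; rewrite polyX_eq0.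
(* Reciprocal polynomial: its constant coefficient is the leading coefficient of [p], hence
   nonzero. *)
pose q := \poly_(i < size p) p`_((size p).-1 - i).
have sp : (0 < size p)%N by rewrite size_poly_gt0.
have q0 : q != 0.
  apply: contraNneq p0 => q0; rewrite -lead_coef_eq0 lead_coefE.
  have := congr1 (fun s : {poly C} => s`_0) q0.
  by rewrite coef_poly coef0 subn0 sp => ->.
apply: contraNneq (tt q q0) => h.
have qE : (map_poly iota q).[t] = (map_poly iota p).[t^-1] * t ^+ (size p).-1.
  rewrite (horner_coef_wide (n := size p)) ?size_map_poly ?size_poly //.
  rewrite (horner_coef_wide (n := size p)) ?size_map_poly //.
  rewrite mulr_suml [RHS](reindex_inj rev_ord_inj) /=; apply: eq_bigr => i _.
  have ip : (i <= (size p).-1)%N by rewrite -ltnS prednK.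
  rewrite !coef_map coef_poly /= ltn_ord subnS predn_sub -mulrA; congr (_ * _).
  by rewrite exprVn -[X in _ * t ^+ X](subnK ip) exprD mulKf // expf_neq0.
by rewrite qE h mul0r.
Qed.

Lemma ratX_transcendental : transcendental (@ratC C) ratX.
Proof. by move=> p p0; rewrite horner_ratX tofrac_eq0. Qed.

(** The involution t -> 1/t, which exchanges the places at the origin and at infinity. *)
Definition ratX_inv : {rmorphism Ct -> Ct} :=
  specialize (transcendentalV ratX_transcendental).

Lemma ratX_invK : involutive ratX_inv.
Proof.
move=> x; have [n [d d0 ->]] := fraction_numdenP x.
have E p : ratX_inv (ratX_inv (tofrac p)) = tofrac p.
  elim/poly_ind: p => [|p c IH]; first by rewrite !rmorph0.
  rewrite !(rmorphD, rmorphM) /= IH.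
  rewrite -[tofrac 'X]/ratX -[tofrac c%:P]/(ratC c) !specializeC specialize_X.
  by rewrite fmorphV specialize_X invrK.
by rewrite !fmorph_div !E.
Qed.

Lemma ratX_invX : ratX_inv ratX = ratX^-1.
Proof. exact: specialize_X. Qed.

Definition ord_inf (x : Ct) : int := ordX (ratX_inv x).

Lemma place_ord_inf : place (@ratC C) ord_inf.
Proof.
have nz x : x != 0 -> ratX_inv x != 0 by rewrite fmorph_eq0.
split.
- by rewrite /ord_inf rmorph0 ordX_0.
- move=> f g /nz f0 /nz g0; rewrite /ord_inf rmorphM; exact: (ordXM f0 g0).
- move=> f g /nz f0 /nz g0 /nz; rewrite /ord_inf rmorphD; exact: (ordXD f0 g0).
- by move=> c; rewrite /ord_inf specializeC ordXC.
exists ratX^-1; first by rewrite invr_eq0 ratX_neq0.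
by rewrite /ord_inf fmorphV ratX_invX invrK ordX_ratX.
Qed.

Lemma ord_inf_ratX : ord_inf ratX = -1.
Proof. by rewrite /ord_inf ratX_invX (placeV (place_ordX R)) ordX_ratX. Qed.

Lemma place_ratX_lt0 v : place (@ratC C) v -> v ratX < 0 -> v = ord_inf.
Proof.
move=> pv vX; have vXV : 0 < v ratX^-1 by rewrite (placeV pv) oppr_gt0.
apply: (place_multiple_eq pv vXV) => x.
by rewrite -{1}(ratX_invK x) place_specialize.
Qed.

End PlaceAtInfinity.

(** * Weak approximation *)

Section WeakApproximation.
Variables (R : realType) (K : fieldType) (iota : {rmorphism R[i] -> K}).

(** Units for [v] are units for [w], so [w f = v f * w u] with [u] a uniformiser of [v]; both places
    take the value 1, so the factor is 1. *)
Lemma place_ring_inj v w : place iota v -> place iota w ->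
  (forall f, f != 0 -> 0 <= v f -> 0 <= w f) -> v = w.
Proof.
move=> pv pw vw.
have w0 f : f != 0 -> v f = 0 -> w f = 0.
  move=> f0 vf; apply/eqP; rewrite eq_le vw ?vf // andbT.
  by rewrite -oppr_ge0 -(placeV pw) vw ?invr_eq0 // (placeV pv) vf oppr0.
have [u u0 vu] : exists2 f, f != 0 & v f = 1 by case: pv.
have [t t0 wt] : exists2 f, f != 0 & w f = 1 by case: pw.
have wE f : w f = v f * w u.
  have [->|f0] := eqVneq f 0; first by rewrite (place0 pv) (place0 pw) mul0r.
  have uz : u ^ (- v f) != 0 by rewrite expfz_neq0.
  have : w (f * u ^ (- v f)) = 0.
    apply: w0; first by rewrite mulf_neq0.
    by rewrite (placeM pv) // (placeXz pv) // vu mulr1 subrr.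
  rewrite (placeM pw) // (placeXz pw) // mulNr => /eqP.
  by rewrite subr_eq0 => /eqP.
have wu : 0 <= w u by rewrite vw // vu.
have wu0 : 0 < w u.
  rewrite lt_def wu andbT; apply/eqP => wu0.
  by move: wt; rewrite wE wu0 mulr0.
have vt : 0 < v t by rewrite -(pmulr_lgt0 (v t) wu0) -wE wt.
have wu1 : w u = 1.
  apply/eqP; rewrite eq_le -(gtz0_ge1 (w u)) wu0 andbT -wt (wE t).
  by rewrite ler_peMl // -gtz0_ge1.
by apply/funext => f; rewrite wE wu1 mulr1.
Qed.

Lemma place_separate v w : place iota v -> place iota w -> v <> w ->
  exists z, [/\ z != 0, 0 < v z & w z < 0].
Proof.
move=> pv pw vw.
have sep v1 w1 : place iota v1 -> place iota w1 -> v1 <> w1 ->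
    exists z, [/\ z != 0, 0 <= v1 z & w1 z < 0].
  move=> p1 p2 n12; apply: contrapT => h; apply: n12.
  apply: place_ring_inj => // f f0 vf; rewrite leNgt; apply/negP => wf.
  by apply: h; exists f.
have [a [a0 va wa]] := sep v w pv pw vw.
have [b [b0 wb vb]] := sep w v pw pv (nesym vw).
have bV : b^-1 != 0 by rewrite invr_eq0.
exists (a / b); rewrite mulf_neq0 // (placeM pv a0 bV) (placeM pw a0 bV).
rewrite (placeV pv) (placeV pw); split=> //.
  by rewrite subr_gt0 (lt_le_trans vb).
by rewrite subr_lt0 (lt_le_trans wa).
Qed.

(** Induction on [n]. If the function found so far has no pole at the new place, a high power of a
    function with a zero at [v] and a pole there is added. *)
Lemma weak_approximation v (W : nat -> K -> int) n : place iota v ->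
  (forall i, (i < n)%N -> place iota (W i) /\ v <> W i) ->
  exists z, [/\ z != 0, 0 < v z & forall i, (i < n)%N -> W i z < 0].
Proof.
move=> pv; elim: n => [|n IH] pW.
  have [u u0 vu] : exists2 f, f != 0 & v f = 1 by case: pv.
  by exists u; rewrite vu.
have [z [z0 vz Wz]] := IH (fun i h => pW i (ltnW h)).
have [pn vn] := pW n (ltnSn n).
have [Wnz|Wnz] := ltP (W n z) 0.
  exists z; split=> // i; rewrite ltnS leq_eqVlt => /orP[/eqP->//|]; exact: Wz.
have [y [y0 vy Wy]] := place_separate pv pn vn.
pose k := (\sum_(i < n) `|W i z|)%N.+1.
have yk0 : y ^+ k != 0 by rewrite expf_neq0.
(* k avoids v_i(z) = k v_i(y), so v_i(z + y^k) is the minimum of the two. *)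
have key i : (i < n.+1)%N -> z + y ^+ k != 0 /\ W i (z + y ^+ k) < 0.
  move=> lin; have [pWi _] := pW i lin.
  have [Wi|Wi] := ltP (W i z) (W i (y ^+ k)).
    have [] := @place_dominant _ _ _ _ pWi z (y ^+ k) z0.
      by rewrite /place_ge lezD1 Wi orbT.
    move=> h ->; split=> //.
    move: lin; rewrite ltnS leq_eqVlt => /orP[/eqP E|/Wz//].
    move: Wi; rewrite E (placeX pn) // => Wi.
    have := le_lt_trans Wnz Wi.
    by rewrite pmulrn_lgt0 // ltNge ltW.
  have [] := @place_dominant _ _ _ _ pWi (y ^+ k) z yk0.
    rewrite /place_ge lezD1 lt_neqAle Wi andbT orbC; apply/orP; left.
    rewrite (placeX pWi) //; move: lin; rewrite ltnS leq_eqVlt => /orP[/eqP E|lin].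
      apply: contraTneq Wnz => Ez; rewrite -E -Ez -ltNge E.
      by rewrite -mulr_natr pmulr_llt0.
    apply/eqP => E; have := Wz _ lin; rewrite -E => neg.
    have : (`|W i z| < k)%N.
      by rewrite ltnS (bigD1 (Ordinal lin)) //= leq_addr.
    rewrite -E -mulr_natr abszM natz absz_nat ltnNge leq_pmull //.
    rewrite absz_gt0; apply: contraTneq neg => ->.
    by rewrite mul0rn.
  rewrite [y ^+ k + z]addrC => h ->; split => //.
  move: Wi lin; rewrite (placeX pWi) // ltnS leq_eqVlt => Wi /orP[/eqP->|/Wz Wz'].
    by rewrite -mulr_natr pmulr_llt0.
  exact: le_lt_trans Wz'.
exists (z + y ^+ k).
have [h _] := key n (ltnSn n); split=> //; last by move=> i /key[].
have gev : place_ge v 1 (z + y ^+ k).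
  apply: (place_geD pv); rewrite /place_ge -(gtz0_ge1 (v _)) ?vz ?orbT //.
  by rewrite (placeX pv) // pmulrn_lgt0 ?vy ?orbT.
by move: gev; rewrite /place_ge (negPf h) -(gtz0_ge1 (v _)).
Qed.

End WeakApproximation.

(** * Finite algebras over a subfield *)

Section LinearDependence.
Variables (F K : fieldType) (phi : {rmorphism F -> K}).

Definition span (I : finType) (e : I -> K) (y : K) : Prop :=
  exists a : I -> F, y = \sum_i phi (a i) * e i.

Lemma span_dependent (I J : finType) (e : I -> K) (g : J -> K) :
  (#|I| < #|J|)%N -> (forall j, span e (g j)) ->
  exists2 b : J -> F, exists j, b j != 0 & \sum_j phi (b j) * g j = 0.
Proof.
move=> IJ /choice[a ga].
pose A := \matrix_(j < #|J|, k < #|I|) a (enum_val j) (enum_val k).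
have : kermx A != 0.
  rewrite kermx_eq0 /row_free neq_ltn; apply/orP; left.
  exact: leq_ltn_trans (rank_leq_col A) IJ.
move=> /rowV0Pn[u /sub_kermxP uA /rV0Pn[j uj]].
exists (fun j => u 0 (enum_rank j)).
  by exists (enum_val j); rewrite enum_valK.
transitivity (\sum_j \sum_i phi (u 0 (enum_rank j) * a j i) * e i).
  apply: eq_bigr => k _; rewrite ga mulr_sumr; apply: eq_bigr => i _.
  by rewrite rmorphM mulrA.
rewrite exchange_big big1 // => i _; rewrite -mulr_suml -rmorph_sum.
rewrite (_ : \sum_k _ = (u *m A) 0 (enum_rank i)); first by rewrite uA mxE rmorph0 mul0r.
rewrite mxE [RHS](reindex enum_rank) /=; last exact/onW_bij/enum_rank_bij.
by apply: eq_bigr => k _; rewrite mxE !enum_rankK.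
Qed.

Section Span.
Variables (I : finType) (e : I -> K).

Lemma span_gen i : span e (e i).
Proof.
exists (fun j => (j == i)%:R); rewrite (bigD1 i) //= eqxx rmorph1 mul1r.
by rewrite big1 ?addr0 // => j /negPf->; rewrite rmorph0 mul0r.
Qed.

Lemma spanD y z : span e y -> span e z -> span e (y + z).
Proof.
move=> [a ->] [b ->]; exists (fun i => a i + b i); rewrite -big_split.
by apply: eq_bigr => i _; rewrite rmorphD mulrDl.
Qed.

Lemma spanZ c y : span e y -> span e (phi c * y).
Proof.
move=> [a ->]; exists (fun i => c * a i); rewrite mulr_sumr.
by apply: eq_bigr => i _; rewrite rmorphM mulrA.
Qed.

Lemma span0 : span e 0.
Proof. by exists (fun=> 0); rewrite big1 // => i _; rewrite rmorph0 mul0r. Qed.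

Lemma span_sum (J : finType) (G : J -> K) :
  (forall j, span e (G j)) -> span e (\sum_j G j).
Proof.
by move=> eG; elim/big_ind: _ => //; [exact: span0 | exact: spanD].
Qed.

End Span.

Lemma span_trans (I J : finType) (e : I -> K) (e' : J -> K) y z :
  (forall i, span e' (e i * z)) -> span e y -> span e' (y * z).
Proof.
move=> h [a ->]; rewrite mulr_suml; apply: span_sum => i.
by rewrite -mulrA; apply: spanZ.
Qed.

Lemma span_mul (I I' J : finType) (e : I -> K) (e' : I' -> K) (e'' : J -> K) y z :
  (forall i j, span e'' (e i * e' j)) -> span e y -> span e' z -> span e'' (y * z).
Proof.
move=> h ey ez; apply: span_trans ey => i; rewrite mulrC.
by apply: span_trans ez => j; rewrite mulrC.
Qed.

(** The span of [e] is an F-subalgebra of K, of finite dimension. *)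
Definition finite_algebra (I : finType) (e : I -> K) : Prop :=
  span e 1 /\ forall i j, span e (e i * e j).

Definition monic_relation (y : K) : Prop :=
  exists d, exists c : 'I_d -> F, y ^+ d = \sum_l phi (c l) * y ^+ l.

(** The products of the [e i] with powers of [y] below [d] suffice; higher powers are lowered by the
    relation. *)
Lemma finite_algebra_adjoin (I : finType) (e : I -> K) y :
  finite_algebra e -> monic_relation y ->
  exists J : finType, exists e' : J -> K,
    [/\ finite_algebra e', span e' y & forall z, span e z -> span e' z].
Proof.
move=> [e1 eM] [d [c yd]].
exists ('I_d * I)%type, (fun p : 'I_d * I => e p.2 * y ^+ p.1).
set e' := fun p : 'I_d * I => _.
have ey n : forall z, span e z -> span e' (z * y ^+ n).
  elim/ltn_ind: n => n IH z ez.
  have [lt|le] := ltnP n d.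
    apply: span_trans ez => i; exact: (span_gen e' (Ordinal lt, i)).
  rewrite -(subnK le) addnC exprD mulrCA yd mulr_suml.
  apply: span_sum => l; rewrite -mulrA; apply: spanZ; rewrite mulrCA -exprD.
  apply: IH => //; rewrite -[X in (_ < X)%N](subnK le) addnC ltn_add2l.
  exact: ltn_ord.
have sub z : span e z -> span e' z by move=> ez; have := ey 0%N z ez; rewrite expr0 mulr1.
split => //; last by have := ey 1%N 1 e1; rewrite expr1 mul1r.
split; first exact: sub.
move=> p q; rewrite /e' mulrACA -exprD; exact: ey.
Qed.

Lemma finite_algebra_adjoin_seq (ys : seq K) :
  (forall y, y \in ys -> monic_relation y) ->
  exists I : finType, exists e : I -> K,
    finite_algebra e /\ forall y, y \in ys -> span e y.
Proof.
elim: ys => [_|y ys IH ysP].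
  have u1 : span (fun _ : unit => 1) 1 by apply: (@span_gen unit (fun=> 1) tt).
  by exists unit, (fun=> 1); split => //; split => // i j; rewrite mulr1.
have [I [e [eA es]]] := IH (fun z h => ysP z (mem_behead (s := y :: ys) h)).
have [J [e' [eA' ey ee']]] := finite_algebra_adjoin eA (ysP y (mem_head _ _)).
exists J, e'; split => // z; rewrite inE => /orP[/eqP->//|/es]; exact: ee'.
Qed.

End LinearDependence.

Lemma infinite_set_sequence (T : Type) (A : set T) : infinite_set A ->
  exists2 W : nat -> T, injective W & forall n, A (W n).
Proof.
move=> Ainf; have [x _] := infinite_setN0 Ainf.
pose T' : pointedType := HB.pack_for pointedType T (gen_eqMixin T)
  (gen_choiceMixin T) (isPointed.Build T x).
have /infiniteP/(@pcard_leP _ T')[W] := Ainf.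
exists W; first by move=> i j; apply: (@inj _ _ _ W); rewrite inE.
by move=> n; apply: (@funS _ _ _ _ W).
Qed.

(** * Finiteness of the zeros of a function *)

Section FiniteZeros.
Variables (R : realType) (K : fieldType) (iota : {rmorphism R[i] -> K}).

(** The leading coefficient is a nonzero polynomial in the transcendental [f], hence invertible in
    C(f). *)
Lemma alg_dependent_monic_relation f (ft : transcendental iota f) y :
  alg_dependent iota f y -> monic_relation (specialize ft) y.
Proof.
case=> P P0 Py; pose phi := specialize ft.
have hE q : (map_poly iota q).[f] = phi (tofrac q) by rewrite specialize_tofrac.
have lP : phi (tofrac (lead_coef P)) != 0.
  by rewrite -hE; apply: (ft (lead_coef P)); rewrite lead_coef_eq0.
have sp : (0 < size P)%N by rewrite size_poly_gt0.
exists (size P).-1, (fun l => - (tofrac P`_l / tofrac (lead_coef P))).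
have := Py; rewrite (eq_map_poly (g := phi \o @tofrac _)); last exact: hE.
rewrite (horner_coef_wide (n := (size P).-1.+1)); last by rewrite prednK // size_poly.
rewrite big_ord_recr /= => /eqP.
rewrite addrC addr_eq0 !coef_map_id0 /= ?rmorph0 // => /eqP E.
apply: (mulfI lP); rewrite {1}lead_coefE E -sumrN mulr_sumr.
apply: eq_bigr => i _; rewrite coef_map_id0 /= ?rmorph0 // mulrA -rmorphM.
rewrite -mulNr -rmorphN; congr (phi _ * _).
by rewrite mulrN mulrC tofrac_divK // lead_coef_eq0.
Qed.

(** Every element of K is a quotient of elements of one finite C(f)-algebra containing [ys], spanned
    by m elements. Among infinitely many zeros of [f], m + 1 would provide m + 1 functions
    independent over C(f), and a common denominator moves these into the algebra. *)
Theorem finite_zeros (ys : seq K) f : trdeg_one iota ->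
  (forall T : K -> Prop, (forall c, T (iota c)) ->
     (forall a b, T a -> T b -> T (a + b)) ->
     (forall a b, T a -> T b -> T (a * b)) ->
     (forall y, y \in ys -> T y) ->
     forall g, exists p q, [/\ T p, T q, q != 0 & g = p / q]) ->
  finite_set [set v | place iota v /\ 0 < v f].
Proof.
move=> [_ algdep] gen; apply: contrapT => /infinite_set_sequence[W Winj pW].
have ft := place_transcendental (pW 0%N).1 (pW 0%N).2.
pose phi := specialize ft.
have [I [e [[e1 eM] ey]]] := finite_algebra_adjoin_seq
  (fun y (_ : y \in ys) => alg_dependent_monic_relation ft (algdep f y)).
have eC c : span phi e (iota c).
  by rewrite -(specializeC ft) -[_ (ratC c)]mulr1; apply: spanZ.
have eMul y z : span phi e y -> span phi e z -> span phi e (y * z).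
  exact: span_mul.
have quot := gen _ eC (fun a b => @spanD _ _ phi I e a b) eMul ey.
pose m := #|I|.
have sepz (i : 'I_m.+1) : exists z, [/\ z != 0, 0 < W i z &
    forall j : 'I_m.+1, j != i -> W j z < 0].
  have [|z [z0 vz Wz]] := @weak_approximation _ _ _ (W i) (fun j => W (bump i j)) m (pW i).1.
    move=> j jm; split; first exact: (pW _).1.
    by move=> /Winj /eqP; apply/negP; rewrite neq_bump.
  exists z; split=> // j; rewrite eq_sym => /unlift_some[k jE _].
  by rewrite jE; exact: (Wz k (ltn_ord k)).
have [z zP] := choice sepz.
(* [g i] is a unit at the i-th place, where [z i] vanishes, and is 0 at the others, where [z i] has
   a pole. *)
pose g i := (1 + z i)^-1.
have gP i : [/\ g i != 0, W i (g i) = 0 & forall j : 'I_m.+1, j != i -> 0 < W j (g i)].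
  have [z0 Wz zW] := zP i.
  have [||h Wi] := @place_dominant _ _ _ _ (pW i).1 1 (z i); first exact: oner_neq0.
    by rewrite (place1 (pW i).1) add0r /place_ge -(gtz0_ge1 (W i (z i))) Wz orbT.
  split; first by rewrite invr_eq0.
    by rewrite (placeV (pW i).1) Wi (place1 (pW i).1) oppr0.
  move=> j /zW Wj; have pj := (pW j).1.
  have [|_ Wj1] := @place_dominant _ _ _ _ pj (z i) 1 z0.
    by rewrite /place_ge (place1 pj) lezD1 Wj orbT.
  by rewrite (placeV pj) addrC Wj1 oppr_gt0.
have [p /choice[q pq]] := choice (fun i => quot (g i)).
(* The product of the denominators moves every [g i] into the span and preserves linear
   relations. *)
pose Q := \prod_i q i.
have q0 i : q i != 0 by case: (pq i).
have Q0 : Q != 0 by apply/prodf_neq0.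
have spanQ (P : pred 'I_m.+1) : span phi e (\prod_(i | P i) q i).
  by elim/big_rec: _ => // i y _; apply: eMul; case: (pq i).
have [|j|b [i0 bi0] gb] := @span_dependent _ _ phi I _ e (fun i => g i * Q).
- by rewrite card_ord.
- rewrite /Q (bigD1 j) //= mulrA; have [pj _ _ ->] := pq j.
  by rewrite divfK //; apply: eMul.
pose o i := ordX (b i).
(* At the place of an index [i] whose coefficient has least order, the i-th term of the relation
   dominates, since every other [g j] vanishes there. *)
have [i bi imin] := @arg_minP _ _ _ i0 (fun i => b i != 0) o bi0.
have pbi : phi (b i) * g i != 0.
  by rewrite mulf_neq0 ?fmorph_eq0 //; case: (gP i).
have Wphi k : W i (phi k) = W i f * ordX k by apply: place_specialize (pW i).2; case: (pW i).
have [gi0 Wgi _] := gP i.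
have Wbi : W i (phi (b i) * g i) = W i f * o i.
  by rewrite (placeM (pW i).1) ?fmorph_eq0 // Wgi addr0 Wphi.
have [|] := @place_dominant _ _ _ _ (pW i).1 _ (\sum_(j | j != i) phi (b j) * g j) pbi.
  apply: (place_ge_sum (pW i).1) => j ji.
  have [->|bj] := eqVneq (b j) 0; first by rewrite rmorph0 mul0r /place_ge eqxx.
  have [gj0 _ Wj] := gP j.
  apply: (place_geM (pW i).1); rewrite /place_ge; apply/orP; right.
    by rewrite Wbi Wphi ler_wpM2l ?imin // ltW; case: (pW i).
  by rewrite -gtz0_ge1 Wj // eq_sym.
move=> /eqP + _; apply; apply: (mulIf Q0); rewrite mul0r; apply: etrans gb.
rewrite -(bigD1 (P := xpredT) (F := fun j => phi (b j) * g j) i isT) /= mulr_suml.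
by apply: eq_bigr => j _; rewrite mulrA.
Qed.

End FiniteZeros.

(** * Transcendence degree of C(t) *)

Section TranscendenceDegree.

Lemma size_expM_leq (C : idomainType) (a b : {poly C}) k n i :
  (size a <= k.+1)%N -> (size b <= k.+1)%N -> (i <= n)%N ->
  (size (a ^+ i * b ^+ (n - i)%N)%R <= (n * k).+1)%N.
Proof.
move=> ak bk ni.
have sX (p : {poly C}) m : (size p <= k.+1)%N -> (size (p ^+ m)%R <= (m * k).+1)%N.
  move=> pk; apply: leq_trans (size_poly_exp_leq p m) _.
  by rewrite ltnS mulnC leq_mul2l; apply/orP; right; lia.
apply: leq_trans (size_polyMleq _ _) _.
have := leq_add (sX a i ak) (sX b (n - i)%N bk).
rewrite addSn addnS -mulnDl subnKC // => h; lia.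
Qed.

(* (n+1)^2 monomials f^i g^j live in a space of dimension linear in n. *)
Lemma rational_functions_dependent (C : fieldType) (f g : {fraction {poly C}}) :
  exists n, exists2 b : 'I_n.+1 * 'I_n.+1 -> C, exists p, b p != 0 &
    \sum_p ratC (b p) * (f ^+ p.1 * g ^+ p.2) = 0.
Proof.
have [a [e e0 ->]] := fraction_numdenP f.
have [c [d d0 ->]] := fraction_numdenP g.
pose k := (size a + size e + size c + size d)%N.
have k0 : (0 < k)%N.
  rewrite !addn_gt0 (_ : (0 < size d)%N) ?orbT //.
  by rewrite size_poly_gt0.
have [ak [ek [ck dk]]] : (size a <= k.+1 /\ size e <= k.+1 /\
    size c <= k.+1 /\ size d <= k.+1)%N by rewrite /k; lia.
(* The numerators have degree at most 2nk; with n = 2k there are (2k + 1)^2 monomials in dimension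
   4k^2 + 1. *)
pose n := (2 * k)%N; exists n.
pose N := (n * k + n * k).+1.
pose E (l : 'I_N) := ratX ^+ l / tofrac ((e * d) ^+ n).
apply: (@span_dependent _ _ (@ratC C) _ _ E).
  by rewrite card_prod !card_ord /N /n; nia.
move=> [i j] /=.
rewrite (tofrac_div_monomial a c e0 d0 (ltn_ord i : i <= n)%N (ltn_ord j : j <= n)%N).
set q := (_ * _ * (_ * _)).
have sq : (size q <= N)%N.
  apply: leq_trans (size_polyMleq _ _) _.
  have := leq_add (size_expM_leq ak ek (ltn_ord i : i <= n)%N)
    (size_expM_leq ck dk (ltn_ord j : j <= n)%N).
  rewrite /N; move: (size _ + size _)%N (n * k)%N => s t; lia.
exists (fun l : 'I_N => q`_l); rewrite -(horner_ratX q).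
rewrite (horner_coef_wide (n := N)) ?size_map_poly //.
rewrite mulr_suml; apply: eq_bigr => l _.
by rewrite coef_map mulrA.
Qed.

Lemma trdeg_one_ratC (R : realType) : trdeg_one (@ratC R[i]).
Proof.
split; first by exists ratX; exact: ratX_transcendental.
move=> f g; have [n [b [[i j] bij] E]] := rational_functions_dependent f g.
pose h := horner_at (@ratC R[i]) f.
exists (\poly_(j < n.+1) \poly_(i < n.+1) b (inord i, inord j)).
  apply: contraNneq bij => /(congr1 (fun P : {poly {poly R[i]}} => P`_j`_i)).
  by rewrite coef_poly ltn_ord coef_poly ltn_ord !inord_val !coef0 => ->.
set P := \poly_(j < _) _.
have -> : map_poly (fun q => (map_poly (@ratC R[i]) q).[f]) P = map_poly h P by [].
rewrite (horner_coef_wide (n := n.+1)); last first.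
  by apply: leq_trans (size_poly _ _) (size_poly _ _).
transitivity (\sum_i \sum_j ratC (b (i, j)) * (f ^+ i * g ^+ j)); last first.
  by rewrite -[RHS]E pair_bigA; apply: eq_bigr => -[].
rewrite exchange_big /=; apply: eq_bigr => l _.
rewrite coef_map coef_poly ltn_ord /= /horner_morph.
rewrite (horner_coef_wide (n := n.+1)); last first.
  by apply: leq_trans (size_poly _ _) (size_poly _ _).
rewrite mulr_suml; apply: eq_bigr => m _.
by rewrite coef_map coef_poly ltn_ord !inord_val mulrA.
Qed.

End TranscendenceDegree.

(** * The fan of a Bott tower *)

Section Pairing.
Variable r : nat.
Implicit Types (u : 'rV[int]_r) (m : 'cV[int]_r).

Lemma pairingDl u u' m : pairing (u + u') m = pairing u m + pairing u' m.
Proof. by rewrite /pairing mulmxDl mxE. Qed.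

Lemma pairingZl a u m : pairing (a *: u) m = a * pairing u m.
Proof. by rewrite /pairing -scalemxAl mxE. Qed.

Lemma pairing_suml (I : finType) (P : pred I) (F : I -> 'rV[int]_r) m :
  pairing (\sum_(i | P i) F i) m = \sum_(i | P i) pairing (F i) m.
Proof. by rewrite /pairing mulmx_suml summxE. Qed.

Lemma pairing0r u : pairing u 0 = 0.
Proof. by rewrite /pairing mulmx0 mxE. Qed.

Lemma pairingDr u m m' : pairing u (m + m') = pairing u m + pairing u m'.
Proof. by rewrite /pairing mulmxDr mxE. Qed.

Lemma pairingNr u m : pairing u (- m) = - pairing u m.
Proof. by rewrite /pairing mulmxN mxE. Qed.

Lemma pairingBr u m m' : pairing u (m - m') = pairing u m - pairing u m'.
Proof. by rewrite pairingDr pairingNr. Qed.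

Lemma pairingZr u a m : pairing u (a *: m) = a * pairing u m.
Proof. by rewrite /pairing -scalemxAr mxE. Qed.

Lemma pairing_sumr u (I : finType) (P : pred I) (F : I -> 'cV[int]_r) :
  pairing u (\sum_(i | P i) F i) = \sum_(i | P i) pairing u (F i).
Proof. by rewrite /pairing mulmx_sumr summxE. Qed.

End Pairing.

(** * Smoothness and completeness of the fan *)

Section BottTowerFan.
Variables (D : km_root_datum) (r : nat) (w : 'I_r -> 'I_(km_size D)).
Local Notation lray := (limit_ray w).
Local Notation rays := ('I_r * bool)%type.
Local Notation M := 'cV[int]_r.
Implicit Types (s : {ffun 'I_r -> bool}) (psi : rays -> int) (m : M).

Lemma limit_ray_lt (i : 'I_r) b (j : 'I_r) : (j < i)%N -> lray (i, b) 0 j = 0.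
Proof.
move=> ji; have ij : (j == i) = false by apply/negbTE; rewrite neq_ltn ji.
rewrite /limit_ray /=; case: b; rewrite !mxE ij /= ?oppr0 ?add0r //.
rewrite summxE big1 ?oppr0 // => l il; rewrite !mxE.
have -> : (j == l) = false by apply/negbTE; rewrite neq_ltn (ltn_trans ji il).
by rewrite mulr0.
Qed.

Lemma limit_ray_diag (i : 'I_r) b : lray (i, b) 0 i = if b then 1 else -1.
Proof.
rewrite /limit_ray /=; case: b; rewrite !mxE ?eqxx // summxE big1 ?subr0 // => l il.
rewrite !mxE (_ : (i == l) = false); last by apply/negbTE; rewrite neq_ltn il.
by rewrite mulr0.
Qed.

Definition sign_cone s : {set rays} := [set u | s u.1 == u.2]%SET.

Definition sign_frame s : 'M[int]_r := \matrix_(i, j) lray (i, s i) 0 j.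

(** Triangular with diagonal entries 1 and -1; this is the smoothness of the fan. *)
Lemma sign_frame_unit s : sign_frame s \in unitmx.
Proof.
rewrite -unitmx_tr unitmxE det_trig.
  apply: rpred_prod => i _; rewrite !mxE limit_ray_diag.
  by case: (s i); rewrite ?unitrN unitr1.
by apply/is_trig_mxP => i j ij; rewrite !mxE limit_ray_lt.
Qed.

Lemma sign_frameE s m i : (sign_frame s *m m) i 0 = pairing (lray (i, s i)) m.
Proof. by rewrite /pairing !mxE; apply: eq_bigr => j _; rewrite mxE. Qed.

Lemma sign_cone_inj s m m' :
  (forall i, pairing (lray (i, s i)) m = pairing (lray (i, s i)) m') -> m = m'.
Proof.
move=> h; rewrite -(mulKmx (sign_frame_unit s) m) -(mulKmx (sign_frame_unit s) m').
by congr (_ *m _); apply/matrixP => i j; rewrite ord1 !sign_frameE h.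
Qed.

(* The linear function that agrees with the support function psi on the
   maximal cone with signs s. *)
Definition local_eq s psi : M := invmx (sign_frame s) *m \col_i psi (i, s i).

Lemma pairing_local_eq s psi i :
  pairing (lray (i, s i)) (local_eq s psi) = psi (i, s i).
Proof. by rewrite -sign_frameE mulKVmx ?sign_frame_unit // mxE. Qed.

Lemma local_eq_unique s psi m :
  (forall i, psi (i, s i) = pairing (lray (i, s i)) m) -> local_eq s psi = m.
Proof. by move=> h; apply: (sign_cone_inj (s := s)) => i; rewrite pairing_local_eq. Qed.

Lemma local_eqD s psi psi' :
  local_eq s (fun u => psi u + psi' u) = local_eq s psi + local_eq s psi'.
Proof.
by apply: local_eq_unique => i; rewrite pairingDr !pairing_local_eq.
Qed.

Lemma local_eqZ s a psi : local_eq s (fun u => a * psi u) = a *: local_eq s psi.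
Proof. by apply: local_eq_unique => i; rewrite pairingZr !pairing_local_eq. Qed.

Lemma local_eq_sum s (I : finType) (P : pred I) (F : I -> rays -> int) :
  local_eq s (fun u => \sum_(k | P k) F k u) = \sum_(k | P k) local_eq s (F k).
Proof.
apply: local_eq_unique => i; rewrite pairing_sumr.
by apply: eq_bigr => k _; rewrite pairing_local_eq.
Qed.

Lemma eq_local_eq s psi psi' :
  (forall i, psi (i, s i) = psi' (i, s i)) -> local_eq s psi = local_eq s psi'.
Proof. by move=> h; apply: local_eq_unique => i; rewrite pairing_local_eq. Qed.

(* Exponent of the i-th coordinate on the affine chart with signs s. *)
Definition dual_vector s i : M := local_eq s (fun u => (u.1 == i)%:R).

Lemma pairing_dual_vector s i j :
  pairing (lray (j, s j)) (dual_vector s i) = (j == i)%:R.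
Proof. by rewrite pairing_local_eq. Qed.

Lemma dual_expansion s m :
  m = \sum_i pairing (lray (i, s i)) m *: dual_vector s i.
Proof.
apply: (sign_cone_inj (s := s)) => j; rewrite pairing_sumr (bigD1 j) //=.
rewrite pairingZr pairing_dual_vector eqxx mulr1 big1 ?addr0 // => i ij.
by rewrite pairingZr pairing_dual_vector eq_sym (negPf ij) mulr0.
Qed.

(* Coordinates are eliminated from the first to the last, the frame being
   triangular. *)
Lemma fan_complete (sigma : {set rays}) (v : 'rV[int]_r) :
  (forall i, ~~ (((i, true) \in sigma) && ((i, false) \in sigma))) ->
  exists s, exists c : 'I_r -> int,
    [/\ sigma \subset sign_cone s,
        v = \sum_i c i *: lray (i, s i),
        forall i, (i, s i) \notin sigma -> 0 <= c i
      & forall i : 'I_r, (forall j : 'I_r, (j <= i)%N -> v 0 j = 0) -> c i = 0].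
Proof.
move=> sigmaP.
(* After step [k] the first [k] coordinates of the remainder vanish; the rays used later do not
   involve them. *)
have : forall k, (k <= r)%N -> exists s, exists c : 'I_r -> int,
  [/\ forall (i : 'I_r) b, (i < k)%N -> (i, b) \in sigma -> s i = b,
      forall j : 'I_r, (j < k)%N -> (v - \sum_i c i *: lray (i, s i)) 0 j = 0,
      forall i : 'I_r, (k <= i)%N -> c i = 0,
      forall i : 'I_r, (i < k)%N -> (i, s i) \notin sigma -> 0 <= c i
    & forall i : 'I_r, (forall j : 'I_r, (j <= i)%N -> v 0 j = 0) -> c i = 0].
  elim=> [_|k IH kr].
    by exists [ffun => true], (fun=> 0); split.
  have [s [c [s1 c1 c2 c3 c4]]] := IH (ltnW kr).
  pose kk := Ordinal kr.
  set res := v - _ in c1.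
  (* A ray of [sigma] imposes the sign, and its coefficient may be negative; otherwise the sign
     makes the coefficient nonnegative. *)
  pose b := if (kk, true) \in sigma then true else
            if (kk, false) \in sigma then false else 0 <= res 0 kk.
  pose a := if b then res 0 kk else - res 0 kk.
  pose s' := [ffun i => if i == kk then b else s i].
  pose c' i := if i == kk then a else c i.
  have sumE : v - \sum_i c' i *: lray (i, s' i) = res - a *: lray (kk, b).
    rewrite /res (bigD1 kk) //= [X in _ = v - X - _](bigD1 kk) //=.
    rewrite (c2 kk) // scale0r add0r /c' /s' ffunE eqxx opprD addrA addrAC.
    congr (_ - _ - _); apply: eq_bigr => i ik.
    by rewrite ffunE (negPf ik).
  exists s', c'; split.
  - move=> i b'; rewrite ltnS leq_eqVlt /s' ffunE => /orP[/eqP ik|ik].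
      have ->: i = kk by apply: val_inj.
      rewrite eqxx /b; have := sigmaP kk.
      by case: b' => [_ ->//|]; case: ifP => //= _ /negPf h h'; rewrite h' in h *.
    have -> : (i == kk) = false by apply/negbTE; rewrite neq_ltn ik.
    exact: s1.
  - move=> j; rewrite sumE !mxE ltnS leq_eqVlt => /orP[/eqP jk|jk].
      have ->: j = kk by apply: val_inj.
      rewrite limit_ray_diag /a -[v 0 kk + _]/(_ + _); have := erefl (res 0 kk).
      by rewrite {1}/res !mxE => ->; case: (b); rewrite ?mulr1 ?mulrN1 ?opprK subrr.
    rewrite limit_ray_lt // mulr0 subr0.
    by have := c1 j jk; rewrite !mxE.
  - move=> i ki; rewrite /c'.
    have -> : (i == kk) = false by apply/negbTE; rewrite neq_ltn ki orbT.
    by rewrite c2 // ltnW.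
  - move=> i; rewrite ltnS leq_eqVlt /c' /s' ffunE => /orP[/eqP ik|ik].
      have ->: i = kk by apply: val_inj.
      rewrite eqxx /a /b; case: ifP => [kt|_]; first by rewrite kt.
      case: ifP => [kf|_]; first by rewrite kf.
      by case: ltP => // h _; rewrite oppr_ge0 ltW.
    have -> : (i == kk) = false by apply/negbTE; rewrite neq_ltn ik.
    exact: c3.
  move=> i vi; rewrite /c'; case: eqP => [ik|_]; last exact: c4.
  have res0 : res 0 kk = 0.
    rewrite /res !mxE summxE vi ?ik // big1 ?subr0 // => j _; rewrite mxE.
    have [kj|jk] := leqP k j; first by rewrite c2 // mul0r.
    rewrite c4 ?mul0r // => l lj; apply: vi; rewrite ik.
    exact: leq_trans lj (ltnW jk).
  by rewrite /a res0 oppr0; case: (b).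
move=> /(_ r (leqnn r))[s [c [s1 c1 _ c3 c4]]]; exists s, c; split => //.
- apply/fintype.subsetP => -[i b] ib; rewrite inE /=; apply/eqP; exact: (s1 i b).
- apply/rowP => j; have := c1 j (ltn_ord j); rewrite mxE [X in _ + X]mxE.
  by move/eqP; rewrite subr_eq0 => /eqP.
- by move=> i; apply: c3.
Qed.

(** Completeness applied to the sum of the two rays: its coordinates before [i] are 0 and the i-th
    entries 1 and -1 cancel, so only later rays occur. *)
Lemma primitive_relation i : exists s, exists c : 'I_r -> int,
  [/\ lray (i, true) + lray (i, false) = \sum_j c j *: lray (j, s j),
      forall j, 0 <= c j & forall j : 'I_r, (j <= i)%N -> c j = 0].
Proof.
have [|s [c [_ cE c0 cz]]] := @fan_complete finset.set0 (lray (i, true) + lray (i, false)).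
  by move=> j; rewrite !inE.
exists s, c; split=> // [j|j ji]; first by apply: c0; rewrite inE.
apply: cz => l lj; rewrite mxE.
have := leq_trans lj ji; rewrite leq_eqVlt => /orP[/eqP li|li].
  have -> : l = i by apply: val_inj.
  by rewrite !limit_ray_diag subrr.
by rewrite !limit_ray_lt // addr0.
Qed.

End BottTowerFan.

(** * Primitive relations and the dual nef basis *)

Section PrimitiveRelations.
Variables (D : km_root_datum) (r : nat) (w : 'I_r -> 'I_(km_size D)).
Local Notation lray := (limit_ray w).
Local Notation rays := ('I_r * bool)%type.
Implicit Types (s : {ffun 'I_r -> bool}) (psi : rays -> int) (i k : 'I_r).

Definition prim_sign i : {ffun 'I_r -> bool} := sval (cid (primitive_relation w i)).

Definition prim_coef i : 'I_r -> int := sval (cid (svalP (cid (primitive_relation w i)))).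

Lemma prim_relation i :
  lray (i, true) + lray (i, false) =
  \sum_j prim_coef i j *: lray (j, prim_sign i j).
Proof. by have [h1 h2 h3] := svalP (cid (svalP (cid (primitive_relation w i)))). Qed.

Lemma prim_coef_ge0 i k : 0 <= prim_coef i k.
Proof. have [h1 h2 h3] := svalP (cid (svalP (cid (primitive_relation w i)))); exact: h2. Qed.

Lemma prim_coef_eq0 i k : (k <= i)%N -> prim_coef i k = 0.
Proof. have [h1 h2 h3] := svalP (cid (svalP (cid (primitive_relation w i)))); exact: h3. Qed.

(* Intersection number of the divisor - sum_u psi(u) D_u with the class of the
   primitive relation of {e_i^+, e_i^-}. *)
Definition prim_degree i psi : int :=
  \sum_j prim_coef i j * psi (j, prim_sign i j) - (psi (i, true) + psi (i, false)).

Lemma prim_degreeD i psi psi' :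
  prim_degree i (fun u => psi u + psi' u) = prim_degree i psi + prim_degree i psi'.
Proof.
rewrite /prim_degree; under eq_bigr do rewrite mulrDr.
rewrite big_split /=; ring.
Qed.

Lemma prim_degreeZ i a psi :
  prim_degree i (fun u => a * psi u) = a * prim_degree i psi.
Proof.
rewrite /prim_degree; under eq_bigr do rewrite mulrCA.
rewrite -mulr_sumr; ring.
Qed.

Lemma prim_degree_sum i (I : finType) (P : pred I) (F : I -> rays -> int) :
  prim_degree i (fun u => \sum_(k | P k) F k u) = \sum_(k | P k) prim_degree i (F k).
Proof.
rewrite /prim_degree !sumrB big_split /=; congr (_ - _).
rewrite [RHS]exchange_big /=; apply: eq_bigr => j _.
by rewrite mulr_sumr.
Qed.

Lemma prim_degree_linear i m : prim_degree i (fun u => pairing (lray u) m) = 0.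
Proof.
rewrite /prim_degree -pairingDl prim_relation pairing_suml.
by apply/eqP; rewrite subr_eq0; apply/eqP/eq_bigr => j _; rewrite pairingZl.
Qed.

(** After subtracting the linear function that agrees with [psi] on the positive rays, the i-th
    relation expresses the value at the i-th negative ray through later rays, and descending
    induction gives 0. *)
Lemma prim_degree_eq0 psi : (forall i, prim_degree i psi = 0) ->
  exists m, forall u, psi u = pairing (lray u) m.
Proof.
move=> psi0; pose m := local_eq w [ffun=> true] psi; exists m.
pose psi' := fun u => psi u + (- 1) * pairing (lray u) m.
have psi'0 i : prim_degree i psi' = 0.
  by rewrite prim_degreeD prim_degreeZ prim_degree_linear psi0 mulr0 addr0.
have psi'T i : psi' (i, true) = 0.
  have := pairing_local_eq w [ffun=> true] psi i; rewrite ffunE => E.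
  by rewrite /psi' E mulN1r subrr.
suff psi'F n i : (r - i <= n)%N -> psi' (i, false) = 0.
  move=> [i b]; apply/eqP; rewrite -subr_eq0 -mulN1r.
  by case: b; rewrite -/(psi' (i, _)) ?psi'T ?(psi'F r) ?leq_subr.
elim: n i => [|n IH] i; first by rewrite leqn0 subn_eq0 leqNgt ltn_ord.
move=> rin; have := psi'0 i; rewrite /prim_degree psi'T add0r big1 ?add0r.
  by move/eqP; rewrite oppr_eq0 => /eqP.
move=> j _; have [ji|ij] := leqP j i; first by rewrite prim_coef_eq0 // mul0r.
case: (prim_sign i j); first by rewrite psi'T mulr0.
by rewrite IH ?mulr0 //; have := ltn_ord j; lia.
Qed.

(* Global generation: the local equation on every maximal cone is a global
   section. *)
Definition nef psi : Prop := forall s u, psi u <= pairing (lray u) (local_eq w s psi).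

Lemma nef_sum (I : finType) (P : pred I) (a : I -> int) (F : I -> rays -> int) :
  (forall l, P l -> 0 <= a l /\ nef (F l)) ->
  nef (fun u => \sum_(l | P l) a l * F l u).
Proof.
move=> aF s u; rewrite local_eq_sum pairing_sumr; apply: ler_sum => l Pl.
have [a0 nF] := aF l Pl.
by rewrite local_eqZ pairingZr ler_wpM2l.
Qed.

(** The last clause asks for strictness at the one ray of index [k] outside each maximal cone;
    combined over all [k] it gives strict convexity. *)
Definition nef_dual k psi : Prop :=
  [/\ forall i, prim_degree i psi = (i == k)%:R, nef psi &
      forall s, psi (k, ~~ s k) < pairing (lray (k, ~~ s k)) (local_eq w s psi)].

(* psi_b is the divisor D_(k,b) corrected by nef classes so as to vanish on all
   primitive classes but the k-th.  The two choices of b are linearly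
   equivalent, and each one is visibly generated on the charts that miss
   D_(k,b). *)
Lemma nef_dual_exists k : exists psi, nef_dual k psi.
Proof.
have [n kn] : exists n, (k < n)%N by exists k.+1.
elim: n k kn => // n IH k; rewrite ltnS => kn.
have IH' i : exists psi, (i < k)%N -> nef_dual i psi.
  have [ik|_] := ltnP i k; last by exists (fun=> 0).
  by have [psi ?] := IH i (leq_trans ik kn); exists psi.
have [Psi PsiP] := choice IH'.
(* For [i < k] this is minus the degree of D_(k,b) on the i-th class; its sign allows the correction
   by a nonnegative multiple of [Psi i]. *)
pose x (b : bool) i := prim_coef i k * (prim_sign i k == b)%:R.
have x0 b i : 0 <= x b i by rewrite mulr_ge0 ?prim_coef_ge0 // ler0n.
pose N b u := \sum_(i : 'I_r | (i < k)%N) x b i * Psi i u.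
pose psi (b : bool) u := -1 * (u == (k, b))%:R + N b u.
have nefN b : nef (N b).
  by apply: nef_sum => i ik; split; [exact: x0 | have [] := PsiP i ik].
have ddelta b i : prim_degree i (fun u => (u == (k, b))%:R) = x b i - (i == k)%:R.
  rewrite /prim_degree (bigD1 k) //= big1 ?addr0 => [|j /negPf jk].
    rewrite !xpair_eqE eqxx /x; congr (_ - _).
    by case: eqP; case: (b).
  by rewrite xpair_eqE jk mulr0.
have dpsi b i : prim_degree i (psi b) = (i == k)%:R.
  rewrite prim_degreeD prim_degreeZ prim_degree_sum ddelta.
  rewrite (eq_bigr (fun l => x b l * (i == l)%:R)); last first.
    by move=> l lk; rewrite prim_degreeZ; have [-> _ _] := PsiP l lk.
  have [ik|ki] := ltnP i k.
    rewrite (bigD1 i) //= eqxx mulr1 big1 ?addr0 => [|l /andP[_]]; first by ring.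
    by rewrite eq_sym => /negPf->; rewrite mulr0.
  rewrite /x prim_coef_eq0 // big1 => [|l lk]; first by ring.
  have -> : (i == l) = false by apply/negbTE; rewrite neq_ltn (leq_trans lk ki) orbT.
  by rewrite mulr0.
have psiN b u : psi b u <= N b u.
  by rewrite /psi gerDr mulN1r oppr_le0 ler0n.
have local b s : s k = ~~ b -> local_eq w s (psi b) = local_eq w s (N b).
  move=> sk; apply: eq_local_eq => i; rewrite /psi xpair_eqE.
  by case: eqP => [->|_]; rewrite ?sk ?mulr0 ?add0r //; case: (b); rewrite mulr0 add0r.
have nef_b b s : s k = ~~ b ->
    (forall u, psi b u <= pairing (lray u) (local_eq w s (psi b))) /\
    psi b (k, ~~ s k) < pairing (lray (k, ~~ s k)) (local_eq w s (psi b)).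
  move=> sk; rewrite local //; split=> [u|]; first exact: le_trans (nefN b s u).
  apply: lt_le_trans (nefN b s _).
  by rewrite sk negbK /psi eqxx mulr1 addrC ltrBlDr ltrDl.
have [m mE] : exists m, forall u, psi true u + -1 * psi false u = pairing (lray u) m.
  apply: prim_degree_eq0 => i.
  by rewrite prim_degreeD prim_degreeZ !dpsi mulN1r subrr.
have psiE u : psi true u = psi false u + pairing (lray u) m.
  by rewrite -mE mulN1r addrC subrK.
have localE s : local_eq w s (psi true) = local_eq w s (psi false) + m.
  by apply: local_eq_unique => i; rewrite pairingDr pairing_local_eq -psiE.
have nef_true s :
    (forall u, psi true u <= pairing (lray u) (local_eq w s (psi true))) /\
    psi true (k, ~~ s k) < pairing (lray (k, ~~ s k)) (local_eq w s (psi true)).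
  case sk: (s k); last by rewrite -sk; apply: nef_b.
  have [h1 h2] := nef_b false s sk; rewrite localE; rewrite sk in h2; split=> [u|].
    by rewrite psiE pairingDr lerD2r.
  by rewrite psiE pairingDr ltrD2r.
by exists (psi true); split=> // s; [move=> u|]; case: (nef_true s).
Qed.

Definition dual_psi k : rays -> int := sval (cid (nef_dual_exists k)).

Lemma dual_psiP k : nef_dual k (dual_psi k).
Proof. by rewrite /dual_psi; case: cid. Qed.

(** The difference has degree 0 on every primitive class, hence is linear. *)
Lemma dual_psi_decomposition psi : exists m, forall u,
  psi u = \sum_k prim_degree k psi * dual_psi k u + pairing (lray u) m.
Proof.
have [|m mE] := @prim_degree_eq0
  (fun u => psi u + -1 * \sum_k prim_degree k psi * dual_psi k u).
  move=> i; rewrite prim_degreeD prim_degreeZ prim_degree_sum (bigD1 i) //=.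
  rewrite prim_degreeZ (_ : prim_degree i (dual_psi i) = 1); last first.
    by have [-> _ _] := dual_psiP i; rewrite eqxx.
  rewrite big1 ?addr0 ?mulr1 ?mulN1r ?subrr // => k ki; rewrite prim_degreeZ.
  by have [-> _ _] := dual_psiP k; rewrite eq_sym (negPf ki) mulr0.
by exists m => u; rewrite -mE mulN1r addrC subrK.
Qed.

Definition strictly_convex psi : Prop :=
  forall s u, u \notin sign_cone s -> psi u < pairing (lray u) (local_eq w s psi).

(** A ray outside the cone of [s] is some [(k, ~~ s k)]; there the k-th summand of [psi] is strict
    and the others are nef. *)
Lemma strictly_convex_criterion psi :
  (forall i, 0 < prim_degree i psi) -> strictly_convex psi.
Proof.
move=> dpos s [k b]; rewrite inE /= => sk.
have bE : b = ~~ s k by move: sk; case: b; case: (s k).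
have [m mE] := dual_psi_decomposition psi.
have -> : local_eq w s psi =
    \sum_i prim_degree i psi *: local_eq w s (dual_psi i) + m.
  apply: local_eq_unique => i; rewrite mE pairingDr pairing_sumr; congr (_ + _).
  by apply: eq_bigr => l _; rewrite pairingZr pairing_local_eq.
rewrite mE pairingDr ltrD2r pairing_sumr (bigD1 k) //= [ltRHS](bigD1 k) //=.
apply: ltr_leD.
  rewrite pairingZr ltr_pM2l // bE; by have [_ _] := dual_psiP k.
apply: ler_sum => i _; rewrite pairingZr ler_wpM2l ?(ltW (dpos _)) //.
by have [_ h _] := dual_psiP i; apply: h.
Qed.

End PrimitiveRelations.

(** * Points and line bundles *)

Section LaurentCoefficients.
Variables (R : realType) (r : nat).
Local Notation C := R[i].
Local Notation M := 'cV[int]_r.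
Implicit Types p q : laurent R r.

(** A list may repeat an exponent; this is the total coefficient. *)
Definition lcoef p (m : M) : C := \sum_(t <- p | t.2 == m) t.1.

Lemma sum_lcoef (K : fieldType) (iota : {rmorphism C -> K}) (F : M -> K) p
    (ms : seq M) : uniq ms -> (forall t, t \in p -> t.2 \in ms) ->
  \sum_(t <- p) iota t.1 * F t.2 = \sum_(m <- ms) iota (lcoef p m) * F m.
Proof.
move=> ums pms.
under [RHS]eq_bigr => m _ do rewrite rmorph_sum mulr_suml big_mkcond /=.
rewrite exchange_big /=; apply: eq_big_seq => t tp.
rewrite (bigD1_seq t.2) ?pms //= eqxx big1 ?addr0 // => m mt.
by rewrite eq_sym (negPf mt).
Qed.

Lemma lcoef_neq0_mem p m : lcoef p m != 0 -> m \in [seq t.2 | t <- p].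
Proof.
apply: contraNT => mp; rewrite /lcoef big_seq_cond big1 // => t /andP[tp /eqP tm].
by rewrite -tm map_f in mp.
Qed.

Definition one_param (lam : 'rV[int]_r) (c : C) p : C :=
  \sum_(t <- p) t.1 * c ^ pairing lam t.2.

(** The point is a positive integer because parameters of torus points have to be nonzero. *)
Lemma poly_nonroot (F : numDomainType) (p : {poly F}) :
  p != 0 -> exists n, ~~ root p n.+1%:R.
Proof.
move=> p0; apply: contrapT => h.
pose rs := mkseq (fun n => n.+1%:R : F) (size p).
have urs : uniq rs.
  by apply: mkseq_uniq => i j /eqP; rewrite eqr_nat => /eqP[].
have ars : all (root p) rs.
  apply/allP => x /mapP[n _ ->]; apply: contrapT => /negP nr.
  by apply: h; exists n.
by have := max_poly_roots p0 ars urs; rewrite size_mkseq ltnn.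
Qed.

(* A one-parameter subgroup (1, n, n^2, ...) off finitely many hyperplanes. *)
Lemma separating_one_param (ds : seq M) : all (fun d => d != 0) ds ->
  exists lam : 'rV[int]_r, forall d, d \in ds -> pairing lam d != 0.
Proof.
move=> /allP ds0; pose P (d : M) := \poly_(i < r) (if insub i is Some j then d j 0 else 0).
have P0 d : d \in ds -> P d != 0.
  move=> /ds0; apply: contra_neq => Pd; apply/colP => j; rewrite mxE.
  have := congr1 (fun p : {poly int} => p`_j) Pd.
  by rewrite coef_poly ltn_ord valK coef0.
have prod0 : \prod_(d <- ds) P d != 0.
  by rewrite prodf_seq_neq0; apply/allP => d /P0.
have [n nroot] := poly_nonroot prod0.
exists (\row_i n.+1%:R ^+ i) => d dds.
have := nroot; rewrite (big_rem d dds) /= rootM negb_or => /andP[+ _].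
rewrite rootE (horner_coef_wide (n := r)) ?size_poly //.
rewrite /pairing mxE; congr (_ != 0); apply: eq_bigr => j _.
by rewrite mxE coef_poly ltn_ord valK mulrC.
Qed.

(** The factor X^N clears negative exponents; for [N] large the absolute value changes nothing. *)
Definition one_param_poly lam (N : nat) p : {poly C} :=
  \sum_(t <- p) t.1 *: 'X^`|pairing lam t.2 + N%:Z|.

Lemma one_param_polyE lam N p c : c != 0 ->
  (forall t, t \in p -> 0 <= pairing lam t.2 + N%:Z) ->
  (one_param_poly lam N p).[c] = c ^+ N * one_param lam c p.
Proof.
move=> c0 pN; rewrite /one_param_poly horner_sum mulr_sumr.
apply: eq_big_seq => t /pN tN; rewrite hornerZ hornerXn mulrCA; congr (_ * _).
by rewrite exprnP gez0_abs // expfzDr // mulrC.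
Qed.

(** A separating [lam] sends distinct exponents to distinct powers, so their coefficients do not
    mix. *)
Lemma coef_one_param_poly lam N p m :
  (forall t, t \in p -> 0 <= pairing lam t.2 + N%:Z) ->
  0 <= pairing lam m + N%:Z ->
  (forall t, t \in p -> t.2 != m -> pairing lam (t.2 - m) != 0) ->
  (one_param_poly lam N p)`_`|pairing lam m + N%:Z| = lcoef p m.
Proof.
move=> pN mN sep; rewrite coef_sum /lcoef [RHS]big_mkcond; apply: eq_big_seq => t tp.
rewrite coefZ coefXn; case: (eqVneq t.2 m) => [->|tm]; first by rewrite eqxx mulr1.
rewrite (_ : (_ == _) = false) ?mulr0 //; apply/negbTE.
apply: contra_neq (sep t tp tm) => h; rewrite pairingBr.
have : pairing lam m + N%:Z = pairing lam t.2 + N%:Z.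
  by rewrite -(gez0_abs mN) -(gez0_abs (pN t tp)) h.
by move/addIr => ->; rewrite subrr.
Qed.

Lemma one_param_bound lam (ms : seq M) :
  exists N : nat, forall m, m \in ms -> 0 <= pairing lam m + N%:Z.
Proof.
exists (\sum_(m <- ms) `|pairing lam m|)%N => m mms.
rewrite (big_rem m mms) /= PoszD addrA; apply: addr_ge0 => //.
by lia.
Qed.

Lemma separating_pair p q m : exists lam : 'rV[int]_r,
  forall t, t \in p ++ q -> forall t', t' \in (0, m) :: p ++ q ->
    t.2 != t'.2 -> pairing lam (t.2 - t'.2) != 0.
Proof.
pose ds := [seq d <- [seq t.2 - t'.2 | t <- p ++ q, t' <- (0 : C, m) :: p ++ q] | d != 0].
have [lam lamP] : exists lam : 'rV[int]_r, forall d, d \in ds -> pairing lam d != 0.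
  by apply: separating_one_param; apply/allP => d; rewrite mem_filter => /andP[].
exists lam => t tp t' t'p tt'; apply: lamP; rewrite mem_filter subr_eq0 tt'.
by apply/allpairsP; exists (t, t').
Qed.

Lemma lcoef_eq0 p : (forall lam c, c != 0 -> one_param lam c p = 0) ->
  forall m, lcoef p m = 0.
Proof.
move=> p0 m; have [lam lamP] := separating_pair p [::] m.
have [N NP] := one_param_bound lam (m :: [seq t.2 | t <- p]).
have pN t : t \in p -> 0 <= pairing lam t.2 + N%:Z.
  by move=> tp; apply: NP; rewrite inE map_f ?orbT.
rewrite -(coef_one_param_poly (lam := lam) (N := N)) //; first last.
- move=> t tp tm; apply: (lamP t _ (0, m)) => //; first by rewrite cats0.
  exact: mem_head.
- by apply: NP; rewrite mem_head.
rewrite (_ : one_param_poly _ _ _ = 0) ?coef0 //; apply/eqP/negPn/negP.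
move/poly_nonroot => [n]; apply/negP; rewrite negbK; apply/eqP.
by rewrite one_param_polyE ?pnatr_eq0 // p0 ?mulr0 // pnatr_eq0.
Qed.

(* Restricted to a generic one-parameter subgroup, a unit of the Laurent ring
   divides a power of the variable. *)
Lemma laurent_unit_monomial p q :
  (forall lam c, c != 0 -> one_param lam c p * one_param lam c q = 1) ->
  exists2 m, lcoef p m != 0 & forall m', m' != m -> lcoef p m' = 0.
Proof.
move=> pq; have [lam lamP] := separating_pair p q 0.
have [N NP] := one_param_bound lam [seq t.2 | t <- p ++ q].
have pN t : t \in p -> 0 <= pairing lam t.2 + N%:Z.
  by move=> tp; apply: NP; apply: map_f; rewrite mem_cat tp.
have qN t : t \in q -> 0 <= pairing lam t.2 + N%:Z.
  by move=> tp; apply: NP; apply: map_f; rewrite mem_cat tp orbT.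
have coefE t : t \in p ->
    (one_param_poly lam N p)`_`|pairing lam t.2 + N%:Z| = lcoef p t.2.
  move=> tp; apply: coef_one_param_poly => // [|t' tp' tt']; first exact: pN.
  by apply: lamP; rewrite ?inE ?mem_cat ?tp' ?tp ?orbT.
have /eqP : one_param_poly lam N p * (one_param_poly lam N q * 'X) = 'X^((N + N).+1).
  apply/eqP; rewrite -subr_eq0; apply/negPn/negP => /poly_nonroot[n].
  have c0 : n.+1%:R != 0 :> C by rewrite pnatr_eq0.
  apply/negP; rewrite negbK; apply/eqP.
  rewrite hornerD hornerN hornerXn !hornerM hornerX !one_param_polyE //.
  by rewrite mulrA mulrACA pq // mulr1 -exprD -exprSr subrr.
move/eqP => E; have : one_param_poly lam N p %| 'X^((N + N).+1).
  by rewrite -E dvdp_mulr.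
rewrite -['X]subr0 => /dvdp_exp_XsubCP[k _ /eqpf_eq[a a0]].
rewrite subr0 => pE.
have [t0 tp0 tk] : exists2 t, t \in p & absz (pairing lam t.2 + N%:Z) = k.
  apply: contrapT => h.
  have : (one_param_poly lam N p)`_k = a by rewrite pE coefZ coefXn eqxx mulr1.
  rewrite coef_sum big_seq big1 => [/esym/eqP|t tp]; first by rewrite (negPf a0).
  rewrite coefZ coefXn (_ : (k == _) = false) ?mulr0 //.
  by apply/negbTE/eqP => kt; apply: h; exists t.
exists t0.2; first by rewrite -coefE // tk pE coefZ coefXn eqxx mulr1.
move=> m' mm'; apply/eqP/negPn/negP => m0.
have /mapP[t tp mt] := lcoef_neq0_mem m0.
move: m0; rewrite mt -coefE // pE coefZ coefXn -tk.
have [h|_] := eqVneq (absz (pairing lam t.2 + N%:Z)); last by rewrite mulr0 eqxx.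
have /eqP : pairing lam (t.2 - t0.2) = 0.
  apply/eqP; rewrite pairingBr subr_eq0; apply/eqP/(@addIr _ N%:Z).
  by rewrite -(gez0_abs (pN t tp)) -(gez0_abs (pN t0 tp0)) h.
move=> h0 _; move: h0; apply/negP; apply: lamP; rewrite ?inE ?mem_cat ?tp ?tp0 ?orbT //.
by rewrite -mt.
Qed.

End LaurentCoefficients.

(** * Points in affine charts *)

Section Points.
Variables (D : km_root_datum) (r : nat) (w : 'I_r -> 'I_(km_size D)).
Local Notation lray := (limit_ray w).
Local Notation rays := ('I_r * bool)%type.
Local Notation X := (toric_limit w).
Local Notation M := 'cV[int]_r.
Implicit Types (s : {ffun 'I_r -> bool}) (A B : {set rays}) (m : M).

Definition cone_sign A : {ffun 'I_r -> bool} := [ffun i => (i, true) \in A].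

Lemma sign_coneK s : cone_sign (sign_cone s) = s.
Proof. by apply/ffunP => i; rewrite ffunE inE /=; case: (s i). Qed.

Lemma in_cones A : (A \in cones X) =
  [forall i, ~~ (((i, true) \in A) && ((i, false) \in A))].
Proof. by rewrite inE. Qed.

Lemma chart_sign_cone s : chart (X := X) (sign_cone s).
Proof.
rewrite /chart in_cones; apply/andP; split.
  by apply/forallP => i; rewrite !inE /=; case: (s i).
have -> : sign_cone s = [set (i, s i) | i : 'I_r]%SET.
  apply/setP => -[i b]; rewrite inE /=; apply/eqP/imsetP => [<-|[j _ [-> ->]]//].
  by exists i.
by rewrite card_imset ?card_ord // => i j [].
Qed.

(** With [r] rays and at most one ray of each pair, the cone has exactly one of each. *)
Lemma chartE A : chart (X := X) A -> A = sign_cone (cone_sign A).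
Proof.
rewrite /chart in_cones => /andP[/forallP A1 /eqP Ar].
suff sub : A \subset sign_cone (cone_sign A).
  have := chart_sign_cone (cone_sign A); rewrite /chart => /andP[_ /eqP cr].
  by apply/eqP; rewrite eqEcard sub Ar cr /=.
have fst_inj : {in A &, injective (fun u : rays => u.1)}.
  move=> [i b] [j b'] /= ib jb' ij; subst j; congr (_, _).
  by have := A1 i; move: ib jb'; case: b; case: b' => // -> ->.
apply/fintype.subsetP => -[i b] ib; rewrite inE /= ffunE; apply/eqP.
case: b ib => // iF; apply/negbTE; have := A1 i; by rewrite iF andbT.
Qed.

Lemma chart_cover A : A \in cones X -> exists s, A \subset sign_cone s.
Proof.
rewrite in_cones => /forallP AP; exists [ffun i => (i, false) \notin A].
apply/fintype.subsetP => -[i b] ib; rewrite inE /= ffunE.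
by case: b ib => ib; [have := AP i; rewrite ib /= => -> | rewrite ib].
Qed.

Lemma dual_coneP A m :
  reflect (forall u, u \in A -> 0 <= pairing (lray u) m) (dual_cone (X := X) A m).
Proof. exact: (iffP forall_inP). Qed.

Lemma perp_coneP A m :
  reflect (forall u, u \in A -> pairing (lray u) m = 0) (perp_cone (X := X) A m).
Proof. by apply: (iffP forall_inP) => h u /h /eqP. Qed.

Lemma perp_coneN A m : perp_cone (X := X) A (- m) = perp_cone (X := X) A m.
Proof. by apply: eq_forallb_in => u _; rewrite pairingNr oppr_eq0. Qed.

Lemma perp_coneD A m m' : perp_cone (X := X) A m -> perp_cone (X := X) A m' ->
  perp_cone (X := X) A (m + m').
Proof.
move=> /perp_coneP h /perp_coneP h'; apply/perp_coneP => u uA.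
by rewrite pairingDr h // h' // addr0.
Qed.

Lemma perp_coneZ A a m : perp_cone (X := X) A m -> perp_cone (X := X) A (a *: m).
Proof.
by move=> /perp_coneP h; apply/perp_coneP => u uA; rewrite pairingZr h // mulr0.
Qed.

Lemma perp_cone0 A : perp_cone (X := X) A 0.
Proof. by apply/perp_coneP => u _; rewrite pairing0r. Qed.

Lemma perp_dual_cone A m : perp_cone (X := X) A m -> dual_cone (X := X) A m.
Proof. by move=> /perp_coneP h; apply/dual_coneP => u /h->. Qed.

Lemma perp_coneS A B m : A \subset B ->
  perp_cone (X := X) B m -> perp_cone (X := X) A m.
Proof.
by move=> /fintype.subsetP AB /perp_coneP h; apply/perp_coneP => u /AB /h.
Qed.

Lemma dual_coneS A B m : A \subset B ->
  dual_cone (X := X) B m -> dual_cone (X := X) A m.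
Proof.
by move=> /fintype.subsetP AB /dual_coneP h; apply/dual_coneP => u /AB /h.
Qed.

Lemma dual_coneD A m m' : dual_cone (X := X) A m -> dual_cone (X := X) A m' ->
  dual_cone (X := X) A (m + m').
Proof.
move=> /dual_coneP h /dual_coneP h'; apply/dual_coneP => u uA.
by rewrite pairingDr addr_ge0 ?h ?h'.
Qed.

Lemma dual_cone_dual_vector s i : dual_cone (X := X) (sign_cone s) (dual_vector w s i).
Proof.
apply/dual_coneP => -[j b]; rewrite inE => /eqP /= <-.
by rewrite pairing_dual_vector ler0n.
Qed.

Section PointTheory.
Variables (K : fieldType) (x : kpoint X K).

Lemma pt_cone_in : pt_cone x \in cones X. Proof. by case: x. Qed.

Lemma pt_val0 : pt_val x 0 = 1. Proof. by case: x. Qed.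

Lemma pt_val_neq0 m : (pt_val x m != 0) = perp_cone (pt_cone x) m.
Proof. by case: x. Qed.

Lemma pt_valD m m' : dual_cone (pt_cone x) m -> dual_cone (pt_cone x) m' ->
  pt_val x (m + m') = pt_val x m * pt_val x m'.
Proof. by case: x => ? ? ? ? h ?; apply: h. Qed.

Lemma pt_valDp m m' : perp_cone (pt_cone x) m -> perp_cone (pt_cone x) m' ->
  pt_val x (m + m') = pt_val x m * pt_val x m'.
Proof. by move=> /perp_dual_cone h /perp_dual_cone; apply: pt_valD. Qed.

Lemma pt_valN m : perp_cone (pt_cone x) m -> pt_val x (- m) = (pt_val x m)^-1.
Proof.
move=> h; have h0 : pt_val x m != 0 by rewrite pt_val_neq0.
by apply: (mulIf h0); rewrite mulVf // -pt_valDp ?perp_coneN // addNr pt_val0.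
Qed.

Lemma pt_valMn m n : dual_cone (pt_cone x) m -> pt_val x (m *+ n) = pt_val x m ^+ n.
Proof.
move=> h; have hn k : dual_cone (pt_cone x) (m *+ k).
  elim: k => [|k IH]; last by rewrite mulrS dual_coneD.
  by rewrite mulr0n; apply/perp_dual_cone/perp_cone0.
elim: n => [|n IH]; first by rewrite mulr0n pt_val0.
by rewrite mulrS pt_valD // IH exprS.
Qed.

Lemma pt_valZ m (a : int) : perp_cone (pt_cone x) m ->
  pt_val x (a *: m) = pt_val x m ^ a.
Proof.
move=> h; case: a => n.
  by rewrite -[Posz n]natz scaler_nat pt_valMn ?perp_dual_cone // natz.
rewrite NegzE scaleNr pt_valN ?perp_coneZ // -[Posz _]natz scaler_nat.
by rewrite pt_valMn ?perp_dual_cone // natz -exprnN.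
Qed.

Lemma pt_val_sum (I : finType) (P : pred I) (F : I -> M) :
  (forall i, P i -> perp_cone (pt_cone x) (F i)) ->
  perp_cone (pt_cone x) (\sum_(i | P i) F i) /\
  pt_val x (\sum_(i | P i) F i) = \prod_(i | P i) pt_val x (F i).
Proof.
move=> pF; elim/big_rec2: _ => [|i a b Pi [pb bE]].
  by rewrite pt_val0; split=> //; exact: perp_cone0.
by split; [exact/perp_coneD/pb/pF | rewrite pt_valDp ?bE //; exact: pF].
Qed.

Variable s : {ffun 'I_r -> bool}.
Hypothesis xs : in_chart (X := X) (sign_cone s) x.

Lemma perp_dual_vector i : perp_cone (pt_cone x) (dual_vector w s i) =
  ((i, s i) \notin pt_cone x).
Proof.
apply/perp_coneP/idP => [h|h [j b] jx].
  apply/negP => /h; rewrite pairing_dual_vector eqxx => /eqP.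
  by rewrite oner_eq0.
have := fintype.subsetP xs _ jx; rewrite inE /= => /eqP sj; subst b.
rewrite pairing_dual_vector; case: eqP => // ji; subst j.
by rewrite jx in h.
Qed.

(** The orbit of a point is read off its vanishing coordinates in a chart. *)
Lemma in_pt_cone (u : rays) :
  (u \in pt_cone x) = (s u.1 == u.2) && (pt_val x (dual_vector w s u.1) == 0).
Proof.
case: u => i b /=; case: eqP => [<-|sb] /=.
  by rewrite -[RHS]negbK pt_val_neq0 perp_dual_vector negbK.
apply/negbTE/negP => ib; have := fintype.subsetP xs _ ib.
by rewrite inE /= => /eqP.
Qed.

(** Coordinates vanishing at [x] occur with exponent 0, so negative powers are taken of nonzero
    values only. *)
Lemma pt_val_perp m : perp_cone (pt_cone x) m ->
  pt_val x m = \prod_i pt_val x (dual_vector w s i) ^ pairing (lray (i, s i)) m.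
Proof.
move=> /perp_coneP pm; rewrite {1}(dual_expansion w s m).
rewrite (bigID (fun i => (i, s i) \in pt_cone x)) /=.
rewrite big1 ?add0r => [|i ix]; last by rewrite pm // scale0r.
have [|_ ->] := @pt_val_sum _ (fun i => (i, s i) \notin pt_cone x)
    (fun i => pairing (lray (i, s i)) m *: dual_vector w s i).
  by move=> i ix; rewrite perp_coneZ // perp_dual_vector.
rewrite [RHS](bigID (fun i => (i, s i) \in pt_cone x)) /= [X in _ = X * _]big1 ?mul1r.
  by apply: eq_bigr => i ix; rewrite pt_valZ // perp_dual_vector.
by move=> i ix; rewrite pm // expr0z.
Qed.

Lemma pt_val_dual m : dual_cone (X := X) (sign_cone s) m ->
  pt_val x m = \prod_i pt_val x (dual_vector w s i) ^+ `|pairing (lray (i, s i)) m|.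
Proof.
move=> /dual_coneP dm.
have mE : m = \sum_i (dual_vector w s i *+ `|pairing (lray (i, s i)) m|).
  rewrite {1}(dual_expansion w s m); apply: eq_bigr => i _.
  by rewrite -scaler_nat natz gez0_abs // dm // inE.
have dv i : dual_cone (pt_cone x) (dual_vector w s i).
  exact: dual_coneS xs (dual_cone_dual_vector s i).
rewrite {1}mE; suff [] : dual_cone (pt_cone x)
      (\sum_i (dual_vector w s i *+ `|pairing (lray (i, s i)) m|)) /\
    pt_val x (\sum_i (dual_vector w s i *+ `|pairing (lray (i, s i)) m|)) =
    \prod_i pt_val x (dual_vector w s i) ^+ `|pairing (lray (i, s i)) m| by [].
elim/big_rec2: _ => [|i a b _ [pb bE]].
  by rewrite pt_val0; split=> //; apply/perp_dual_cone/perp_cone0.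
have dvn n : dual_cone (pt_cone x) (dual_vector w s i *+ n).
  elim: n => [|n IH]; first by rewrite mulr0n; apply/perp_dual_cone/perp_cone0.
  by rewrite mulrS dual_coneD.
by rewrite dual_coneD // pt_valD // pt_valMn // bE.
Qed.

End PointTheory.

Lemma kpoint_ext (K : fieldType) (x y : kpoint X K) :
  pt_cone x = pt_cone y -> pt_val x = pt_val y -> x = y.
Proof.
case: x y => [A v h1 h2 h3 h4] [A' v' h1' h2' h3' h4'] /= EA Ev; subst A' v'.
by congr KPoint; apply: Prop_irrelevance.
Qed.

Lemma kpoint_coord_eq (K : fieldType) (x y : kpoint X K) s :
  in_chart (X := X) (sign_cone s) x -> in_chart (X := X) (sign_cone s) y ->
  (forall i, pt_val x (dual_vector w s i) = pt_val y (dual_vector w s i)) -> x = y.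
Proof.
move=> xs ys xy.
have cE : pt_cone x = pt_cone y.
  by apply/setP => u; rewrite (in_pt_cone xs) (in_pt_cone ys) xy.
apply: kpoint_ext => //; apply/funext => m.
have [pm|pm] := boolP (perp_cone (pt_cone x) m).
  rewrite (pt_val_perp xs) // (pt_val_perp ys) -?cE //.
  by apply: eq_bigr => i _; rewrite xy.
have := pm; rewrite -pt_val_neq0 negbK => /eqP->.
by move: pm; rewrite cE -pt_val_neq0 negbK => /eqP->.
Qed.

Section CoordinatePoint.
Variables (K : fieldType) (s : {ffun 'I_r -> bool}) (z : 'I_r -> K).

Definition coord_cone : {set rays} := [set u | (s u.1 == u.2) && (z u.1 == 0)]%SET.

(** Off the orthogonal of the cone, a regular monomial involves a vanishing coordinate; for the
    other exponents 0 is the convention for points. *)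
Definition coord_val m : K :=
  if perp_cone (X := X) coord_cone m
  then \prod_i z i ^ pairing (lray (i, s i)) m else 0.

Lemma coord_cone_sub : coord_cone \subset sign_cone s.
Proof. by apply/fintype.subsetP => u; rewrite !inE => /andP[]. Qed.

Lemma coord_cone_in : coord_cone \in cones X.
Proof.
rewrite in_cones; apply/forallP => i; rewrite !inE /=.
by case: (s i); rewrite ?andbF.
Qed.

Lemma coord_val0 : coord_val 0 = 1.
Proof.
rewrite /coord_val perp_cone0 big1 // => i _.
by rewrite pairing0r expr0z.
Qed.

Lemma coord_val_neq0 m : (coord_val m != 0) = perp_cone (X := X) coord_cone m.
Proof.
rewrite /coord_val; case: ifPn => [/perp_coneP pm|_]; last by rewrite eqxx.
apply/prodf_neq0 => i _; have [zi|zi] := eqVneq (z i) 0; last by rewrite expfz_neq0.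
by rewrite pm ?expr0z ?oner_neq0 // inE /= eqxx zi eqxx.
Qed.

Lemma coord_valD m m' : dual_cone (X := X) coord_cone m ->
  dual_cone (X := X) coord_cone m' ->
  coord_val (m + m') = coord_val m * coord_val m'.
Proof.
move=> dm dm'; rewrite /coord_val.
have -> : perp_cone (X := X) coord_cone (m + m') =
    perp_cone (X := X) coord_cone m && perp_cone (X := X) coord_cone m'.
  apply/idP/andP => [/perp_coneP pD|[]]; last exact: perp_coneD.
  have h u : u \in coord_cone -> pairing (lray u) m = 0 /\ pairing (lray u) m' = 0.
    move=> uc; have := pD u uc; rewrite pairingDr => /eqP.
    by rewrite paddr_eq0 ?(dual_coneP _ _ dm) ?(dual_coneP _ _ dm') // => /andP[/eqP-> /eqP->].
  by split; apply/perp_coneP => u /h[].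
case: ifPn => [/andP[pm pm']|]; last first.
  by rewrite negb_and => /orP[]/negPf->; rewrite ?mul0r ?mulr0.
rewrite pm pm' -big_split; apply: eq_bigr => i _ /=.
rewrite pairingDr; have [zi|zi] := eqVneq (z i) 0; last by rewrite expfzDr.
have ic : (i, s i) \in coord_cone by rewrite inE /= eqxx zi eqxx.
by rewrite (perp_coneP _ _ pm) // (perp_coneP _ _ pm') // addr0 expr0z mulr1.
Qed.

Definition coord_point : kpoint X K :=
  @KPoint _ X K coord_cone coord_val coord_cone_in coord_val0 coord_valD coord_val_neq0.

Lemma coord_point_chart : in_chart (X := X) (sign_cone s) coord_point.
Proof. exact: coord_cone_sub. Qed.

Lemma coord_point_coord i : pt_val coord_point (dual_vector w s i) = z i.
Proof.
rewrite /= /coord_val; case: ifPn => [_|np].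
  rewrite (bigD1 i) //= pairing_dual_vector eqxx expr1z big1 ?mulr1 // => j ji.
  by rewrite pairing_dual_vector (negPf ji) expr0z.
have := perp_dual_vector coord_point_chart i.
by rewrite /= (negPf np) inE /= eqxx => /esym/negbFE/eqP.
Qed.

End CoordinatePoint.

End Points.

Arguments coord_point : simpl never.

(** * Line bundles as functions on the rays *)

Section LineBundles.
Variables (R : realType) (D : km_root_datum) (r : nat) (w : 'I_r -> 'I_(km_size D)).
Local Notation C := R[i].
Local Notation lray := (limit_ray w).
Local Notation rays := ('I_r * bool)%type.
Local Notation X := (toric_limit w).
Local Notation M := 'cV[int]_r.
Local Notation ev := (Defs.eval (@idfun C : {rmorphism C -> C})).
Implicit Types (s : {ffun 'I_r -> bool}) (A B : {set rays}) (m : M)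
  (psi : rays -> int) (L : cocycle R X).

Definition chart_eq psi A : M := local_eq w (cone_sign A) psi.

Lemma pairing_chart_eq psi A u : chart (X := X) A -> u \in A ->
  pairing (lray u) (chart_eq psi A) = psi u.
Proof.
move=> /chartE AE; rewrite {1}AE; case: u => i b; rewrite inE => /eqP /= <-.
exact: pairing_local_eq.
Qed.

Lemma chart_eq_perp psi A B : chart (X := X) A -> chart (X := X) B ->
  perp_cone (X := X) (A :&: B) (chart_eq psi B - chart_eq psi A).
Proof.
move=> cA cB; apply/perp_coneP => u; rewrite inE => /andP[uA uB].
by rewrite pairingBr !pairing_chart_eq // subrr.
Qed.

Lemma chart_eq_perp_point (K : fieldType) (x : kpoint X K) psi A B :
  chart (X := X) A -> chart (X := X) B -> in_chart (X := X) A x -> in_chart (X := X) B x ->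
  perp_cone (pt_cone x) (chart_eq psi B - chart_eq psi A).
Proof.
move=> cA cB xA xB; apply: perp_coneS (chart_eq_perp psi cA cB).
by rewrite finset.subsetI; apply/andP.
Qed.

Lemma chart_eq_unique psi A m : chart (X := X) A ->
  (forall u, u \in A -> pairing (lray u) m = psi u) -> chart_eq psi A = m.
Proof.
move=> cA h; apply: local_eq_unique => i; rewrite h // (chartE cA) inE /=.
by rewrite sign_coneK.
Qed.

(** The value at [c] of the one-parameter subgroup [lam]. *)
Definition torus_point (lam : 'rV[int]_r) (c : C) : kpoint X C :=
  coord_point w [ffun=> true] (fun i => c ^ lam 0 i).

Lemma torus_point_cone lam c : c != 0 -> pt_cone (torus_point lam c) = finset.set0.
Proof.
move=> c0; apply/setP => u; rewrite !inE.
by rewrite (negPf (expfz_neq0 _ c0)) andbF.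
Qed.

Lemma torus_point_chart lam c A : c != 0 -> in_chart (X := X) A (torus_point lam c).
Proof. by move=> c0; rewrite /in_chart torus_point_cone // finset.sub0set. Qed.

Lemma pairing_positive_ray i m : pairing (lray (i, true)) m = m i 0.
Proof.
rewrite /pairing mxE (bigD1 i) //= limit_ray_diag mul1r big1 ?addr0 // => j ji.
by rewrite /limit_ray /= mxE (negPf ji) mul0r.
Qed.

Lemma torus_point_val lam c m : c != 0 ->
  pt_val (torus_point lam c) m = c ^ pairing lam m.
Proof.
move=> c0; rewrite (pt_val_perp (coord_point_chart w _ _)); last first.
  by apply/perp_coneP => u; rewrite torus_point_cone // inE.
have -> : pairing lam m = \sum_i lam 0 i * m i 0 by rewrite /pairing mxE.
under eq_bigr => i _.
  rewrite coord_point_coord ffunE pairing_positive_ray exprz_exp; over.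
elim/big_rec2: _ => // i a b _ ->.
by rewrite expfzDr.
Qed.

Lemma eval_torus_point lam c p : c != 0 ->
  ev (torus_point lam c) p = one_param lam c p.
Proof. by move=> c0; apply: eq_bigr => t _; rewrite torus_point_val. Qed.

Lemma eval_monomial (K : fieldType) (iota : {rmorphism C -> K}) (x : kpoint X K)
    (p : laurent R r) m : (forall m', m' != m -> lcoef p m' = 0) ->
  Defs.eval iota x p = iota (lcoef p m) * pt_val x m.
Proof.
move=> pm; rewrite /Defs.eval.
rewrite (sum_lcoef iota _ (ms := undup (m :: [seq t.2 | t <- p]))) ?undup_uniq //.
  rewrite (bigD1_seq m) ?undup_uniq ?mem_undup ?mem_head //= big1 ?addr0 // => m' /pm->.
  by rewrite rmorph0 mul0r.
by move=> t tp; rewrite mem_undup inE map_f ?orbT.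
Qed.

(** Up to the constants [c], [L] is the bundle of the divisor - sum_u psi(u) D_u. All fields are
    allowed because curves enter through points over their function fields. *)
Definition represents L psi (c : {set rays} -> {set rays} -> C) : Prop :=
  forall A B, chart (X := X) A -> chart (X := X) B -> c A B != 0 /\
    forall (K : fieldType) (iota : {rmorphism C -> K}) (x : kpoint X K),
      in_chart (X := X) A x -> in_chart (X := X) B x ->
      Defs.eval iota x (L A B) = iota (c A B) * pt_val x (chart_eq psi B - chart_eq psi A).

Lemma character_eq (a b : C) m m' : a != 0 ->
  (forall lam c, c != 0 -> a * c ^ pairing lam m = b * c ^ pairing lam m') -> m = m'.
Proof.
move=> a0 ab; pose p : laurent R r := [:: (a, m); (- b, m')].
have p0 lam c : c != 0 -> one_param lam c p = 0.
  by move=> c0; rewrite /one_param !big_cons big_nil /= ab // mulNr addr0 subrr.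
have := lcoef_eq0 p0 m; rewrite /lcoef !big_cons big_nil /= eqxx.
by case: eqVneq => // _ /eqP; rewrite addr0 (negPf a0).
Qed.

(** On the torus [L A B] and [L B A] are inverse to each other, so each is a monomial. The cocycle
    rule makes the exponents additive, and regularity of both makes them orthogonal to the common
    rays. *)
Lemma line_bundle_represents L : is_line_bundle L -> exists psi c, represents L psi c.
Proof.
move=> [Lreg L1 LM].
have evL A B D' lam c : chart (X := X) A -> chart (X := X) B -> chart (X := X) D' ->
    c != 0 -> one_param lam c (L A D') = one_param lam c (L A B) * one_param lam c (L B D').
  move=> cA cB cD c0; rewrite -!eval_torus_point //.
  by apply: LM => //; exact: torus_point_chart.
have evL1 A lam c : chart (X := X) A -> c != 0 -> one_param lam c (L A A) = 1.
  by move=> cA c0; rewrite -eval_torus_point // L1 //; exact: torus_point_chart.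
have mono (AB : {set rays} * {set rays}) : exists m,
    chart (X := X) AB.1 -> chart (X := X) AB.2 -> lcoef (L AB.1 AB.2) m != 0 /\
      forall m', m' != m -> lcoef (L AB.1 AB.2) m' = 0.
  case: AB => A B /=; have [cA|] := boolP (chart (X := X) A); last by exists 0.
  have [cB|] := boolP (chart (X := X) B); last by exists 0.
  have [lam c c0|m m1 m2] := @laurent_unit_monomial _ _ (L A B) (L B A).
    by rewrite -evL // evL1.
  by exists m.
have [e0 e0P] := choice mono; pose e A B := e0 (A, B).
have eP A B : chart (X := X) A -> chart (X := X) B -> lcoef (L A B) (e A B) != 0 /\
    forall m', m' != e A B -> lcoef (L A B) m' = 0 by exact: (e0P (A, B)).
pose cf A B := lcoef (L A B) (e A B).
have evE (K : fieldType) (iota : {rmorphism C -> K}) (x : kpoint X K) A B :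
    chart (X := X) A -> chart (X := X) B ->
    Defs.eval iota x (L A B) = iota (cf A B) * pt_val x (e A B).
  by move=> cA cB; apply: eval_monomial; have [] := eP A B cA cB.
have opE A B lam c : chart (X := X) A -> chart (X := X) B -> c != 0 ->
    one_param lam c (L A B) = cf A B * c ^ pairing lam (e A B).
  by move=> cA cB c0; rewrite -eval_torus_point // evE // torus_point_val.
have cf0 A B : chart (X := X) A -> chart (X := X) B -> cf A B != 0.
  by move=> cA cB; have [] := eP A B cA cB.
have eD A B D' : chart (X := X) A -> chart (X := X) B -> chart (X := X) D' ->
    e A D' = e A B + e B D'.
  move=> cA cB cD; apply: (@character_eq (cf A D') (cf A B * cf B D')); first exact: cf0.
  move=> lam c c0; rewrite -opE // (evL A B D') // !opE // pairingDr expfzDr //.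
  by rewrite mulrACA.
have e1 A : chart (X := X) A -> e A A = 0.
  move=> cA; have := eD A A A cA cA cA; move/eqP.
  by rewrite -subr_eq0 opprD addrA subrr add0r oppr_eq0 => /eqP.
have eN A B : chart (X := X) A -> chart (X := X) B -> e B A = - e A B.
  by move=> cA cB; apply/eqP; rewrite -addr_eq0 -eD // e1.
have edual A B : chart (X := X) A -> chart (X := X) B -> dual_cone (X := X) (A :&: B) (e A B).
  move=> cA cB; have [h _] := eP A B cA cB.
  have /mapP[t tL ->] := lcoef_neq0_mem h.
  exact: (allP (Lreg A B cA cB)).
have eperp A B u : chart (X := X) A -> chart (X := X) B -> u \in A -> u \in B ->
    pairing (lray u) (e A B) = 0.
  move=> cA cB uA uB; apply/eqP; rewrite eq_le.
  have /dual_coneP h1 := edual A B cA cB; have /dual_coneP h2 := edual B A cB cA.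
  rewrite h1 ?inE ?uA // andbT -oppr_ge0 -pairingNr -eN // h2 ?inE ?uA ?uB //.
pose O : {set rays} := sign_cone [ffun=> true].
have cO : chart (X := X) O by exact: chart_sign_cone.
pose At (b : bool) : {set rays} := sign_cone [ffun=> b].
have cAt b : chart (X := X) (At b) by exact: chart_sign_cone.
(* Every chart containing [u] gives the same value; the one with all signs equal to [u.2] is such a
   chart. *)
pose psi u := pairing (lray u) (e O (At u.2)).
have ceE A : chart (X := X) A -> chart_eq psi A = e O A.
  move=> cA; apply: chart_eq_unique => // u uA.
  rewrite /psi (eD O A (At u.2)) // pairingDr (eperp A) ?addr0 //.
  by rewrite inE ffunE.
exists psi, cf => A B cA cB; split; first exact: cf0.
move=> K iota x xA xB; rewrite evE // !ceE //; congr (_ * pt_val x _).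
by rewrite (eD O A B) // addrC addKr.
Qed.

Definition psi_bundle psi : cocycle R X :=
  fun A B => [:: (1, chart_eq psi B - chart_eq psi A)].

Lemma psi_bundle_represents psi : represents (psi_bundle psi) psi (fun _ _ => 1).
Proof.
move=> A B cA cB; split; first exact: oner_neq0.
by move=> K iota x xA xB; rewrite /Defs.eval big_cons big_nil addr0.
Qed.

Lemma represents_line_bundle L psi c : represents L psi c ->
  (forall A B, chart (X := X) A -> chart (X := X) B -> regular_on (X := X) (A :&: B) (L A B)) ->
  (forall A, chart (X := X) A -> c A A = 1) ->
  (forall A B D', chart (X := X) A -> chart (X := X) B -> chart (X := X) D' ->
     c A D' = c A B * c B D') ->
  is_line_bundle L.
Proof.
move=> Lpsi reg c1 cM; split=> //.
- move=> A cA x xA; have [_ ->] := Lpsi A A cA cA; rewrite ?c1 //=.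
  by rewrite subrr pt_val0 mulr1.
move=> A B D' cA cB cD x xA xB xD.
have [_ ->] := Lpsi A D' cA cD; rewrite // (cM A B) //.
have [_ ->] := Lpsi A B cA cB; rewrite //; have [_ ->] := Lpsi B D' cB cD => //.
rewrite mulrACA -pt_valDp ?chart_eq_perp_point //; congr (_ * pt_val x _).
by rewrite [RHS]addrC addrA subrK.
Qed.

Lemma psi_bundle_line_bundle psi : is_line_bundle (psi_bundle psi).
Proof.
apply: (represents_line_bundle (psi_bundle_represents psi)) => //.
- move=> A B cA cB; rewrite /regular_on /= andbT.
  exact/perp_dual_cone/chart_eq_perp.
- by move=> A B D' _ _ _; rewrite mulr1.
Qed.

Section Frame.
Variable A : {set rays}.
Hypothesis cA : chart (X := X) A.

(** [frame] lists the rays in the order of [enum]; the list has length [r], so the default is never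
    reached. *)
Let ru (i : 'I_r) : rays := nth (i, true) (enum A) i.

Let sizeA : size (enum A) = r.
Proof. by move: cA => /andP[_ /eqP]; rewrite cardE. Qed.

Let ruA i : ru i \in A.
Proof. by rewrite -mem_enum mem_nth // sizeA. Qed.

Let ruE i : ru i = ((ru i).1, cone_sign A (ru i).1).
Proof.
have : ru i \in sign_cone (cone_sign A) by rewrite -(chartE cA).
rewrite inE; by case: (ru i) => a b /= /eqP->.
Qed.

Let ru_inj i k : (ru i).1 = (ru k).1 -> i = k.
Proof.
move=> ik; have : ru i = ru k by rewrite ruE ik -ruE.
rewrite /ru (set_nth_default (i, true) (k, true)) ?sizeA // => /eqP.
by rewrite nth_uniq ?enum_uniq ?sizeA // => /eqP /val_inj.
Qed.

Lemma frameE m i : (frame (X := X) A *m m) i 0 = pairing (lray (ru i)) m.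
Proof.
rewrite /pairing !mxE; apply: eq_bigr => j _; rewrite mxE.
by rewrite (nth_map (i, true)) ?sizeA.
Qed.

Lemma frame_unit : frame (X := X) A \in unitmx.
Proof.
pose G : 'M[int]_r := \matrix_(j, k) dual_vector w (cone_sign A) (ru k).1 j 0.
suff : frame (X := X) A *m G = 1%:M by case/mulmx1_unit.
apply/matrixP => i k; rewrite [RHS]mxE.
have -> : (frame (X := X) A *m G) i k =
    (frame (X := X) A *m dual_vector w (cone_sign A) (ru k).1) i 0.
  by rewrite !mxE; apply: eq_bigr => j _; rewrite !mxE.
rewrite frameE ruE pairing_dual_vector; congr ((_ : bool)%:R).
by apply/eqP/eqP => [/ru_inj//|->].
Qed.

Lemma frame_chart_eq a :
  invmx (frame (X := X) A) *m const_mx a = chart_eq (fun=> a) A.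
Proof.
apply: (canLR (mulKmx frame_unit)); apply/matrixP => i j.
by rewrite ord1 frameE (pairing_chart_eq _ cA) ?ruA // mxE.
Qed.

End Frame.

Definition frame_det A B : int :=
  \det (frame (X := X) A *m invmx (frame (X := X) B)).

Lemma frame_detM A B D' : chart (X := X) B ->
  frame_det A D' = frame_det A B * frame_det B D'.
Proof.
move=> cB; rewrite /frame_det -det_mulmx; congr (\det _).
by rewrite mulmxA mulmxKV // frame_unit.
Qed.

Lemma frame_det1 A : chart (X := X) A -> frame_det A A = 1.
Proof. by move=> cA; rewrite /frame_det mulmxV ?frame_unit // det1. Qed.

(** An invertible integer is a sign; the square of -K is taken to get rid of it. *)
Lemma frame_det_sqr A B : chart (X := X) A -> chart (X := X) B ->
  frame_det A B ^+ 2 = 1.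
Proof.
move=> cA cB; have : frame_det A B \is a GRing.unit.
  by apply/unitrP; exists (frame_det B A); rewrite -!frame_detM // !frame_det1.
rewrite qualifE /= => /orP[]/eqP->; ring.
Qed.

(** The canonical divisor is minus the sum of the invariant divisors, hence the function 1; the
    constants are the Jacobian signs. *)
Lemma canonical_represents :
  represents (canonical_bundle R (X := X)) (fun=> 1) (fun A B => (frame_det A B)%:~R).
Proof.
move=> A B cA cB; split.
  rewrite intr_eq0; apply/eqP => d0; have := frame_det1 cA.
  by rewrite (frame_detM A (B := B)) // d0 mul0r.
move=> K iota x xA xB; rewrite /Defs.eval big_cons big_nil addr0 /=.
by rewrite mulmxBl !frame_chart_eq.
Qed.

Lemma canonical_line_bundle : is_line_bundle (canonical_bundle R (X := X)).
Proof.
apply: (represents_line_bundle canonical_represents).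
- move=> A B cA cB; rewrite /regular_on /= andbT mulmxBl !frame_chart_eq //.
  exact/perp_dual_cone/chart_eq_perp.
- by move=> A cA; rewrite frame_det1.
- by move=> A B D' cA cB cD; rewrite -intrM -frame_detM.
Qed.

End LineBundles.

Arguments psi_bundle R {D r} w psi _ _.
Arguments psi_bundle_represents R {D r} w psi.
Arguments psi_bundle_line_bundle R {D r} w psi.
Arguments canonical_represents R {D r} w.
Arguments canonical_line_bundle R {D r} w.

(** * Intersection numbers *)

Section CurveDegree.
Variables (R : realType) (D : km_root_datum) (r : nat) (w : 'I_r -> 'I_(km_size D)).
Local Notation C := R[i].
Local Notation lray := (limit_ray w).
Local Notation rays := ('I_r * bool)%type.
Local Notation X := (toric_limit w).
Local Notation M := 'cV[int]_r.
Variables (K : fieldType) (iota : {rmorphism C -> K}) (x : kpoint X K).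
Implicit Types (s : {ffun 'I_r -> bool}) (A B : {set rays}) (m : M)
  (psi : rays -> int) (L : cocycle R X) (v : K -> int).

Lemma generic_chartP : chart (generic_chart x) /\ in_chart (generic_chart x) x.
Proof.
rewrite /generic_chart; case: pickP => [A /andP[]//|h] /=.
have [s xs] := chart_cover (pt_cone_in x).
by have := h (sign_cone s); rewrite (chart_sign_cone w s) /in_chart xs.
Qed.

Lemma generic_sign : in_chart (X := X) (sign_cone (cone_sign (generic_chart x))) x.
Proof. by have [c h] := generic_chartP; rewrite -(chartE c). Qed.

Let s0 := cone_sign (generic_chart x).
Let z i := pt_val x (dual_vector w s0 i).

Lemma place_prod v (I : finType) (F : I -> K) : place iota v ->
  (forall i, F i != 0) -> v (\prod_i F i) = \sum_i v (F i).
Proof.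
move=> pv F0; suff [] : \prod_i F i != 0 /\ v (\prod_i F i) = \sum_i v (F i) by [].
elim/big_rec2: _ => [|i a b _ [b0 <-]]; first by rewrite oner_eq0 (place1 pv).
by rewrite mulf_neq0 // (placeM pv).
Qed.

(** A vanishing coordinate has exponent 0 in [m] and contributes 0. *)
Lemma place_pt_val v m : place iota v -> perp_cone (pt_cone x) m ->
  v (pt_val x m) = \sum_i pairing (lray (i, s0 i)) m * v (z i).
Proof.
move=> pv pm; have := pm; rewrite -pt_val_neq0 (pt_val_perp generic_sign pm).
move/prodf_neq0 => h; rewrite place_prod // => [|i]; last exact: h.
apply: eq_bigr => i _; have [zi|zi] := eqVneq (z i) 0; last by rewrite (placeXz pv).
have := h i isT; rewrite -/(z i) zi.
have [->|a0] := eqVneq (pairing (lray (i, s0 i)) m) 0.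
  by rewrite expr0z (place1 pv) mul0r.
by rewrite exp0rz (negPf a0) eqxx.
Qed.

(** Valuative criterion of properness: the orders of characters at [v] are pairings with one lattice
    point, which is expanded in a maximal cone containing the orbit cone. Coefficients along the
    orbit cone may be negative, but the exponents concerned are orthogonal to it. *)
Lemma center_exists v : place iota v -> exists A, centered v x A.
Proof.
move=> pv; have xc := pt_cone_in x.
have sigmaP : forall i, ~~ (((i, true) \in pt_cone x) && ((i, false) \in pt_cone x)).
  by apply/forallP; rewrite -(in_cones w).
have [s [c [sub vE c0 _]]] :=
  fan_complete w (\sum_i v (z i) *: lray (i, s0 i)) sigmaP.
exists (sign_cone s); split; [exact: chart_sign_cone | exact: sub |].
move=> m /dual_coneP dm; rewrite pt_val_neq0 => pm; rewrite place_pt_val //.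
have -> : \sum_i pairing (lray (i, s0 i)) m * v (z i) =
    pairing (\sum_i v (z i) *: lray (i, s0 i)) m.
  by rewrite pairing_suml; apply: eq_bigr => i _; rewrite pairingZl mulrC.
rewrite vE pairing_suml; apply: sumr_ge0 => i _; rewrite pairingZl.
have [ix|ix] := boolP ((i, s i) \in pt_cone x).
  by have /perp_coneP -> := pm; rewrite ?mulr0.
by rewrite mulr_ge0 ?c0 // dm // inE.
Qed.

Lemma center_chartP v : place iota v -> centered v x (center_chart v x).
Proof.
move=> /center_exists[A vA]; rewrite /center_chart.
by case: pickP => [B /asboolP//|/(_ A)]; rewrite asboolT.
Qed.

(* Order at v of the section of psi that is 1 over the generic chart. *)
Definition local_degree v psi : int :=
  v (pt_val x (chart_eq w psi (generic_chart x) - chart_eq w psi (center_chart v x))).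

Lemma local_degree_perp v psi : place iota v -> perp_cone (pt_cone x)
  (chart_eq w psi (generic_chart x) - chart_eq w psi (center_chart v x)).
Proof.
move=> pv; have [gc gx] := generic_chartP; have [cc cx _] := center_chartP pv.
exact: chart_eq_perp_point.
Qed.

Lemma degree_represents L psi c : represents L psi c ->
  degree iota L x = \sum_(v \in [set v | place iota v]) local_degree v psi.
Proof.
move=> Lpsi; rewrite /degree; apply: eq_fsbigr => v /set_mem /= pv.
have [gc gx] := generic_chartP; have [cc cx _] := center_chartP pv.
have [c0 ->] // := Lpsi _ _ cc gc.
rewrite (placeM pv) ?fmorph_eq0 //; last by rewrite pt_val_neq0 local_degree_perp.
by rewrite (place_const pv) add0r.
Qed.

Lemma local_degreeD v psi psi' : place iota v ->
  local_degree v (fun u => psi u + psi' u) = local_degree v psi + local_degree v psi'.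
Proof.
move=> pv; have h := local_degree_perp psi pv; have h' := local_degree_perp psi' pv.
rewrite {1}/local_degree /chart_eq !local_eqD opprD addrACA (pt_valDp h h').
by rewrite (placeM pv) // pt_val_neq0.
Qed.

Lemma local_degreeZ v a psi : place iota v ->
  local_degree v (fun u => a * psi u) = a * local_degree v psi.
Proof.
move=> pv; rewrite /local_degree /chart_eq !local_eqZ -scalerBr pt_valZ.
  by rewrite (placeXz pv) // pt_val_neq0; apply: local_degree_perp.
exact: local_degree_perp.
Qed.

Lemma local_degree_linear v m : place iota v ->
  local_degree v (fun u => pairing (lray u) m) = 0.
Proof.
move=> pv; rewrite /local_degree /chart_eq.
have E s : local_eq w s (fun u => pairing (lray u) m) = m by exact: local_eq_unique.
by rewrite !E subrr pt_val0 (place1 pv).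
Qed.

Lemma local_degree0 v : place iota v -> local_degree v (fun=> 0) = 0.
Proof.
move=> pv; rewrite -[RHS](local_degree_linear 0 pv); congr (local_degree v _).
by apply/funext => u; rewrite pairing0r.
Qed.

Lemma local_degree_sum v (I : finType) (F : I -> rays -> int) : place iota v ->
  local_degree v (fun u => \sum_k F k u) = \sum_k local_degree v (F k).
Proof.
move=> pv; suff h (l : seq I) : local_degree v (fun u => \sum_(k <- l) F k u) =
    \sum_(k <- l) local_degree v (F k).
  by have := h (index_enum I).
elim: l => [|k l IH].
  rewrite big_nil -[RHS](local_degree0 pv); congr (local_degree v _).
  by apply/funext => u; rewrite big_nil.
rewrite big_cons -IH -local_degreeD //; congr (local_degree v _).
by apply/funext => u; rewrite big_cons.
Qed.

(** The local equation of the generic chart is a global section, hence regular on the chart of the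
    centre. *)
Lemma local_degree_nef v psi : place iota v -> nef w psi -> 0 <= local_degree v psi.
Proof.
move=> pv npsi; have [cc cx h] := center_chartP pv; apply: h.
  apply/dual_coneP => u uA; rewrite pairingBr subr_ge0 (pairing_chart_eq _ cc uA).
  exact: npsi.
by rewrite pt_val_neq0; apply: local_degree_perp.
Qed.

Section FiniteSupport.
Hypothesis gx : generic_point_of_curve iota x.

Lemma finite_place_support f : f != 0 ->
  finite_set [set v | place iota v /\ v f != 0].
Proof.
move=> f0; case: gx => td quot.
(* K is generated by values of monomials, whose exponents may be negative; hence the inverses. *)
pose ys := [seq z i | i <- enum 'I_r] ++ [seq (z i)^-1 | i <- enum 'I_r].
have fin g : finite_set [set v | place iota v /\ 0 < v g].
  apply: (finite_zeros (ys := ys) g td) => T TC TD TM Ty h.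
  have TX a n : T a -> T (a ^+ n).
    by move=> Ta; elim: n => [|n IH]; [rewrite expr0 -(rmorph1 iota) | rewrite exprS; apply: TM].
  have Tpt m : T (pt_val x m).
    have [pm|] := boolP (perp_cone (pt_cone x) m); last first.
      by rewrite -pt_val_neq0 negbK => /eqP->; rewrite -(rmorph0 iota).
    rewrite (pt_val_perp generic_sign pm); elim/big_rec: _ => [|i a _ Ta].
      by rewrite -(rmorph1 iota).
    apply: TM => //; case: (pairing _ _) => n.
      rewrite -exprnP; apply/TX/Ty; rewrite mem_cat; apply/orP; left.
      by apply/mapP; exists i; rewrite ?mem_enum.
    rewrite NegzE -exprnN -exprVn; apply/TX/Ty.
    rewrite mem_cat; apply/orP; right.
    by apply/mapP; exists i; rewrite ?mem_enum.
  have Tev p : T (Defs.eval iota x p).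
    rewrite /Defs.eval; elim/big_rec: _ => [|t a _ Ta]; first by rewrite -(rmorph0 iota).
    by apply: TD => //; apply: TM.
  by have [p [q [_ _ q0 ->]]] := quot h; exists (Defs.eval iota x p), (Defs.eval iota x q).
apply: sub_finite_set (_ : _ `<=` [set v | place iota v /\ 0 < v f] `|`
  [set v | place iota v /\ 0 < v f^-1]) _; last by rewrite finite_setU.
move=> v /= [pv]; rewrite neq_lt (placeV pv) oppr_gt0.
by case/orP => h; [right|left].
Qed.

(** Orders of characters depend only on those of the nonzero coordinates, so the zeros and poles of
    the latter form one list that serves every [psi]. *)
Lemma place_support : exists2 l : seq (K -> int), uniq l &
  [/\ forall v, v \in l -> place iota v &
      forall v psi, place iota v -> v \notin l -> local_degree v psi = 0].
Proof.
pose S := \bigcup_(i in [set: 'I_r]) [set v | [/\ place iota v, z i != 0 & v (z i) != 0]].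
have finS : finite_set S.
  apply: bigcup_finite => // i _; have [zi|zi] := eqVneq (z i) 0.
    by apply: (sub_finite_set (B := set0)) => // v [].
  by apply: sub_finite_set (finite_place_support zi) => v /= [].
have [l lu lS] : exists2 l : seq (K -> int), uniq l & S = [set` l].
  have /finite_fsetP[X' ->] := finS.
  exists (finmap.enum_fset X'); first exact: finmap.fset_uniq.
  by apply/seteqP; split.
exists l => //; split=> [v vl|v psi pv vl].
  by have [i _ []] : S v by rewrite lS.
rewrite /local_degree place_pt_val //; last exact: local_degree_perp.
apply: big1 => i _; have [->|zi] := eqVneq (z i) 0; first by rewrite (place0 pv) mulr0.
have [->|vz] := eqVneq (v (z i)) 0; first by rewrite mulr0.
have Sv : S v by exists i.
by move: Sv; rewrite lS /= => vl'; rewrite vl' in vl.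
Qed.

(** On one finite list of places the sum commutes with the decomposition of [psi], whose linear part
    has order 0 at each place. *)
Lemma degree_decomposition L psi c : represents L psi c ->
  degree iota L x = \sum_k prim_degree w k psi *
    degree iota (psi_bundle R w (dual_psi w k)) x.
Proof.
move=> Lpsi; rewrite (degree_represents Lpsi).
have [l lu [lp l0]] := place_support.
have E psi' : \sum_(v \in [set v | place iota v]) local_degree v psi' =
    \sum_(v <- l) local_degree v psi'.
  have h1 : [set` l] `<=` [set v | place iota v] by move=> v /= /lp.
  rewrite (fsbigE _ _ lu h1) => [|v /= pv vl]; last exact: l0.
  rewrite [RHS]big_seq [LHS]big_seq_cond; apply: eq_bigl => v.
  by case vl: (v \in l) => //=; rewrite mem_set //; apply: lp.
rewrite E; transitivity (\sum_k \sum_(v <- l)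
    prim_degree w k psi * local_degree v (dual_psi w k)); last first.
  apply: eq_bigr => k _.
  by rewrite (degree_represents (psi_bundle_represents R w _)) E mulr_sumr.
rewrite exchange_big /=; apply: eq_big_seq => v /lp pv.
have [m mE] := dual_psi_decomposition w psi.
transitivity (local_degree v (fun u =>
    \sum_k prim_degree w k psi * dual_psi w k u + pairing (lray u) m)).
  by congr (local_degree v _); apply/funext.
rewrite local_degreeD // local_degree_linear // addr0 local_degree_sum //.
by apply: eq_bigr => k _; rewrite local_degreeZ.
Qed.

End FiniteSupport.

Lemma degree_dual_psi_ge0 k : 0 <= degree iota (psi_bundle R w (dual_psi w k)) x.
Proof.
rewrite (degree_represents (psi_bundle_represents R w (dual_psi w k))).
apply: fsumr_ge0 => v /= pv; apply: local_degree_nef => //.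
by have [] := dual_psiP w k.
Qed.

End CurveDegree.

(** * The invariant curves of primitive relations *)

Section WallCurve.
Variables (R : realType) (D : km_root_datum) (r : nat) (w : 'I_r -> 'I_(km_size D)).
Local Notation C := R[i].
Local Notation lray := (limit_ray w).
Local Notation rays := ('I_r * bool)%type.
Local Notation X := (toric_limit w).
Local Notation M := 'cV[int]_r.
Variable i : 'I_r.
Implicit Types (A B : {set rays}) (m : M) (psi : rays -> int) (L : cocycle R X).

(* The two maximal cones adjacent along a wall containing the cone of the
   primitive relation of {e_i^+, e_i^-}. *)
Definition wall_sign (b : bool) : {ffun 'I_r -> bool} :=
  [ffun j => if j == i then b else prim_sign w i j].

Lemma ray_positive m : pairing (lray (i, true)) m =
  \sum_j prim_coef w i j * pairing (lray (j, prim_sign w i j)) m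
    - pairing (lray (i, false)) m.
Proof.
apply/eqP; rewrite eq_sym subr_eq -pairingDl prim_relation pairing_suml.
by apply/eqP/eq_bigr => j _; rewrite pairingZl.
Qed.

(** The local equation of the other cone takes the value [psi (i, true)] here, so the jump across
    the wall is the degree. *)
Lemma prim_degree_wall psi :
  pairing (lray (i, true)) (local_eq w (wall_sign false) psi) =
  prim_degree w i psi + psi (i, true).
Proof.
have E j b : pairing (lray (j, wall_sign b j)) (local_eq w (wall_sign b) psi) =
    psi (j, wall_sign b j) by exact: pairing_local_eq.
rewrite ray_positive /prim_degree; have := E i false; rewrite ffunE eqxx => ->.
rewrite (eq_bigr (fun j => prim_coef w i j * psi (j, prim_sign w i j))); first by ring.
move=> j _; have [->|ji] := eqVneq j i; first by rewrite prim_coef_eq0 // !mul0r.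
by have := E j false; rewrite ffunE (negPf ji) => ->.
Qed.

Section Point.
Variables (K : fieldType) (t : K).

(** The curve is a projective line with coordinate [t]: [ratX] gives its generic point, constants
    give closed points. *)
Definition wall_point : kpoint X K :=
  coord_point w (wall_sign true) (fun j => if j == i then t else 0).

#[local] Arguments wall_point : simpl never.

Lemma wall_point_chart : in_chart (X := X) (sign_cone (wall_sign true)) wall_point.
Proof. exact: coord_point_chart. Qed.

Lemma wall_point_coord j :
  pt_val wall_point (dual_vector w (wall_sign true) j) = if j == i then t else 0.
Proof. exact: coord_point_coord. Qed.

Hypothesis t0 : t != 0.

Lemma in_wall_point u : (u \in pt_cone wall_point) =
  (u.1 != i) && (prim_sign w i u.1 == u.2).
Proof.
rewrite inE ffunE; case: (eqVneq u.1 i) => [_|_]; first by rewrite (negPf t0) andbF.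
by rewrite eqxx andbT.
Qed.

Lemma wall_point_charts b : in_chart (X := X) (sign_cone (wall_sign b)) wall_point.
Proof.
apply/fintype.subsetP => u; rewrite in_wall_point !inE ffunE.
by case/andP => /negPf->.
Qed.

Lemma wall_point_chartE A : chart (X := X) A -> in_chart (X := X) A wall_point ->
  exists b, A = sign_cone (wall_sign b).
Proof.
move=> cA xA; exists (cone_sign A i); rewrite {1}(chartE cA).
congr sign_cone; apply/ffunP => j; rewrite [RHS]ffunE.
case: eqVneq => [->//|ji].
have : (j, prim_sign w i j) \in A.
  by apply: (fintype.subsetP xA); rewrite in_wall_point /= ji eqxx.
rewrite {1}(chartE cA) inE => /eqP //.
Qed.

Lemma wall_point_val m : perp_cone (pt_cone wall_point) m ->
  pt_val wall_point m = t ^ pairing (lray (i, true)) m.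
Proof.
move=> pm; rewrite (pt_val_perp wall_point_chart pm).
under eq_bigr do rewrite wall_point_coord.
rewrite (bigD1 i) //= eqxx ffunE eqxx big1 ?mulr1 // => j ji.
rewrite (perp_coneP _ _ _ pm) ?expr0z //.
by rewrite in_wall_point /= ffunE (negPf ji) eqxx.
Qed.

Lemma wall_perp b : perp_cone (pt_cone wall_point) (dual_vector w (wall_sign b) i).
Proof.
by rewrite (perp_dual_vector (wall_point_charts b)) in_wall_point /= eqxx.
Qed.

Lemma pairing_wall_dual b :
  pairing (lray (i, true)) (dual_vector w (wall_sign b) i) = if b then 1 else -1.
Proof.
have E j : pairing (lray (j, wall_sign b j)) (dual_vector w (wall_sign b) i) = (j == i)%:R.
  exact: pairing_dual_vector.
have := E i; rewrite ffunE !eqxx; case: b E => E Ei //.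
rewrite ray_positive Ei big1 ?sub0r // => j _.
have [->|ji] := eqVneq j i; first by rewrite prim_coef_eq0 ?mul0r.
by have := E j; rewrite ffunE (negPf ji) => ->; rewrite mulr0.
Qed.

End Point.

#[local] Arguments wall_point : simpl never.

Local Notation Ct := {fraction {poly C}}.
Let x : kpoint X Ct := wall_point ratX.

Lemma eval_wall_poly (p : {poly C}) : exists q : laurent R r,
  regular_on (X := X) (pt_cone x) q /\ Defs.eval (@ratC C) x q = tofrac p.
Proof.
have X0 := @ratX_neq0 C.
pose m := dual_vector w (wall_sign true) i.
have pm : perp_cone (pt_cone x) m by exact: wall_perp.
exists [seq (p`_k, m *+ k) | k <- iota 0 (size p)]; split.
  rewrite /regular_on all_map; apply/allP => k _ /=.
  by rewrite -scaler_nat perp_dual_cone // perp_coneZ.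
rewrite /Defs.eval big_map -(horner_ratX p).
rewrite (horner_coef_wide (n := size p)) ?size_map_poly //.
have -> : iota 0 (size p) = index_iota 0 (size p) by rewrite /index_iota subn0.
rewrite big_mkord; apply: eq_bigr => k _.
rewrite coef_map pt_valMn ?perp_dual_cone //; congr (_ * _ ^+ _).
by rewrite wall_point_coord eqxx.
Qed.

Lemma wall_generic_point : generic_point_of_curve (@ratC C) x.
Proof.
split; first exact: trdeg_one_ratC.
move=> f; have [n [d d0 ->]] := fraction_numdenP f.
have [p [pr pE]] := eval_wall_poly n; have [q [qr qE]] := eval_wall_poly d.
exists p, q; split; rewrite ?pE ?qE //.
rewrite tofrac_eq0; exact: d0.
Qed.

(** The coordinate along the curve, t in one chart and 1/t in the other, must be regular at [v]. *)
Lemma wall_center v A : place (@ratC C) v -> centered v x A ->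
  (0 < v ratX -> A = sign_cone (wall_sign true)) /\
  (v ratX < 0 -> A = sign_cone (wall_sign false)).
Proof.
have X0 := @ratX_neq0 C; move=> pv [cA xA dA].
have [b AE] := wall_point_chartE X0 cA xA.
have pb := wall_perp X0 b.
have := dA (dual_vector w (wall_sign b) i).
rewrite pt_val_neq0 pb AE => /(_ (dual_cone_dual_vector _ _ _) isT).
rewrite wall_point_val // (placeXz pv) // pairing_wall_dual.
by case: (b); rewrite ?mul1r ?mulN1r ?oppr_ge0 => h; split=> // /lt_geF; rewrite h.
Qed.

Lemma chart_eq_wall b psi :
  chart_eq w psi (sign_cone (wall_sign b)) = local_eq w (wall_sign b) psi.
Proof. by rewrite /chart_eq sign_coneK. Qed.

Lemma wall_local_degree v psi : place (@ratC C) v ->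
  local_degree x v psi =
  pairing (lray (i, true)) (chart_eq w psi (generic_chart x)) * v ratX -
  pairing (lray (i, true)) (chart_eq w psi (center_chart v x)) * v ratX.
Proof.
move=> pv; have X0 := @ratX_neq0 C.
have pm : perp_cone (pt_cone x) _ := local_degree_perp x psi pv.
rewrite /local_degree (wall_point_val X0 pm) (placeXz pv _ X0).
by rewrite pairingBr mulrBl.
Qed.

(** Away from the origin and infinity t has order 0, and with it every character. *)
Lemma wall_degree L psi c : represents L psi c ->
  degree (@ratC C) L x = prim_degree w i psi.
Proof.
move=> Lpsi; rewrite (degree_represents _ _ Lpsi).
have X0 := @ratX_neq0 C.
have p0 := place_ordX R; have pinf := place_ord_inf R.
have neq : @ordX C != @ord_inf R.
  apply/eqP => /(congr1 (fun f => f ratX)).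
  by rewrite ordX_ratX ord_inf_ratX.
pose l : seq (Ct -> int) := [:: @ordX C; @ord_inf R].
have lu : uniq l by rewrite /= inE neq.
have lp v : v \in l -> place (@ratC C) v.
  by rewrite !inE => /orP[]/eqP->.
have lsub : [set` l] `<=` [set v | place (@ratC C) v] by move=> v /= /lp.
rewrite (fsbigE _ _ lu lsub) => [|v pv vl].
  rewrite big_mkcond big_cons big_cons big_nil !mem_set //= addr0.
  (* As t has orders 1 and -1, the generic chart cancels and the jump across the wall remains. *)
  rewrite !wall_local_degree // ordX_ratX ord_inf_ratX !mulr1 !mulrN1.
  have [c0 _] := wall_center p0 (center_chartP x p0).
  have [_ cinf] := wall_center pinf (center_chartP x pinf).
  rewrite c0 ?ordX_ratX // cinf ?ord_inf_ratX // !chart_eq_wall prim_degree_wall.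
  have := pairing_local_eq w (wall_sign true) psi i; rewrite ffunE eqxx => ->.
  ring.
rewrite wall_local_degree // (_ : v ratX = 0) ?mulr0 ?subrr //.
move: vl; rewrite !inE negb_or => /andP[v0 vinf].
have [vX|vX|//] := ltgtP (v ratX) 0.
  by rewrite (place_ratX_lt0 pv vX) eqxx in vinf.
by rewrite (place_ratX_gt0 pv vX) eqxx in v0.
Qed.

Definition prim_class : num_class R X := fun L =>
  if `[< is_line_bundle L >] then (degree (@ratC C) L x)%:~R else 0.

Lemma prim_class_curve : curve_class prim_class.
Proof.
exists Ct, (@ratC C), x; first exact: wall_generic_point.
by [].
Qed.

Lemma prim_class_represents L psi c : is_line_bundle L -> represents L psi c ->
  prim_class L = (prim_degree w i psi)%:~R.
Proof.
by move=> LL Lpsi; rewrite /prim_class asboolT // (wall_degree Lpsi).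
Qed.

End WallCurve.

Arguments wall_point : simpl never.
Arguments prim_class R {D r} w i _.
Arguments prim_class_represents R {D r} w i.
Arguments prim_class_curve R {D r} w i.

(** * Negativity of K on the invariant curves of a Fano variety *)

Section AmpleNecessary.
Variables (R : realType) (D : km_root_datum) (r : nat) (w : 'I_r -> 'I_(km_size D)).
Local Notation C := R[i].
Local Notation lray := (limit_ray w).
Local Notation rays := ('I_r * bool)%type.
Local Notation X := (toric_limit w).
Local Notation M := 'cV[int]_r.
Implicit Types (A B : {set rays}) (m : M) (psi : rays -> int) (L : cocycle R X).

Lemma eval_lmul (K : fieldType) (iota : {rmorphism C -> K}) (x : kpoint X K)
    (p q : laurent R r) : regular_on (pt_cone x) p -> regular_on (pt_cone x) q ->
  regular_on (pt_cone x) (lmul p q) /\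
  Defs.eval iota x (lmul p q) = Defs.eval iota x p * Defs.eval iota x q.
Proof.
move=> /allP pr /allP qr; split.
  apply/allP => _ /allpairsP[[s t] /= [sp tq ->]] /=.
  by apply: dual_coneD; [apply: pr|apply: qr].
rewrite /Defs.eval big_allpairs_dep mulr_suml; apply: eq_big_seq => s sp.
rewrite mulr_sumr; apply: eq_big_seq => t tq.
by rewrite /= rmorphM (pt_valD (pr s sp) (qr t tq)) mulrACA.
Qed.

Lemma eval_lexp (K : fieldType) (iota : {rmorphism C -> K}) (x : kpoint X K)
    (p : laurent R r) n : regular_on (pt_cone x) p ->
  regular_on (pt_cone x) (lexp p n) /\
  Defs.eval iota x (lexp p n) = Defs.eval iota x p ^+ n.
Proof.
move=> pr; elim: n => [|n [IHr IH]].
  split; first by rewrite /regular_on /= andbT perp_dual_cone ?perp_cone0.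
  by rewrite /Defs.eval big_cons big_nil /= pt_val0 rmorph1 mulr1 addr0.
have [h ->] := eval_lmul iota pr IHr.
by split; [exact: h | rewrite IH exprS].
Qed.

Lemma eval_dual_exp_canonical n A B (K : fieldType) (iota : {rmorphism C -> K})
    (x : kpoint X K) : chart (X := X) A -> chart (X := X) B ->
  in_chart (X := X) A x -> in_chart (X := X) B x ->
  Defs.eval iota x (lb_exp (lb_dual (canonical_bundle R (X := X))) n A B) =
  iota ((frame_det w B A)%:~R ^+ n) *
    pt_val x (chart_eq w (fun=> 1) A - chart_eq w (fun=> 1) B) ^+ n.
Proof.
move=> cA cB xA xB; have [reg _ _] := canonical_line_bundle R w.
have [|_ ->] := @eval_lexp _ iota x (canonical_bundle R (X := X) B A) n.
  apply/allP => t tK; have /allP/(_ t tK) := reg B A cB cA.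
  by apply: dual_coneS; rewrite finset.subsetI; apply/andP.
have [_ ->] := canonical_represents R w B A cB cA; rewrite //.
by rewrite exprMn rmorphXn.
Qed.

Variable i : 'I_r.

(** Restriction to the i-th coordinate axis, where only monomials free of the other coordinates
    survive. *)
Definition axis_poly (s : {ffun 'I_r -> bool}) (p : laurent R r) : {poly C} :=
  \sum_(t <- p | [forall j, (j != i) ==> (pairing (lray (j, s j)) t.2 == 0)])
    t.1 *: 'X^`|pairing (lray (i, s i)) t.2|.

Lemma eval_axis s (x : kpoint X C) (c : C) (p : laurent R r) :
  in_chart (X := X) (sign_cone s) x -> regular_on (X := X) (sign_cone s) p ->
  (forall j, pt_val x (dual_vector w s j) = if j == i then c else 0) ->
  Defs.eval (@idfun C : {rmorphism C -> C}) x p = (axis_poly s p).[c].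
Proof.
move=> xs /allP pr xc; rewrite /Defs.eval /axis_poly horner_sum [RHS]big_mkcond.
apply: eq_big_seq => t tp; rewrite (pt_val_dual xs) ?pr // (bigD1 i) //=.
rewrite xc eqxx; case: ifPn => [/forall_inP h|].
  rewrite hornerZ hornerXn big1 ?mulr1 // => j ji.
  by rewrite (eqP (h j ji)) absz0 expr0.
rewrite negb_forall_in => /exists_inP[j ji tj].
rewrite (bigD1 j) //= xc (negPf ji) expr0n absz_eq0 (negPf tj) mul0r.
by rewrite !mulr0.
Qed.

Lemma reverse_horner (F : fieldType) (q : {poly F}) : exists2 q' : {poly F},
  (size q' <= (size q).+1)%N & forall c, c != 0 -> q'.[c] = c ^+ size q * q.[c^-1].
Proof.
pose N := size q; exists (\poly_(l < N.+1) q`_(N - l)); first exact: size_poly.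
move=> c c0; rewrite (horner_coef_wide (n := N.+1)) ?size_poly //.
rewrite (horner_coef_wide (p := q) (n := N.+1)) // mulr_sumr.
rewrite [RHS](reindex_inj rev_ord_inj) /=; apply: eq_bigr => l _.
rewrite coef_poly ltn_ord subSS mulrCA; congr (_ * _).
have lN : (l <= N)%N by rewrite -ltnS.
have -> : c ^+ size q = c ^+ l * c ^+ (N - l) by rewrite -exprD subnKC.
by rewrite exprVn mulfK // expf_neq0.
Qed.

(* If -nK had degree <= 0 on the wall curve, all its sections would be constant
   there, and the embedding would identify two of its points. *)
Lemma ample_prim_degree : fano R X -> prim_degree w i (fun=> 1) < 0.
Proof.
case=> n n0 [N [s sec [_ inj _ _]]]; rewrite ltNge; apply/negP => a0.
pose x (c : C) := wall_point w i c.
pose sT := wall_sign w i true; pose sF := wall_sign w i false.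
pose T : {set rays} := sign_cone sT; pose F : {set rays} := sign_cone sF.
have cT : chart (X := X) T by exact: chart_sign_cone.
have cF : chart (X := X) F by exact: chart_sign_cone.
have xT c : in_chart (X := X) T (x c) by exact: wall_point_chart.
suff E k : hcoord s T (x 0) k = hcoord s T (x 1) k.
  have /(congr1 (fun y => pt_val y (dual_vector w sT i))) : x 0 = x 1.
    apply: (inj (x 0) (x 1) (hcoord s T (x 0))).
      by exists T, 1; [split; rewrite ?oner_neq0 | move=> k; rewrite mul1r].
    exists T, 1; first by split; rewrite ?oner_neq0.
    by move=> k; rewrite mul1r E.
  by rewrite !wall_point_coord eqxx => /eqP; rewrite eq_sym oner_eq0.
have [reg glue] := sec k.
pose P := axis_poly sT (s k T); pose Q := axis_poly sF (s k F).
have PE c : hcoord s T (x c) k = P.[c].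
  by apply: eval_axis => //; [exact: reg | exact: wall_point_coord].
have xF c : c != 0 -> in_chart (X := X) F (x c).
  by move=> c0; exact: (wall_point_charts w i c0).
have QE c : c != 0 -> Defs.eval (@idfun C : {rmorphism C -> C}) (x c) (s k F) = Q.[c^-1].
  move=> c0; apply: eval_axis; [exact: xF | exact: reg | move=> j].
  have [->|ji] := eqVneq j i.
    by rewrite wall_point_val ?wall_perp // pairing_wall_dual exprN1.
  apply/eqP; have := in_pt_cone (xF c c0) (j, sF j).
  by rewrite in_wall_point // /= ji ffunE (negPf ji) !eqxx /= => <-.
have [m aE] : exists m : nat, prim_degree w i (fun=> 1) = m%:Z.
  by exists `|prim_degree w i (fun=> 1)|%N; rewrite gez0_abs.
pose kap := (@idfun C : {rmorphism C -> C}) ((frame_det w F T)%:~R ^+ n).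
(* Gluing of a polynomial in t with one in 1/t; [m] is the degree of K on the curve. *)
have PQ c : c != 0 -> c ^+ (m * n) * P.[c] = kap * Q.[c^-1].
  move=> c0; rewrite -PE -QE // /hcoord (glue T F) ?xF //.
  rewrite eval_dual_exp_canonical ?xF // -/kap.
  rewrite (wall_point_val c0 (chart_eq_perp_point (fun=> 1) cF cT (xF c c0) (xT c))).
  rewrite pairingBr !chart_eq_wall prim_degree_wall aE.
  have -> : pairing (lray (i, true)) (local_eq w (wall_sign w i true) (fun=> 1)) = 1.
    by have := pairing_local_eq w (wall_sign w i true) (fun=> 1) i; rewrite ffunE eqxx.
  rewrite opprD addrCA subrr addr0 -exprnN exprVn -exprM.
  by rewrite -(mulrA kap) mulrCA mulVKf // expf_neq0.
have [Q' sQ' Q'E] := reverse_horner Q.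
(* With t^(size Q) both sides are polynomials; comparing their degrees leaves [P] constant. *)
have PQ' : P * 'X^(size Q + m * n) = kap *: Q'.
  apply/eqP; rewrite -subr_eq0; apply/negPn/negP => /poly_nonroot[l].
  have c0 : l.+1%:R != 0 :> C by rewrite pnatr_eq0.
  apply/negP; rewrite negbK; apply/eqP.
  rewrite hornerD hornerN hornerM hornerXn hornerZ Q'E // mulrCA -PQ //.
  by rewrite mulrA -exprD mulrC subrr.
have sP : (size P <= 1)%N.
  have [->|P0] := eqVneq P 0; first by rewrite size_poly0.
  have : (size (P * 'X^(size Q + m * n))%R <= (size Q).+1)%N.
    by rewrite PQ'; apply: leq_trans (size_scale_leq _ _) sQ'.
  by rewrite size_mulXn //; lia.
by rewrite !PE (size1_polyC sP) !hornerC.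
Qed.

End AmpleNecessary.

(** * Very ampleness *)

Section HomogeneousPolynomials.
Import (canonicals, coercions) mpoly.
Variables (C : comNzRingType) (n : nat).
Local Notation P := (mpoly.mpoly n.+1 C).
Local Notation var k := (mpoly.mpolyX C (mpoly.mnm1 k) : P).
Local Notation homog d f := (all (fun m => mpoly.mdeg m == d) (mpoly.msupp (f : P))).

Lemma homogE d f : homog d f = (f \is @mpoly.ishomog1 n.+1 C d (@mpoly.mdeg n.+1)).
Proof. by rewrite mpoly.dhomogE. Qed.

Lemma homog_var k : homog 1 (var k).
Proof. by rewrite homogE mpoly.dhomogX; apply/eqP; apply: mpoly.mdeg1. Qed.

Lemma homogM d e f g : homog d f -> homog e g -> homog (d + e)%N (f * g).
Proof. by rewrite !homogE; exact: mpoly.dhomogM. Qed.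

Lemma homogXn d k f : homog d f -> homog (d * k)%N (f ^+ k).
Proof. by rewrite !homogE; exact: mpoly.dhomogMn. Qed.

Lemma homog_varX k m : homog m (var k ^+ m).
Proof.
by have := homogXn m (homog_var k); rewrite !homogE mul1n.
Qed.

Lemma homogZ d c f : homog d f -> homog d (c *: f).
Proof. by rewrite !homogE; exact: mpoly.dhomogZ. Qed.

Lemma homogB d f g : homog d f -> homog d g -> homog d (f - g).
Proof. by rewrite !homogE => hf hg; rewrite rpredB. Qed.

Lemma homog_sum (I : eqType) (l : seq I) d (F : I -> P) :
  (forall i, i \in l -> homog d (F i)) -> homog d (\sum_(i <- l) F i).
Proof.
by move=> h; rewrite homogE big_seq rpred_sum // => i /h; rewrite homogE.
Qed.

Lemma homog_prod (I : finType) (d : I -> nat) (F : I -> P) :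
  (forall i, homog (d i) (F i)) -> homog (\sum_i d i)%N (\prod_i F i).
Proof.
move=> h; elim/big_rec2: _ => [|i e f _ hf]; last exact: homogM.
by rewrite homogE; exact: mpoly.dhomog1.
Qed.

Lemma meval_sum (v : 'I_n.+1 -> C) (I : Type) (l : seq I) (F : I -> P) :
  mpoly.meval v (\sum_(i <- l) F i) = \sum_(i <- l) mpoly.meval v (F i).
Proof. exact: raddf_sum. Qed.

Lemma meval_prod (v : 'I_n.+1 -> C) (I : finType) (F : I -> P) :
  mpoly.meval v (\prod_i F i) = \prod_i mpoly.meval v (F i).
Proof. exact: rmorph_prod. Qed.

Lemma mevalXn (v : 'I_n.+1 -> C) (f : P) k :
  mpoly.meval v (f ^+ k) = mpoly.meval v f ^+ k.
Proof. exact: rmorphXn. Qed.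

End HomogeneousPolynomials.

(** * The embedding by vertices and edges of the polytope *)

Section VeryAmple.
Import (canonicals, coercions) mpoly.
Variables (R : realType) (D : km_root_datum) (r : nat) (w : 'I_r -> 'I_(km_size D)).
Local Notation C := R[i].
Local Notation lray := (limit_ray w).
Local Notation rays := ('I_r * bool)%type.
Local Notation signs := {ffun 'I_r -> bool}.
Local Notation X := (toric_limit w).
Local Notation M := 'cV[int]_r.
Local Notation ev := (Defs.eval (@idfun C : {rmorphism C -> C})).
Variable psi : rays -> int.
Hypothesis psi_convex : strictly_convex w psi.
Implicit Types (A B : {set rays}) (m : M) (s : signs).

Lemma local_eq_ge s u : psi u <= pairing (lray u) (local_eq w s psi).
Proof.
have [us|/psi_convex/ltW//] := boolP (u \in sign_cone s).
by move: us; case: u => i b; rewrite inE => /eqP /= <-; rewrite pairing_local_eq.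
Qed.

Definition flip s j : signs := [ffun i => if i == j then ~~ s i else s i].

(* Lattice length of the edge from the vertex s to the vertex flip s j. *)
Definition edge_length s j : int :=
  pairing (lray (j, s j)) (local_eq w (flip s j) psi) - psi (j, s j).

Lemma edge_length_gt0 s j : 0 < edge_length s j.
Proof.
rewrite subr_gt0; apply: psi_convex; rewrite inE /= ffunE eqxx.
by case: (s j).
Qed.

Lemma local_eq_flip s j : local_eq w (flip s j) psi =
  local_eq w s psi + edge_length s j *: dual_vector w s j.
Proof.
apply: (sign_cone_inj (w := w) (s := s)) => i.
rewrite pairingDr pairingZr pairing_dual_vector pairing_local_eq.
have [->|ij] := eqVneq i j; first by rewrite mulr1 addrC subrK.
rewrite mulr0 addr0; have := pairing_local_eq w (flip s j) psi i.
by rewrite ffunE (negPf ij).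
Qed.

Local Notation index := (signs * option 'I_r)%type.

(* Exponents of the sections: the vertices of the polytope and the lattice
   points next to them on the edges. *)
Definition exponent (a : index) : M :=
  local_eq w a.1 psi + (if a.2 is Some j then dual_vector w a.1 j else 0).

(** The point next to a vertex is a convex combination of the ends of the edge; scaling by the edge
    length, at least 1, keeps the weights integral. *)
Lemma exponent_ge a u : psi u <= pairing (lray u) (exponent a).
Proof.
case: a => s [j|]; rewrite /exponent /=; last by rewrite addr0 local_eq_ge.
have l0 := edge_length_gt0 s j; rewrite -(ler_pM2l l0) -pairingZr scalerDr.
have -> : edge_length s j *: local_eq w s psi + edge_length s j *: dual_vector w s j =
    (edge_length s j - 1) *: local_eq w s psi + local_eq w (flip s j) psi.
  by rewrite local_eq_flip addrA (scalerBl (edge_length s j) 1) scale1r subrK.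
rewrite pairingDr pairingZr -[X in X * psi u](subrK 1) mulrDl mul1r.
by rewrite lerD ?local_eq_ge // ler_wpM2l ?local_eq_ge // subr_ge0 -gtz0_ge1.
Qed.

(** Exponent of the section of index [a] in the trivialisation over [A]. *)
Definition shifted A a : M := exponent a - chart_eq w psi A.

Lemma shifted_dual A a : chart (X := X) A -> dual_cone (X := X) A (shifted A a).
Proof.
move=> cA; apply/dual_coneP => u uA.
by rewrite pairingBr subr_ge0 (pairing_chart_eq _ cA uA) exponent_ge.
Qed.

Lemma shifted_dual_point A a (x : kpoint X C) : chart (X := X) A ->
  in_chart (X := X) A x -> dual_cone (pt_cone x) (shifted A a).
Proof. by move=> cA xA; apply: dual_coneS xA (shifted_dual a cA). Qed.

Lemma index_card_gt0 : (#|{: index}|.-1.+1 = #|{: index}|)%N.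
Proof. by rewrite prednK //; apply/card_gt0P; exists ([ffun=> true], None). Qed.

Local Notation N := (#|{: index}|.-1).

Definition index_of (k : 'I_N.+1) : index := enum_val (cast_ord index_card_gt0 k).
Definition ord_of (a : index) : 'I_N.+1 := cast_ord (esym index_card_gt0) (enum_rank a).

Lemma ord_ofK a : index_of (ord_of a) = a.
Proof. by rewrite /index_of /ord_of cast_ordKV enum_rankK. Qed.

Lemma index_ofK k : ord_of (index_of k) = k.
Proof. by rewrite /index_of /ord_of enum_valK cast_ordK. Qed.

Definition psi_section (k : 'I_N.+1) (A : {set ridx X}) : laurent R r :=
  [:: (1, shifted A (index_of k))].

Lemma hcoordE A (x : kpoint X C) k :
  hcoord psi_section A x k = pt_val x (shifted A (index_of k)).
Proof. by rewrite /hcoord /Defs.eval big_cons big_nil addr0 /= mul1r. Qed.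

Lemma shiftedD A B a : shifted B a + (chart_eq w psi B - chart_eq w psi A) = shifted A a.
Proof. by rewrite /shifted addrA subrK. Qed.

Lemma pt_val_shifted A B a (x : kpoint X C) : chart (X := X) A -> chart (X := X) B ->
  in_chart (X := X) A x -> in_chart (X := X) B x ->
  pt_val x (shifted A a) =
  pt_val x (chart_eq w psi B - chart_eq w psi A) * pt_val x (shifted B a).
Proof.
move=> cA cB xA xB; rewrite -(shiftedD A B) pt_valD ?shifted_dual_point 1?mulrC //.
exact/perp_dual_cone/chart_eq_perp_point.
Qed.

Lemma chart_eq_sign s : chart_eq w psi (sign_cone s) = local_eq w s psi.
Proof. by rewrite /chart_eq sign_coneK. Qed.

Lemma shifted_None s : shifted (sign_cone s) (s, None) = 0.
Proof. by rewrite /shifted chart_eq_sign /exponent addr0 subrr. Qed.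

Lemma shifted_Some s j : shifted (sign_cone s) (s, Some j) = dual_vector w s j.
Proof. by rewrite /shifted chart_eq_sign /exponent addrC addKr. Qed.

Lemma shifted_vertex B s :
  shifted B (s, None) = chart_eq w psi (sign_cone s) - chart_eq w psi B.
Proof. by rewrite /shifted /exponent /= addr0 chart_eq_sign. Qed.

(** By strict convexity the vertex section of [s] vanishes on every invariant divisor outside the
    cone of [s]. *)
Lemma vertex_section_chart B s (x : kpoint X C) : chart (X := X) B ->
  in_chart (X := X) B x -> pt_val x (shifted B (s, None)) != 0 ->
  in_chart (X := X) (sign_cone s) x.
Proof.
move=> cB xB; rewrite pt_val_neq0 => /perp_coneP h.
apply/fintype.subsetP => u ux; apply: contraT => /psi_convex.
have := h u ux; rewrite shifted_vertex pairingBr chart_eq_sign.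
rewrite (pairing_chart_eq _ cB) ?(fintype.subsetP xB) // => /eqP.
by rewrite subr_eq0 => /eqP->; rewrite ltxx.
Qed.

Lemma hits_chart p s (x : kpoint X C) : hits psi_section p x ->
  p (ord_of (s, None)) != 0 ->
  in_chart (X := X) (sign_cone s) x /\ forall a,
    p (ord_of a) = p (ord_of (s, None)) * pt_val x (shifted (sign_cone s) a).
Proof.
move=> [B [c [cB xB c0] pE]].
rewrite pE hcoordE ord_ofK mulf_eq0 negb_or => /andP[_ ps].
have xs := vertex_section_chart cB xB ps; split=> // a.
have cs : chart (X := X) (sign_cone s) := chart_sign_cone w s.
rewrite !pE !hcoordE !ord_ofK (pt_val_shifted a cB cs xB xs) shifted_vertex.
by rewrite mulrA.
Qed.

Lemma hits_sign p (x : kpoint X C) : hits psi_section p x ->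
  exists s, p (ord_of (s, None)) != 0.
Proof.
move=> [B [c [cB xB c0] pE]]; exists (cone_sign B).
rewrite pE hcoordE ord_ofK {1}(chartE cB) shifted_None pt_val0 mulr1 //.
Qed.

Lemma psi_section_injective : injective_morphism psi_section.
Proof.
move=> x y p px py; have [s s0] := hits_sign px.
have [xs xE] := hits_chart px s0; have [ys yE] := hits_chart py s0.
apply: (kpoint_coord_eq xs ys) => j.
have := xE (s, Some j); rewrite yE shifted_Some => /(mulfI s0) //.
Qed.

Lemma psi_section_generates : generates psi_section.
Proof.
move=> A x cA xA; exists (ord_of (cone_sign A, None)).
by rewrite hcoordE ord_ofK {1}(chartE cA) shifted_None pt_val0 oner_neq0.
Qed.

Local Notation P := (mpoly.mpoly N.+1 C).
Local Notation var a := (mpoly.mpolyX C (mpoly.mnm1 (ord_of a)) : P).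

Definition edeg s m : nat := (\sum_i `|pairing (lray (i, s i)) m|)%N.

(** A chart coordinate is an edge coordinate over the vertex coordinate; the power of the latter
    brings the total degree to [d]. *)
Definition hmonomial s d m : P :=
  var (s, None) ^+ (d - edeg s m) *
  \prod_i var (s, Some i) ^+ `|pairing (lray (i, s i)) m|.

Definition homogenize s d (p : laurent R r) : P :=
  \sum_(t <- p) t.1 *: hmonomial s d t.2.

Definition degree_bound s (p : laurent R r) : nat := (\sum_(t <- p) edeg s t.2)%N.

Lemma degree_boundP s p t : t \in p -> (edeg s t.2 <= degree_bound s p)%N.
Proof. by move=> tp; rewrite /degree_bound (big_rem t tp) /= leq_addr. Qed.

Lemma homogenize_homog s d p : (degree_bound s p <= d)%N ->
  homogeneous d (homogenize s d p).
Proof.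
move=> pd; apply: homog_sum => t tp; apply: homogZ.
have td := leq_trans (degree_boundP s tp) pd.
have := homogM (homog_varX C (ord_of (s, None)) (d - edeg s t.2)%N)
  (homog_prod (fun i => homog_varX C (ord_of (s, Some i)) `|pairing (lray (i, s i)) t.2|%N)).
by rewrite /homogeneous !homogE -/(edeg s t.2) subnK.
Qed.

Lemma meval_homogenize s d p (v : 'I_N.+1 -> C) (x : kpoint X C) :
  (degree_bound s p <= d)%N -> in_chart (X := X) (sign_cone s) x ->
  regular_on (X := X) (sign_cone s) p ->
  (forall i, v (ord_of (s, Some i)) =
     v (ord_of (s, None)) * pt_val x (dual_vector w s i)) ->
  mpoly.meval v (homogenize s d p) = v (ord_of (s, None)) ^+ d * ev x p.
Proof.
move=> pd xs /allP pr vE; rewrite /homogenize meval_sum /Defs.eval mulr_sumr.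
apply: eq_big_seq => t tp; rewrite mpoly.mevalZ /= mulrCA; congr (_ * _).
have td := leq_trans (degree_boundP s tp) pd.
rewrite /hmonomial mpoly.mevalM mevalXn mpoly.mevalXU meval_prod.
rewrite (pt_val_dual xs) ?pr // -{2}(subnK td) exprD -mulrA; congr (_ * _).
rewrite /edeg -prodrXr -big_split; apply: eq_bigr => i _ /=.
by rewrite mevalXn mpoly.mevalXU vE exprMn.
Qed.

(** On a chart the vertex section is 1 and the edge sections are the coordinates, so homogenised
    functions take their original values. *)
Lemma psi_section_stalk_surjective : stalk_surjective psi_section.
Proof.
move=> A x cA xA a b ar br bx; have AE := chartE cA.
set s := cone_sign A in AE.
pose d := maxn (degree_bound s a) (degree_bound s b).
have H y p : in_chart (X := X) A y -> regular_on (X := X) A p ->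
    (degree_bound s p <= d)%N ->
    mpoly.meval (hcoord psi_section A y) (homogenize s d p) = ev y p.
  rewrite AE => ys pr pd; rewrite (meval_homogenize pd ys pr).
    by rewrite hcoordE ord_ofK shifted_None pt_val0 expr1n mul1r.
  by move=> i; rewrite !hcoordE !ord_ofK shifted_None pt_val0 mul1r shifted_Some.
exists d, (homogenize s d a), (homogenize s d b); split.
- by apply: homogenize_homog; rewrite leq_maxl.
- by apply: homogenize_homog; rewrite leq_maxr.
- by rewrite H // leq_maxr.
by move=> y yA; rewrite !H ?leq_maxl ?leq_maxr // mulrC.
Qed.

(* The equations of the image contain the toric relations along the edges,
   which force some vertex coordinate to be nonzero, and the homogenised
   equations of Z on the corresponding chart. *)
Lemma psi_section_closed : closed_morphism psi_section.
Proof.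
move=> Z Zcl.
exists [set f : P | (exists d, homogeneous d f) /\
  forall x p, Z x -> hits psi_section p x -> mpoly.meval p f = 0].
split=> [f []//|p [k pk]]; split=> [pF|[x Zx px] f [_ fZ]]; last exact: fZ px.
have [s s0] : exists s, p (ord_of (s, None)) != 0.
  case kE: (index_of k) => [s [j|]]; last by exists s; rewrite -kE index_ofK.
  have [l lE] : exists l, edge_length s j = l.+1%:Z.
    have l0 := edge_length_gt0 s j; exists `|edge_length s j|.-1.
    by rewrite prednK ?gez0_abs ?(ltW l0) // absz_gt0 gt_eqF.
  exists (flip s j).
  (* For a vertex v, a dual vector d and the other end v' = v + (l + 1) d, this is the relation (l +
     1)(v + d) = l v + v'. *)
  pose f : P := var (s, Some j) ^+ l.+1 - var (s, None) ^+ l * var (flip s j, None).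
  have : mpoly.meval p f = 0.
    apply: pF; split.
      exists l.+1; apply: homogB.
        exact: homog_varX.
      have := homogM (homog_varX C (ord_of (s, None)) l)
        (homog_var C (ord_of (flip s j, None))).
      by rewrite !homogE addn1.
    move=> x q _ [B [c [cB xB c0] qE]].
    rewrite mpoly.mevalB mpoly.mevalM !mevalXn !mpoly.mevalXU !qE !hcoordE !ord_ofK.
    apply/eqP; rewrite subr_eq0 !exprMn mulrACA -exprSr; apply/eqP; congr (_ * _).
    have dB a : dual_cone (pt_cone x) (shifted B a) by exact: shifted_dual_point.
    have dMn m' n : dual_cone (pt_cone x) m' -> dual_cone (pt_cone x) (m' *+ n).
      move=> h; elim: n => [|n IH]; last by rewrite mulrS dual_coneD.
      by rewrite mulr0n; apply/perp_dual_cone/perp_cone0.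
    rewrite -!pt_valMn // -pt_valD ?dMn //; congr (pt_val x _).
    rewrite /shifted /exponent /= !addr0 local_eq_flip lE.
    rewrite -[Posz l.+1]natz scaler_nat addrAC mulrnDl mulrSr -addrA.
    by congr (_ + _); rewrite addrAC.
  rewrite /f mpoly.mevalB mpoly.mevalM !mevalXn !mpoly.mevalXU => /eqP.
  rewrite subr_eq0 => /eqP E; apply: contraNneq pk => h.
  move: E; rewrite h mulr0 => /eqP; rewrite expf_eq0 /= => /eqP.
  by rewrite -[k]index_ofK kE => ->.
pose c := p (ord_of (s, None)).
(* The preimage of [p]: edge coordinates divided by the vertex coordinate. *)
pose x := coord_point w s (fun j => p (ord_of (s, Some j)) / c).
have cs : chart (X := X) (sign_cone s) := chart_sign_cone w s.
have xs : in_chart (X := X) (sign_cone s) x := coord_point_chart w s _.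
have pS i : p (ord_of (s, Some i)) = c * pt_val x (dual_vector w s i).
  by rewrite coord_point_coord mulrC divfK.
have qS q y : hits psi_section q y -> q (ord_of (s, None)) != 0 ->
    forall i, q (ord_of (s, Some i)) =
      q (ord_of (s, None)) * pt_val y (dual_vector w s i).
  by move=> qy q0 i; have [_ ->] := hits_chart qy q0; rewrite shifted_Some.
have px : hits psi_section p x.
  exists (sign_cone s), c; first by split.
  move=> l; rewrite -[l]index_ofK; move: (index_of l) => a.
  rewrite hcoordE ord_ofK.
  pose g : laurent R r := [:: (1, shifted (sign_cone s) a)].
  have gr : regular_on (X := X) (sign_cone s) g by rewrite /regular_on /= shifted_dual.
  have evg y : ev y g = pt_val y (shifted (sign_cone s) a).
    by rewrite /Defs.eval big_cons big_nil addr0 /= mul1r.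
  pose d := degree_bound s g.
  (* The leading factor makes the equation hold at image points off the chart of [s], where the
     vertex coordinate is 0. *)
  pose f : P := var (s, None) *
    (var a * var (s, None) ^+ d - var (s, None) * homogenize s d g).
  have : mpoly.meval p f = 0.
    apply: pF; split.
      exists (1 + (1 + d))%N; apply: homogM; first exact: homog_var.
      apply: homogB; apply: homogM; try exact: homog_var.
        exact: homog_varX.
      exact: homogenize_homog.
    move=> y q _ qy; rewrite mpoly.mevalM mpoly.mevalXU.
    have [->|q0] := eqVneq (q (ord_of (s, None))) 0; first by rewrite mul0r.
    have [ys qE] := hits_chart qy q0.
    rewrite mpoly.mevalB !mpoly.mevalM mevalXn !mpoly.mevalXU.
    rewrite (meval_homogenize (leqnn _) ys gr (qS q y qy q0)) evg.
    by rewrite (qE a) -mulrA [pt_val y _ * _]mulrC subrr mulr0.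
  rewrite mpoly.mevalM mpoly.mevalB !mpoly.mevalM mevalXn !mpoly.mevalXU.
  rewrite (meval_homogenize (leqnn _) xs gr pS) evg -/c => /eqP.
  rewrite mulf_eq0 (negPf s0) /= subr_eq0 mulrCA [p _ * _]mulrC => /eqP.
  by move/(mulfI (expf_neq0 _ s0)).
exists x => //; have [Fs [Fr FZ]] := Zcl _ cs.
apply/(FZ x xs) => g Fg; have gr := Fr g Fg.
pose d := degree_bound s g.
(* Again the factor covers the points of [Z] off the chart. *)
pose f : P := var (s, None) * homogenize s d g.
have : mpoly.meval p f = 0.
  apply: pF; split.
    exists (1 + d)%N; apply: homogM; [exact: homog_var | exact: homogenize_homog].
  move=> y q Zy qy; rewrite mpoly.mevalM mpoly.mevalXU.
  have [->|q0] := eqVneq (q (ord_of (s, None))) 0; first by rewrite mul0r.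
  have [ys qE] := hits_chart qy q0.
  rewrite (meval_homogenize (leqnn _) ys gr (qS q y qy q0)).
  by rewrite (proj1 (FZ y ys) Zy g Fg) !mulr0.
rewrite mpoly.mevalM mpoly.mevalXU (meval_homogenize (leqnn _) xs gr pS) => /eqP.
by rewrite !mulf_eq0 expf_eq0 (negPf s0) andbF /= => /eqP.
Qed.

Lemma strictly_convex_very_ample (L : cocycle R X) :
  (forall A B, chart (X := X) A -> chart (X := X) B -> forall x : kpoint X C,
     in_chart (X := X) A x -> in_chart (X := X) B x ->
     ev x (L A B) = pt_val x (chart_eq w psi B - chart_eq w psi A)) ->
  very_ample L.
Proof.
move=> LE; exists N, psi_section.
  move=> k; split=> [A cA|A B cA cB x xA xB].
    by rewrite /regular_on /= shifted_dual.
  rewrite LE // -!/(hcoord psi_section _ _ _) !hcoordE.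
  exact: pt_val_shifted.
split; [exact: psi_section_generates | exact: psi_section_injective |
  exact: psi_section_closed | exact: psi_section_stalk_surjective].
Qed.

End VeryAmple.

(** * The Mori cone *)

Lemma continuous_linear_combination (R : realType) (T : topologicalType)
    (I : Type) (l : seq I) (q : I -> R) (f : T -> R) (g : I -> T -> R) :
  continuous f -> (forall k, continuous (g k)) ->
  continuous (fun z => f z - \sum_(k <- l) q k * g k z).
Proof.
move=> cf cg x; apply: (cvgB (cf x)).
suff h : continuous (fun z => \sum_(k <- l) q k * g k z) by exact: h.
move=> {x}; elim: l => [|k l IH] x.
  have -> : (fun z => \sum_(k <- [::]) q k * g k z) = (fun=> 0).
    by apply/funext => z; rewrite big_nil.
  exact: cvg_cst.
have -> : (fun z => \sum_(j <- k :: l) q j * g j z) =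
    (fun z => q k * g k z + \sum_(j <- l) q j * g j z).
  by apply/funext => z; rewrite big_cons.
have ck : continuous (fun z => q k * g k z) by move=> y; exact: (cvgMr (cg k y)).
exact: (cvgD (ck x) (IH x)).
Qed.

(** * Closed conditions and pointwise limits *)

Section PointwiseClosure.
Variables (R : realType) (T : Type) (A : set {ptws T -> R}).

Lemma closure_closed_preimage (f : {ptws T -> R} -> R) (F : set R) z :
  continuous f -> closed F -> (forall a, A a -> F (f a)) -> closure A z -> F (f z).
Proof.
move=> cf Fcl AF zA.
have cl : closed (f @^-1` F) by apply: closed_comp => // x _; exact: cf.
have := closure_subset (AF : A `<=` f @^-1` F) zA.
by rewrite -(closure_id _).1.
Qed.

Lemma ptws_eval_continuous (t : T) : continuous (fun z : {ptws T -> R} => z t).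
Proof.
pose T' : eqType := HB.pack_for eqType T (gen_eqMixin T).
exact: (@proj_continuous T' (fun=> R) t).
Qed.

(** A relation between finitely many values is closed for pointwise convergence, so it passes from
    curves to the Mori cone. *)
Lemma closure_linear_relation (I : finType) (t : T) (q : I -> R) (b : I -> T) z :
  (forall a, A a -> a t = \sum_k q k * a (b k)) -> closure A z ->
  z t = \sum_k q k * z (b k).
Proof.
move=> Aq zA; apply/eqP; rewrite -subr_eq0; apply/eqP.
apply: (@closure_closed_preimage (fun z => z t - \sum_k q k * z (b k)) [set 0] z) zA.
- apply: continuous_linear_combination => [|k]; exact: ptws_eval_continuous.
- exact: closed_eq.
- by move=> a /Aq ->; rewrite /= subrr.
Qed.

Lemma closure_ge0 (t : T) z : (forall a, A a -> 0 <= a t) -> closure A z -> 0 <= z t.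
Proof.
move=> Ap zA.
apply: (@closure_closed_preimage (fun z => z t) [set x | 0 <= x] z) zA.
- exact: ptws_eval_continuous.
- exact: closed_ge.
- exact: Ap.
Qed.

End PointwiseClosure.

(** * Coordinates and extremal rays of the Mori cone *)

Section MoriCone.
Variables (R : realType) (D : km_root_datum) (r : nat) (w : 'I_r -> 'I_(km_size D)).
Local Notation X := (toric_limit w).
Local Notation B k := (psi_bundle R w (dual_psi w k)).
Implicit Types (L : cocycle R X) (z : num_class R X).

Lemma curve_class_decomposition z : curve_class z ->
  [/\ forall L psi c, is_line_bundle L -> represents L psi c ->
        z L = \sum_k (prim_degree w k psi)%:~R * z (B k),
      forall k, 0 <= z (B k) & forall L, ~ is_line_bundle L -> z L = 0].
Proof.
move=> [K [iota [x gx zE]]].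
have zB k : z (B k) = (degree iota (B k) x)%:~R.
  by rewrite zE asboolT //; exact: psi_bundle_line_bundle.
split=> [L psi c LL Lpsi|k|L nL]; last by rewrite zE asboolF.
  rewrite zE asboolT // (degree_decomposition gx Lpsi) rmorph_sum.
  by apply: eq_bigr => k _; rewrite rmorphM zB.
by rewrite zB ler0z degree_dual_psi_ge0.
Qed.

Lemma mori_cone_decomposition z : mori_cone z ->
  [/\ forall L psi c, is_line_bundle L -> represents L psi c ->
        z L = \sum_k (prim_degree w k psi)%:~R * z (B k),
      forall k, 0 <= z (B k) & forall L, ~ is_line_bundle L -> z L = 0].
Proof.
move=> zM; split=> [L psi c LL Lpsi|k|L nL].
- apply: (closure_linear_relation _ zM) => y [n [a [c' [a0 cc] yE]]].
  rewrite yE; under [RHS]eq_bigr do rewrite yE mulr_sumr.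
  rewrite exchange_big /=; apply: eq_bigr => i _.
  have [cE _ _] := curve_class_decomposition (cc i).
  rewrite (cE _ _ _ LL Lpsi) mulr_sumr; apply: eq_bigr => k _; exact: mulrCA.
- apply: (closure_ge0 _ zM) => y [n [a [c' [a0 cc] yE]]].
  rewrite yE; apply: sumr_ge0 => i _; apply: mulr_ge0; first exact: a0.
  by have [_ h _] := curve_class_decomposition (cc i).
(* Vanishing is written as an empty linear relation, which passes to the closure. *)
have -> : 0 = \sum_(i < 0) (fun=> 0 : R) i * z L by rewrite big_ord0.
apply: (closure_linear_relation (b := fun=> L) _ zM) => y [n [a [c' [a0 cc] yE]]].
rewrite big_ord0 yE big1 // => i _.
by have [_ _ ->] := curve_class_decomposition (cc i); rewrite ?mulr0.
Qed.

Lemma mori_cone_eq0 z : mori_cone z -> (forall k, z (B k) = 0) -> z = (fun=> 0).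
Proof.
move=> /mori_cone_decomposition[zE _ z0] zB; apply/funext => L.
have [LL|/z0//] := pselect (is_line_bundle L).
have [psi [c Lpsi]] := line_bundle_represents LL.
by rewrite (zE _ _ _ LL Lpsi) big1 // => k _; rewrite zB mulr0.
Qed.

Lemma prim_class_dual i k : prim_class R w i (B k) = (i == k)%:R.
Proof.
rewrite (prim_class_represents _ _ _ _ _ _ (psi_bundle_line_bundle R w _)
  (psi_bundle_represents R w _)).
by have [-> _ _] := dual_psiP w k; case: eqP.
Qed.

Lemma prim_class_mori_cone i : mori_cone (prim_class R w i).
Proof.
apply: subset_closure; exists 1%N, (fun=> 1), (fun=> prim_class R w i).
  by split=> // _; exact: prim_class_curve.
by move=> L; rewrite big_ord_recl big_ord0 addr0 mul1r.
Qed.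

Lemma prim_class_ray u i : mori_cone u -> (forall k, k != i -> u (B k) = 0) ->
  u = (fun L => u (B i) * prim_class R w i L).
Proof.
move=> uM u0; have [uE _ un] := mori_cone_decomposition uM; apply/funext => L.
have [_ _ pn] := mori_cone_decomposition (@prim_class_mori_cone i).
have [LL|nL] := pselect (is_line_bundle L); last by rewrite un // pn // mulr0.
have [psi [c Lpsi]] := line_bundle_represents LL.
rewrite (uE _ _ _ LL Lpsi) (prim_class_represents _ _ _ _ _ _ LL Lpsi) (bigD1 i) //= mulrC.
by rewrite big1 ?addr0 // => k /u0->; rewrite mulr0.
Qed.

(** Two classes with sum on the ray have nonnegative coordinates with sum 0 off [i], so each is a
    multiple of the primitive class. *)
Lemma prim_class_extremal i : extremal_ray
  [set z | exists2 t : R, 0 <= t & z = (fun L => t * prim_class R w i L)].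
Proof.
split.
  exists (prim_class R w i); split=> //; first exact: prim_class_mori_cone.
  move=> /(congr1 (fun z => z (B i))); rewrite prim_class_dual eqxx => /eqP.
  by rewrite oner_eq0.
move=> u v uM vM [t t0 uv].
have [_ up _] := mori_cone_decomposition uM.
have [_ vp _] := mori_cone_decomposition vM.
have uv0 k : k != i -> u (B k) = 0 /\ v (B k) = 0.
  move=> ki; have /eqP := congr1 (fun z => z (B k)) uv.
  rewrite /= prim_class_dual (eq_sym i) (negPf ki) mulr0 paddr_eq0 //.
  by case/andP => /eqP -> /eqP ->.
split.
  by exists (u (B i)) => //; apply: prim_class_ray => // k /uv0[].
by exists (v (B i)) => //; apply: prim_class_ray => // k /uv0[].
Qed.

Lemma prim_class_canonical i :
  prim_class R w i (canonical_bundle R (X := X)) = (prim_degree w i (fun=> 1))%:~R.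
Proof.
exact: (prim_class_represents _ _ _ _ _ _ (canonical_line_bundle R w) (canonical_represents R w)).
Qed.

Lemma fano_mori_ray (S : set (num_class R X)) :
  fano R X -> extremal_ray S -> mori_ray S.
Proof.
move=> fanoX [[u [uM _ ->]] _] z [t t0 zE] z0.
have [uE up _] := mori_cone_decomposition uM.
have := uE _ _ _ (canonical_line_bundle R w) (canonical_represents R w).
rewrite zE => ->; rewrite mulr_sumr.
(* A nonzero class has a nonzero coordinate, which makes a sum of nonpositive terms strictly
   negative. *)
have [k uk] : exists k, t * u (B k) != 0.
  apply: contrapT => h; apply: z0; rewrite zE.
  have [->|tn] := eqVneq t 0; first by apply/funext => L; rewrite mul0r.
  rewrite (mori_cone_eq0 uM) => [|k]; first by apply/funext => L; rewrite mulr0.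
  apply: contrapT => /eqP uk; apply: h; exists k.
  by rewrite mulf_neq0.
have neg i : (prim_degree w i (fun=> 1))%:~R < 0 :> R.
  by rewrite ltrz0; apply: ample_prim_degree fanoX.
have le0 i : t * ((prim_degree w i (fun=> 1))%:~R * u (B i)) <= 0.
  by rewrite mulrCA nmulr_rle0 // mulr_ge0.
rewrite (bigD1 k) //=; apply: ltr_wnDr; first by apply: sumr_le0.
by rewrite mulrCA nmulr_rlt0 // lt_def uk mulr_ge0.
Qed.

(** The constant function -2 represents -2K and has positive degree on every primitive class. *)
Lemma prim_degree_fano :
  (forall i, prim_degree w i (fun=> 1) < 0) -> fano R X.
Proof.
move=> neg; exists 2%N => //.
apply: (@strictly_convex_very_ample _ _ _ _ (fun=> -2)).
  apply: strictly_convex_criterion => i.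
  have := prim_degreeZ w i (-2) (fun=> 1); rewrite mulr1 => ->.
  by rewrite nmulr_rgt0.
move=> A A' cA cA' x xA xA'.
rewrite eval_dual_exp_canonical // -rmorphXn frame_det_sqr // rmorph1 mul1r.
rewrite -pt_valMn; last exact/perp_dual_cone/chart_eq_perp_point.
have E A0 : chart_eq w (fun=> -2) A0 = -2 *: chart_eq w (fun=> 1) A0.
  rewrite /chart_eq -local_eqZ; apply: eq_local_eq => i.
  by rewrite mulr1.
congr (pt_val x _); rewrite !E -scalerBr scaleNr -scalerN opprB.
by rewrite -scaler_nat.
Qed.

End MoriCone.

Theorem corollary7p12 (R : realType) (D : km_root_datum) (r : nat)
    (w : 'I_r -> 'I_(km_size D)) :
  fano R (toric_limit w) <->
  (forall S : set (num_class R (toric_limit w)), extremal_ray S -> mori_ray S).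
Proof.
split=> [fanoX S|mori]; first exact: fano_mori_ray.
(* The ray of each primitive class is extremal, so the hypothesis gives K negative degree on it; the
   class is nonzero, having degree 1 on its dual bundle. *)
apply: prim_degree_fano => i; rewrite -(ltrz0 R) -prim_class_canonical.
apply: (mori _ (prim_class_extremal R w i) (prim_class R w i)).
  by exists 1 => //; apply/funext => L; rewrite mul1r.
move=> /(congr1 (fun z => z (psi_bundle R w (dual_psi w i)))).
by rewrite prim_class_dual eqxx => /eqP; rewrite oner_eq0.
Qed.
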